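(* Let $\alpha,\gamma>0$, let $\theta_1,\theta_2\in\mathbb{R}$, and suppose that $q=\alpha\gamma>1$. Put $\zeta=e^{\pi i\theta_1/\alpha}$ and $\eta=e^{\pi i\theta_2/\gamma}$. Then: (i) Every $v\in BV((1,q))$ is the restriction to $(1,q)$ of an element of $\mathcal{A}^{BV}_{q,\zeta,\eta}$. (ii) If $(\zeta,\eta)\ne(1,1)$, then for each $v\in BV((1,q))$ the element of $\mathcal{A}^{BV}_{q,\zeta,\eta}$ whose restriction to $(1,q)$ is $v$ is unique. If $(\zeta,\eta)=(1,1)$, there is a fixed nonzero $\Psi\in\mathcal{A}^{BV}_{q,1,1}$ (independent of $v$) vanishing almost everywhere on $(1,q)$ such that, for each $v\in BV((1,q))$, the set of all $F\in\mathcal{A}^{BV}_{q,1,1}$ with $F|_{(1,q)}=v$ is an affine line $F_v+\mathbb{C}\Psi$. (iii) The pre-annihilator $\mathcal{A}_{\alpha,\gamma,\theta_1,\theta_2}$ of the shifted lattice cross is infinite-dimensional. Consequently, $(\Gamma_+,\Lambda_{\alpha,\gamma,\theta_1,\theta_2})$ is not a Heisenberg uniqueness pair.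
   Context: Write $\mathbb{R}_+=(0,\infty)$. Functions are complex valued and identities between $L^1$ functions hold almost everywhere. For an interval $J$, $BV(J)$ is the space of $h\in L^1(J)$ having a representative of finite total variation, with norm $\|h\|_{BV(J)}=\|h\|_{L^1(J)}+\operatorname{Var}_J(h)$. Let $\Gamma_+=\{(t,t^{-1}):t>0\}\subset\mathbb{R}^2$ and $$\Lambda_{\alpha,\gamma,\theta_1,\theta_2}=\big((2\alpha\mathbb{Z}+\theta_1)\times\{0\}\big)\cup\big(\{0\}\times(2\gamma\mathbb{Z}+\theta_2)\big).$$ The Fourier transform of a finite complex Borel measure $\mu$ on $\mathbb{R}^2$ is $\widehat\mu(\xi,\eta)=\int_{\mathbb{R}^2}e^{\pi i(x\xi+y\eta)}\,d\mu(x,y)$. For a curve $\Gamma\subset\mathbb{R}^2$ and a set $\Lambda\subset\mathbb{R}^2$, $(\Gamma,\Lambda)$ is a Heisenberg uniqueness pair if every finite complex Borel measure $\mu$ supported on $\Gamma$, absolutely continuous with respect to arc length on $\Gamma$, and with $\widehat\mu=0$ on $\Lambda$, is zero. The pre-annihilator $\mathcal{A}_{\alpha,\gamma,\theta_1,\theta_2}$ of the shifted cross is the set of $f\in L^1(\mathbb{R}_+)$ such that $$\int_{\mathbb{R}_+}f(t)e^{\pi i(2m\alpha+\theta_1)t}\,dt=0\ (m\in\mathbb{Z}),\qquad \int_{\mathbb{R}_+}f(t)e^{\pi i(2n\gamma+\theta_2)/t}\,dt=0\ (n\in\mathbb{Z}).$$ The normalized pre-annihilator $\mathcal{A}_{q,\zeta,\eta}\subset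 L^1(\mathbb{R}_+)$ is the image of $\mathcal{A}_{\alpha,\gamma,\theta_1,\theta_2}$ under the isometry $f\mapsto F$, $F(x)=\alpha^{-1}f(x/\alpha)$, of $L^1(\mathbb{R}_+)$ (it depends only on $q,\zeta,\eta$). Its global $BV$ core is $\mathcal{A}^{BV}_{q,\zeta,\eta}=\mathcal{A}_{q,\zeta,\eta}\cap BV(\mathbb{R}_+)$. *)

(* Defs.v *)
From HB Require Import structures.
From mathcomp Require Export all_boot all_order all_algebra.
From mathcomp Require Export complex.
From mathcomp Require Export all_classical all_reals all_analysis.

Set Implicit Arguments.
Unset Strict Implicit.
Unset Printing Implicit Defensive.

Import Order.TTheory GRing.Theory Num.Theory.
Import numFieldNormedType.Exports.

Local Open Scope classical_set_scope.
Local Open Scope ring_scope.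
Local Open Scope complex_scope.

Section complex_L1.
Context (R : realType).
Implicit Types (J : set R) (f g : R -> R[i]).

Definition Rplus : set R := `]0, +oo[%classic.

Definition eq_ae J f g : Prop := ae_eq (@lebesgue_measure R) J f g.

(* Elements of L^1(J) are handled through representatives R -> R[i], whose
   values outside J are irrelevant and which are compared by [eq_ae J]. *)
Definition L1 J : set (R -> R[i]) := [set f |
  (@lebesgue_measure R).-integrable J (fun x => (complex.Re (f x))%:E) /\
  (@lebesgue_measure R).-integrable J (fun x => (complex.Im (f x))%:E)].

Definition cintegral J f : R[i] :=
  Rintegral (@lebesgue_measure R) J (fun x => complex.Re (f x)) +i*
  Rintegral (@lebesgue_measure R) J (fun x => complex.Im (f x)).

(* e^{pi i s} *)
Definition expipi (s : R) : R[i] := cos (pi * s) +i* sin (pi * s).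

(* Var_J(g): supremum over the increasing finite sequences of points of J. *)
Definition Var J g : \bar R :=
  ereal_sup [set (\sum_(i < (size s).-1) Normc.normc (g s`_i.+1 - g s`_i))%:E
            | s in [set s : seq R | sorted <%R s /\ {in s, forall x, J x}]].

Definition BV J : set (R -> R[i]) := [set h |
  L1 J h /\ exists2 g, eq_ae J h g & (Var J g < +oo)%E].

End complex_L1.
Arguments Rplus {R}.

Section pre_annihilator.
Context (R : realType).

Definition pre_annihilator (alpha gamma theta1 theta2 : R) : set (R -> R[i]) :=
  [set f | [/\ L1 Rplus f,
    forall m : int, cintegral Rplus
      (fun t => f t * expipi ((2 * m%:~R * alpha + theta1) * t)) = 0 &
    forall n : int, cintegral Rplus
      (fun t => f t * expipi ((2 * n%:~R * gamma + theta2) / t)) = 0]].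

(* A_{q,zeta,eta} for q = alpha * gamma, zeta = expipi (theta1 / alpha) and
   eta = expipi (theta2 / gamma). *)
Definition normalized_pre_annihilator (alpha gamma theta1 theta2 : R) :
    set (R -> R[i]) :=
  [set F | L1 Rplus F /\
    exists2 f, pre_annihilator alpha gamma theta1 theta2 f &
      eq_ae Rplus F (fun x => (alpha^-1)%:C * f (x / alpha))].

Definition BV_core (alpha gamma theta1 theta2 : R) : set (R -> R[i]) :=
  normalized_pre_annihilator alpha gamma theta1 theta2 `&` BV Rplus.

(* A set V of functions, viewed in L^1(J), is spanned by finitely many of its
   elements. *)
Definition finite_dimensional (J : set R) (V : set (R -> R[i])) : Prop :=
  exists n (b : 'I_n -> R -> R[i]), (forall i, V (b i)) /\
    forall f, V f -> exists c : 'I_n -> R[i],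
      eq_ae J f (fun x => \sum_(i < n) c i * b i x).

End pre_annihilator.

(* The product sigma-algebra, i.e. the Borel sets of the plane. *)
Notation plane R := (measurableTypeR R * measurableTypeR R)%type.

Section complex_measure.
Context d (T : measurableType d) (R : realType).

Record complex_measure := ComplexMeasure {
  re_charge : {charge set T -> \bar R};
  im_charge : {charge set T -> \bar R} }.

Definition cmeasure (mu : complex_measure) (A : set T) : R[i] :=
  fine (re_charge mu A) +i* fine (im_charge mu A).

(* The Jordan decomposition does not depend on the chosen Hahn
   decomposition. *)
Definition charge_integral (nu : {charge set T -> \bar R}) (f : T -> R) : R :=
  let nuPN := projT2 (cid (projT2 (cid (Hahn_decomposition nu)))) in
  Rintegral (jordan_pos nuPN) setT f - Rintegral (jordan_neg nuPN) setT f.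

Definition cmeasure_integral (mu : complex_measure) (f : T -> R[i]) : R[i] :=
  let re x := complex.Re (f x) in
  let im x := complex.Im (f x) in
  (charge_integral (re_charge mu) re - charge_integral (im_charge mu) im) +i*
  (charge_integral (im_charge mu) re + charge_integral (re_charge mu) im).

End complex_measure.

Section Heisenberg.
Context (R : realType).

(* A curve in the plane, presented by an injective C^1 parametrization. *)
Record plane_curve := PlaneCurve {
  curve_dom : interval R;
  curve_x : R -> R;
  curve_y : R -> R;
  curve_inj : {in curve_dom &, injective (fun t => (curve_x t, curve_y t))};
  curve_derivable : {in curve_dom, forall t,
    derivable curve_x t 1 /\ derivable curve_y t 1};
  curve_C1 : {in curve_dom, continuous (derive1 curve_x)} /\
             {in curve_dom, continuous (derive1 curve_y)} }.

Definition curve_image (G : plane_curve) : set (plane R) :=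
  [set (curve_x G t, curve_y G t) | t in [set` curve_dom G]].

Definition arc_length (G : plane_curve) (A : set (plane R)) : \bar R :=
  (\int[@lebesgue_measure R]_(t in
      [set t | t \in curve_dom G /\ A (curve_x G t, curve_y G t)])
    (Num.sqrt (derive1 (curve_x G) t ^+ 2 + derive1 (curve_y G) t ^+ 2))%:E)%E.

Definition supported_on (mu : complex_measure (plane R) R)
    (S : set (plane R)) : Prop :=
  forall A, measurable A -> A `&` S = set0 -> cmeasure mu A = 0.

Definition abs_continuous_arc_length (mu : complex_measure (plane R) R)
    (G : plane_curve) : Prop :=
  forall A, measurable A -> arc_length G A = 0%E -> cmeasure mu A = 0.

Definition fourier (mu : complex_measure (plane R) R) (z : R * R) : R[i] :=
  cmeasure_integral mu (fun p => expipi (p.1 * z.1 + p.2 * z.2)).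

Definition Heisenberg_uniqueness_pair (G : plane_curve) (L : set (R * R)) :
    Prop :=
  forall mu : complex_measure (plane R) R,
    supported_on mu (curve_image G) ->
    abs_continuous_arc_length mu G ->
    (forall z, L z -> fourier mu z = 0) ->
    forall A, measurable A -> cmeasure mu A = 0.

Definition lattice_cross (alpha gamma theta1 theta2 : R) : set (R * R) :=
  [set (2 * alpha * m%:~R + theta1, 0) | m in [set: int]] `|`
  [set (0, 2 * gamma * n%:~R + theta2) | n in [set: int]].

Let hyp_dom : interval R := `]0, +oo[.

Let hyp_neq0 (t : R) : t \in hyp_dom -> t != 0.
Proof. by rewrite in_itv/= andbT => /lt0r_neq0. Qed.

Let hyp_inj : {in hyp_dom &, injective (fun t : R => (t, t^-1))}.
Proof. by move=> s t _ _ []. Qed.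

Let hyp_derivable : {in hyp_dom, forall t : R,
  derivable (fun t : R => t) t 1 /\ derivable (fun t : R => t^-1) t 1}.
Proof.
move=> t /hyp_neq0 t0; split; first exact: derivable_id.
by apply: (@derivableV R R id t 1) => //; exact: derivable_id.
Qed.

Let hyp_C1 : {in hyp_dom, continuous (derive1 (fun t : R => t))} /\
             {in hyp_dom, continuous (derive1 (fun t : R => t^-1))}.
Proof.
split=> t t0.
  have -> : derive1 (fun t : R => t) = fun=> 1 :> R.
    by apply/funext => x; rewrite derive1E derive_id.
  exact: cst_continuous.
have inv' (x : R) : x != 0 -> derive1 (fun t : R => t^-1) x = - x ^- 2.
  move=> x0; rewrite derive1E (@deriveV R R id x 1 x0 (@derivable_id R R x 1)).
  by rewrite derive_id /GRing.scale/= mulr1.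
have {}t0 := hyp_neq0 t0.
rewrite /continuous_at inv'//.
apply: (@cvg_trans _ ((fun x : R => - x ^- 2) @ t)).
  apply: near_eq_cvg; have : \forall x \near t, x != 0.
    by apply: (@open_nbhs_nbhs R t [set x | x != 0]); split=> //; exact: open_neq.
  by apply: filterS => x x0; rewrite inv'.
have t2 : (fun x : R => x ^+ 2) @ t --> t ^+ 2 := @exprn_continuous R 2%N t.
exact: cvgN (cvgV (expf_neq0 2 t0) t2).
Qed.

Definition Gamma_plus : plane_curve :=
  @PlaneCurve `]0, +oo[ (fun t => t) (fun t => t^-1)
    hyp_inj hyp_derivable hyp_C1.

End Heisenberg.
Arguments Gamma_plus {R}.

(* Main.v *)
From HB Require Import structures.
Require Import Defs.
From mathcomp Require Import measurable_realfun ring lra.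

(** The key reformulation is that, after rescaling, both families of moment
    conditions say that a twisted periodization vanishes. The integral of
    F(x) e^(pi i (2 m + th) x) over (0,oo) is the m-th Fourier coefficient on
    (0,1) of e^(pi i th x) times the sum over j >= 0 of z^j F(x + j), where
    z = e^(pi i th) ([period_char]). The frequencies in 1 / x are of the same
    kind for the flip t -> q t^-2 F(q / t) of F. So F is in the normalized
    annihilator exactly when the periodization of F twisted by zeta and that
    of its flip twisted by eta vanish almost everywhere on (0,1)
    ([normalized_period]).

    Prescribe F = g on (1,q). The remaining unknowns are the restrictions f
    and K of F and of its flip to (0,1), since F on (q,oo) is the lift of K.
    The two conditions become

      f = - tail zeta g - L_zeta K,     K = - tail eta (flip g) - L_eta f,

    where L_z = [transfer] z is a twisted transfer operator of the expanding
    map y -> q / y mod 1. Hence f = w + L_zeta (L_eta f), with w depending on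
    g only. These operators do not increase the L^1 norm, and, as q > 1, they
    contract the variation up to a multiple of the L^1 norm ([lasota_yorke]).
    This gives enough compactness for a Fredholm alternative
    ([fredholm_alternative]): either the equation has a solution of bounded
    variation, or there is a fixed point of L^1 norm 1, which moreover has
    integral 0 if zeta = eta = 1 and w has integral 0.

    Fixed points are found by equality in the triangle inequality
    ([kernel_dichotomy]). For a solution of the homogeneous equations the
    contraction of the L^1 norm forces |f| to be the sum of the |K| over the
    inverse branches, with all terms in phase. A positive lower bound for |K|
    on some interval is then carried to ever longer intervals by the expanding
    map, until it holds on (0,1). Being of bounded variation, K has a limit at
    0, and the far terms of the series are values of K near 0. So their phases
    converge, which is possible only if zeta = eta = 1, and it makes the phase
    of f constant, so that the integral of f is not 0.

    Part (i) follows: there are no fixed points unless zeta = eta = 1, where w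
    always has integral 0 because all operations preserve integrals. In part
    (ii) the difference of two extensions solves the homogeneous equations.
    If (zeta, eta) <> (1, 1) it is 0; otherwise it is determined by its
    integral over (0,1). A nonzero Psi exists in the latter case because
    f = 1 + L_1 (L_1 f) has no solution, as one sees by integrating.

    For part (iii), extensions of the indicators of disjoint subintervals of
    (1,q) are linearly independent, and the image of f dt under t -> (t, 1 / t)
    for a nonzero f in the annihilator is a nonzero measure on the hyperbola
    whose Fourier transform vanishes on the lattice cross. *)

Set Implicit Arguments.
Unset Strict Implicit.
Unset Printing Implicit Defensive.

Import Order.TTheory GRing.Theory Num.Theory.
Import numFieldNormedType.Exports.

Local Open Scope classical_set_scope.
Local Open Scope ring_scope.
Local Open Scope complex_scope.

(** * The substitution t -> q / t *)

Section inv.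
Context (R : realType).
Local Notation mu := (@lebesgue_measure R).

Lemma measurable_inv : measurable_fun [set: R] (fun t : R => t^-1).
Proof.
have m0 : measurable_fun [set t : R | t != 0] (fun t : R => t^-1).
  apply: open_continuous_measurable_fun; first exact: open_neq.
  by move=> x /=; rewrite inE/= => x0; apply: inv_continuous.
have -> : [set: R] = [set t : R | t != 0] `|` [set 0].
  by apply/seteqP; split=> // x _ /=; have [->|] := eqVneq x 0; [right|left].
apply/measurable_funU => //.
  by apply: open_measurable; exact: open_neq.
by split=> //; exact: measurable_fun_set1.
Qed.

Lemma integral_inv_sqr (c : R) : 0 < c ->
  (\int[mu]_(t in `[c, +oo[) (t ^- 2)%:E = (c^-1)%:E)%E.
Proof.
move=> c0.
have dV (x : R) : x != 0 -> is_derive x (1:R) (fun t : R => - t^-1) (x ^- 2).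
  move=> x0.
  have dI : is_derive x (1:R) (fun t : R => t^-1) (- x ^- 2 *: 1).
    exact: (@is_deriveV R id x 1 1 x0).
  have := is_deriveN dI.
  by rewrite /GRing.scale/= mulr1 opprK; apply.
rewrite (@ge0_continuous_FTC2y _ (fun t => t^-2) (fun t => - t^-1) c 0) //.
- by rewrite -EFinB opprK add0r.
- by move=> x cx; rewrite invr_ge0 exprn_ge0// (le_trans _ cx)// ltW.
- apply: continuous_in_subspaceT => x; rewrite inE/= in_itv/= andbT => cx.
  have x0 : x != 0 by rewrite gt_eqF// (lt_le_trans c0).
  apply: (@cvgV R R (nbhs x) _ (fun x : R => x ^+ 2)); first by rewrite expf_neq0.
  exact: exprn_continuous.
- rewrite -[X in _ --> X]oppr0; apply: cvgN.
  apply/gtr0_cvgV0; last exact: cvg_id.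
  exact: nbhs_pinfty_gt.
- by move=> x cx; have [] := dV x (lt0r_neq0 (lt_trans c0 cx)).
- apply: cvg_at_right_filter; apply: cvgN; apply: cvgV; last exact: cvg_id.
  by rewrite gt_eqF.
- move=> x; rewrite in_itv/= andbT => cx.
  rewrite derive1E.
  by have [_ ->] := dV x (lt0r_neq0 (lt_trans c0 cx)).
Qed.

Lemma measurable_recip (q : R) : measurable_fun [set: R] (fun t : R => q / t).
Proof. by apply: measurable_funM => //; exact: measurable_inv. Qed.

Lemma measurable_recip_density (q : R) :
  measurable_fun [set: R] (fun t : R => q * t ^- 2).
Proof.
apply: measurable_funM => //.
apply: (measurableT_comp measurable_inv).
exact: measurable_funX.
Qed.

Let g (q : R) := fun t : R => (q * t ^- 2)%:E.
Let nu0 (q : R) (B : set (measurableTypeR R)) : \bar R :=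
  (\int[mu]_(t in `]0%R, +oo[ `&` B) g q t)%E.

Let mg q : measurable_fun [set: R] (g q).
Proof.
apply/measurable_EFinP; apply: measurable_funM => //.
apply: (measurableT_comp measurable_inv).
exact: measurable_funX.
Qed.

Context (q : R) (q0 : 0 < q).

Let g0 t : (0 <= g q t)%E.
Proof. by rewrite lee_fin mulr_ge0 ?(ltW q0)// invr_ge0 sqr_ge0. Qed.

Let nu00 : nu0 q set0 = 0%E.
Proof. by rewrite /nu0 setI0 integral_set0. Qed.

Let nu0_ge0 B : (0 <= nu0 q B)%E.
Proof. by rewrite integral_ge0. Qed.

Let nu0_sigma : semi_sigma_additive (nu0 q).
Proof.
move=> F mF tF mUF.
rewrite {2}/nu0 setI_bigcupr.
rewrite (@ge0_integral_bigcup _ _ _ mu (fun n => `]0%R, +oo[ `&` F n)) //.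
- by apply: is_cvg_nneseries => n _ _; exact: integral_ge0.
- by move=> k; apply: measurableI.
- by apply: measurable_funTS; exact: mg.
- exact: trivIset_setIl.
Qed.

Let inv : R -> R := fun t => q / t.

(** Both sides are measures of A. For A = ]a, b] with 0 <= a the left side is a
    difference of integrals of q t^-2 over two half-lines, namely b - a, and
    Lebesgue measure is determined by its values on such intervals. *)
Lemma lebesgue_measure_recip (A : set R) : measurable A ->
  (\int[mu]_(t in `]0%R, +oo[ `&` inv @^-1` A) (q * t ^- 2)%R%:E =
   mu (A `&` `]0%R, +oo[))%E.
Proof.
move=> mA.
pose nuM : {measure set (measurableTypeR R) -> \bar R} :=
  HB.pack (nu0 q) (isMeasure.Build _ _ R (nu0 q) nu00 nu0_ge0 nu0_sigma).
(* Lebesgue measure on ]-oo, 0] is added in order to compare measures on the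
   whole line. *)
pose nu2 : {measure set (measurableTypeR R) -> \bar R} :=
  measure_add (pushforward nuM (inv : measurableTypeR R -> measurableTypeR R))
  (mrestr mu (measurable_itv `]-oo, (0:R)])).
pose nu1 : {measure set (measurableTypeR R) -> \bar R} :=
  nu2 (measurable_recip q).
have mI : forall B : set R, measurable B -> measurable (inv @^-1` B).
  by move=> B mB; rewrite -[_ @^-1` _]setTI; exact: measurable_recip.
have half (b : R) : 0 <= b -> (nuM (inv @^-1` `]0%R, b]) = b%:E)%E.
  rewrite le_eqVlt => /orP[/eqP <-|b0].
    by rewrite set_itvoc0 preimage_set0 measure0.
  have -> : nuM (inv @^-1` `]0, b]) = (\int[mu]_(t in `[(q / b)%R, +oo[) g q t)%E.
    congr (\int[mu]_(t in _) _)%E.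
    apply/seteqP; split=> t /=; rewrite !in_itv/= !andbT.
      by move=> [t0 /andP[_]]; rewrite /inv ler_pdivrMr// ler_pdivrMr// mulrC.
    move=> qt; have t0 : 0 < t by rewrite (lt_le_trans _ qt)// divr_gt0.
    split=> //; rewrite divr_gt0//= ler_pdivrMr//.
    by move: qt; rewrite ler_pdivrMr// mulrC.
  under eq_integral do rewrite /g EFinM.
  rewrite ge0_integralZl//=.
  - by rewrite integral_inv_sqr ?divr_gt0// -EFinM invf_div mulrCA divff ?gt_eqF// mulr1.
  - apply: measurable_funTS; apply/measurable_EFinP.
    by apply: (measurableT_comp measurable_inv); exact: measurable_funX.
  - by move=> t _; rewrite lee_fin invr_ge0 sqr_ge0.
  - by rewrite lee_fin ltW.
have full (a b : R) : 0 <= a -> a <= b -> (nuM (inv @^-1` `]a, b]) = (b - a)%:E)%E.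
  move=> a0 ab.
  have := half _ (le_trans a0 ab).
  have -> : `]0, b]%classic = `]0, a] `|` `]a, b].
    by rewrite -itv_bndbnd_setU// bnd_simp.
  rewrite preimage_setU measureU; [|exact: mI|exact: mI|]; last first.
    rewrite -preimage_setI; apply/seteqP; split=> // t /=; rewrite !in_itv/=.
    by case=> /andP[_ +] /andP[+ _] => /le_lt_trans/[apply]; rewrite ltxx.
  rewrite [X in (X + _)%E]half// EFinB => <-.
  by rewrite addeAC subee// add0e.
have H : forall X, measurable X -> lebesgue_measure X = nu1 X.
  apply: lebesgue_measure_unique => _ [[a b] _ <-] /=.
  rewrite [nu1 _]measure_addE/= {1}/pushforward/= /mrestr/=.
  have [ba|ab] := leP b a.
    by rewrite set_itv_ge ?bnd_simp -?leNgt// preimage_set0 set0I !measure0 adde0.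
  have [a0|a0] := leP 0 a.
    rewrite [X in (X + _)%E](full _ _ a0 (ltW ab)) lebesgue_measure_itv/= lte_fin ab.
    rewrite (_ : _ `&` _ = set0) ?measure0 ?adde0//.
    apply/seteqP; split=> // t /=; rewrite !in_itv/=.
    by case=> /andP[at_ _] t0; move: (le_lt_trans a0 at_); rewrite ltNge t0.
  have [b0|b0] := leP b 0.
    rewrite setIidl; last first.
      by move=> t /=; rewrite !in_itv/= => /andP[_ /le_trans]; apply.
    rewrite [X in (X + _)%E](_ : _ = 0%E) ?add0e//.
    rewrite /nu0 (_ : _ `&` _ = set0) ?integral_set0//.
    apply/seteqP; split=> // t /=; rewrite !in_itv/= andbT.
    move=> [t0] /andP[_ tb]; move: (le_trans tb b0).
    by rewrite leNgt /inv divr_gt0.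
  rewrite [X in (_ + mu X)%E](_ : _ = `]a, 0]%classic); last first.
    apply/seteqP; split=> t /=; rewrite !in_itv/=.
      by move=> [/andP[-> _] ->].
    by move=> /andP[-> t0]; rewrite (le_trans t0 (ltW b0)).
  rewrite [X in (X + _)%E](_ : _ = b%:E).
    by rewrite !lebesgue_measure_itv/= !lte_fin ab a0 -!EFinB -EFinD sub0r.
  rewrite -(half b (ltW b0)) /=/nu0; congr (\int[mu]_(t in _) _)%E.
  apply/seteqP; split=> t /=; rewrite !in_itv/= andbT.
    by move=> [t0 /andP[_ ->]]; rewrite t0 divr_gt0.
  by move=> [t0 /andP[qt ->]]; rewrite t0 (lt_trans a0 qt).
have := H _ (measurableI _ _ mA (measurable_itv `]0%R, +oo[)).
move=> ->.
rewrite [nu1 _]measure_addE/= /pushforward/= /mrestr/= /nu0.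
rewrite [X in mu X](_ : _ = set0) ?measure0 ?adde0; last first.
  apply/seteqP; split=> // t /=; rewrite !in_itv/= andbT => -[[_ t0]].
  by rewrite leNgt t0.
congr (\int[mu]_(t in _) _)%E.
apply/seteqP; split=> t /=; rewrite !in_itv/= !andbT.
  by case=> t0 At; rewrite divr_gt0.
by case=> t0 [].
Qed.

Import HBNNSimple.

(** Simple functions are handled by [lebesgue_measure_recip], and nonnegative
    measurable ones by monotone convergence. *)
Lemma ge0_integral_recip (u : R -> \bar R) :
  measurable_fun (`]0, +oo[ : set R) u -> (forall x, 0 < x -> (0 <= u x)%E) ->
  (\int[mu]_(x in `]0%R, +oo[) u x =
   \int[mu]_(t in `]0%R, +oo[) ((q * t ^- 2)%R%:E * u (q / t)%R))%E.
Proof.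
move=> mu_ u0; set D := `]0, +oo[%classic.
have mD : measurable D by exact: measurable_itv.
have mI B : measurable B -> measurable (inv @^-1` B).
  by move=> mB; rewrite -[_ @^-1` _]setTI; exact: measurable_recip.
have Dinv t : D t -> D (inv t) by rewrite /D/= !in_itv/= !andbT => t0; rewrite divr_gt0.
pose h := nnsfun_approx mD mu_.
have uE x : D x -> u x = limn (fun n => (h n x)%:E).
  move=> Dx; apply/esym/cvg_lim => //; apply: cvg_nnsfun_approx => //.
  by move=> y; rewrite /D/= in_itv/= andbT; exact: u0.
have nd x : {homo (fun n => (h n x)%:E) : n m / (n <= m)%N >-> (n <= m)%E}.
  by move=> n m nm; rewrite lee_fin; exact/lefP/nd_nnsfun_approx.
have mh n : measurable_fun [set: R] (EFin \o (h n : R -> R)).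
  by apply/measurable_EFinP; exact: measurable_funP.
have mhi n : measurable_fun [set: R] (fun t => (h n (inv t))%:E).
  by apply: (measurableT_comp (mh n)); exact: measurable_recip.
transitivity (limn (fun n => \int[mu]_(x in D) (h n x)%:E)%E).
  rewrite -monotone_convergence//.
  - by apply: eq_integral => x /[!inE] /uE.
  - by move=> n; apply: measurable_funTS; exact: mh.
  - by move=> n x _; rewrite lee_fin.
transitivity (limn (fun n => \int[mu]_(t in D) (g q t * (h n (inv t))%:E))%E); last first.
  rewrite -monotone_convergence//.
  - apply: eq_integral => t /[!inE] Dt; rewrite (uE _ (Dinv _ Dt)).
    apply/cvg_lim => //; apply: cvgeZl => //.
    exact: (ereal_nondecreasing_is_cvgn (nd (inv t))).
  - by move=> n; apply: emeasurable_funM; apply: measurable_funTS; [exact: mg|exact: mhi].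
  - by move=> n x _; rewrite mule_ge0// lee_fin.
  - by move=> x _ n m nm; apply: lee_wpmul2l; [exact: g0|exact: nd].
apply/congr_lim/funext => n.
have mindh r : measurable_fun [set: R] (\1_(h n @^-1` [set r]) : R -> R).
  apply: measurable_indic; rewrite -[_ @^-1` _]setTI.
  by apply: (@measurable_funP _ _ _ _ _ (h n)).
under eq_integral do rewrite fimfunE -fsumEFin//.
rewrite ge0_integral_fsum//; last 2 first.
  - move=> r; apply/measurable_EFinP; apply: measurable_funTS; apply: measurable_funM;
    [exact: measurable_cst|exact: mindh].
  - by move=> r x _; rewrite nnfun_muleindic_ge0.
under [RHS]eq_integral.
  move=> t _; rewrite fimfunE -fsumEFin// ge0_mule_fsumr; last first.
    by move=> r; rewrite nnfun_muleindic_ge0.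
  over.
have mind r : measurable_fun [set: R] (fun t => \1_(h n @^-1` [set r]) (inv t) : R).
  exact: (measurableT_comp (mindh r) (measurable_recip q)).
rewrite /= ge0_integral_fsum//; last 2 first.
  - move=> r; apply: measurable_funTS; apply: emeasurable_funM; first exact: mg.
    apply/measurable_EFinP; apply: measurable_funM; [exact: measurable_cst|exact: mind].
  - by move=> r x _; rewrite mule_ge0// nnfun_muleindic_ge0.
apply: eq_fsbigr => r; rewrite inE => -[x _ rE].
have r0 : 0 <= r by rewrite -rE.
transitivity (\int[mu]_(t in D) (r%:E * (\1_(h n @^-1` [set r]) t)%:E))%E.
  by apply: eq_integral => t _; rewrite EFinM.
rewrite ge0_integralZl//; last first.
  by apply/measurable_EFinP; apply: measurable_funTS; exact: mindh.
transitivity (\int[mu]_(t in D) (r%:E * (g q t * (\1_(inv @^-1` (h n @^-1` [set r])) t)%:E)))%E;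
  last first.
  by apply: eq_integral => t _; rewrite EFinM muleCA.
have mindi : measurable_fun [set: R] (fun t => \1_(inv @^-1` (h n @^-1` [set r])) t : R).
  exact: mind.
rewrite ge0_integralZl//; last 2 first.
  - apply: measurable_funTS; apply: emeasurable_funM; first exact: mg.
    by apply/measurable_EFinP; exact: mindi.
  - by move=> t _; rewrite mule_ge0// lee_fin.
congr (_ * _)%E.
have mset : measurable (h n @^-1` [set r]).
  rewrite -[_ @^-1` _]setTI.
  by apply: (@measurable_funP _ _ _ _ _ (h n)).
rewrite integral_indic// -[LHS]/(mu (_ `&` `]0, +oo[)) -(lebesgue_measure_recip mset)
  integral_mkcondr.
apply: eq_integral => t _.
by rewrite epatch_indic.
Qed.

End inv.

(** * Null sets and periodization *)

Section change_of_variables.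
Context (R : realType).
Local Notation mu := (@lebesgue_measure R).
Local Notation D := (`]0%R, +oo[%classic : set R).
Local Notation U := (`]0%R, 1%R[%classic : set R).
Implicit Types u : R -> R.

Lemma ae_imp (P Q : R -> Prop) : (forall x, P x -> Q x) ->
  {ae mu, forall x, P x} -> {ae mu, forall x, Q x}.
Proof. exact: (@filterS _ _ (ae_filter_ringOfSetsType mu)). Qed.

Lemma ae_imp2 (P Q S : R -> Prop) : (forall x, P x -> Q x -> S x) ->
  {ae mu, forall x, P x} -> {ae mu, forall x, Q x} -> {ae mu, forall x, S x}.
Proof. exact: (@filterS2 _ _ (ae_filter_ringOfSetsType mu)). Qed.

Lemma ae_imp3 (P Q S T : R -> Prop) : (forall x, P x -> Q x -> S x -> T x) ->
  {ae mu, forall x, P x} -> {ae mu, forall x, Q x} -> {ae mu, forall x, S x} ->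
  {ae mu, forall x, T x}.
Proof.
move=> PQST aP aQ; apply: ae_imp2; last exact: (ae_imp2 (fun _ p q => conj p q) aP aQ).
by move=> x [Px Qx]; exact: PQST.
Qed.

(** The density q t^-2 of the image measure does not vanish, so a set that is
    null for this density is Lebesgue null. *)
Lemma negligible_recip (q : R) (P : R -> Prop) : 0 < q ->
  {ae mu, forall x, 0 < x -> P x} -> {ae mu, forall t, 0 < t -> P (q / t)}.
Proof.
move=> q0 [B [mB B0 PB]].
have mI : measurable ((fun t : R => q / t) @^-1` B).
  by rewrite -[_ @^-1` _]setTI; exact: measurable_recip.
have mg : measurable_fun [set: R] (fun t : R => (q * t ^- 2)%:E).
  by apply/measurable_EFinP; exact: measurable_recip_density.
set inv := (fun t : R => q / t) in mI.
exists (D `&` (inv @^-1` B)); split.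
- exact: measurableI.
- have /ae_eq_integral_abs : (\int[mu]_(t in D `&` (inv @^-1` B))
      `|(q * t ^- 2)%R%:E| = 0%E)%E.
    transitivity (mu (B `&` `]0, +oo[)).
      rewrite -(lebesgue_measure_recip q0 mB); apply: eq_integral => t _.
      by rewrite gee0_abs// lee_fin mulr_ge0 ?(ltW q0)// invr_ge0 sqr_ge0.
    by apply: (subset_measure0 _ _ _ B0) => //; exact: measurableI.
  move=> h; have {}h := h (measurableI _ _ (measurable_itv _) mI) (measurable_funTS mg).
  case: h => N [mN N0 hN].
  apply: (subset_measure0 _ mN _ N0); first exact: measurableI.
  move=> t [t0 Bt]; apply: hN => /= /(_ (conj t0 Bt)) [] /eqP.
  move: t0; rewrite /= in_itv/= andbT => t0.
  by rewrite mulf_eq0 (gt_eqF q0)/= invr_eq0 expf_eq0/= (gt_eqF t0).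
- move=> t /= /not_implyP[t0 Pt]; split; first by rewrite /= in_itv/= andbT.
  by apply: PB => /= h; apply: Pt; apply: h; rewrite divr_gt0.
Qed.

Lemma lebesgue_measure_shift (c : R) (A : set R) : measurable A ->
  pushforward mu ((fun x => x + c) : R -> measurableTypeR R) A = mu A.
Proof.
have mc : measurable_fun [set: R] (fun x : R => x + c) by exact: measurable_funD.
move=> mA; apply/esym/(@lebesgue_measure_unique R (pushforward mu ((fun x => x + c) : R ->
  measurableTypeR R))) => //= _ [[a b]] _ <-.
rewrite /pushforward/= (_ : _ @^-1` _ = `]a - c, b - c]%classic); last first.
  by apply/seteqP; split=> x /=; rewrite !in_itv/= ltrBlDr lerBrDr.
rewrite [LHS]lebesgue_measure_itv [RHS]lebesgue_measure_itv/= !lte_fin ltrD2r.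
by case: ifP => // _; rewrite -!EFinB; congr (_%:E); ring.
Qed.

Lemma negligible_shift (P : R -> Prop) :
  {ae mu, forall x, 0 < x -> P x} ->
  {ae mu, forall x, 0 < x -> forall j : nat, P (x + j%:R)}.
Proof.
move=> [B [mB B0 PB]].
suff : forall j : nat, {ae mu, forall x, 0 < x -> P (x + j%:R)}.
  by move=> /ae_foralln; apply: filterS => x h x0 j; exact: h.
move=> j; exists ((fun x => x + j%:R) @^-1` B); split.
- rewrite -[_ @^-1` _]setTI.
  have mc : measurable_fun [set: R] (fun x : R => x + j%:R) by exact: measurable_funD.
  exact: mc.
- exact: etrans (lebesgue_measure_shift _ mB) B0.
- move=> x /= /not_implyP[x0 Px]; apply: PB => /= h; apply: Px; apply: h.
  by rewrite ltr_wpDr.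
Qed.

Lemma ge0_integral_shift (c : R) (E : set R) (u : R -> \bar R) :
  measurable E -> measurable_fun E u -> (forall x, E x -> (0 <= u x)%E) ->
  (\int[mu]_(x in E) u x = \int[mu]_(x in [set x | E (x + c)%R]) u (x + c)%R)%E.
Proof.
move=> mE mu_ u0.
have mc : measurable_fun [set: R] (fun x : R => x + c) by exact: measurable_funD.
pose s : R -> measurableTypeR R := fun x => x + c.
transitivity (\int[pushforward mu s]_(x in E) u x)%E.
  apply: eq_measure_integral => // A mA _; apply/esym; exact: lebesgue_measure_shift.
rewrite ge0_integral_pushforward//.
by move=> x; rewrite inE; exact: u0.
Qed.

(** The half-line is cut into the intervals ]j, j + 1], each of which is
    translated back to (0,1). *)
Lemma ge0_integral_period (u : R -> \bar R) :
  measurable_fun D u -> (forall x, 0 < x -> (0 <= u x)%E) ->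
  (\int[mu]_(x in D) u x = \int[mu]_(x in U) \sum_(j <oo) u (x + j%:R)%R)%E.
Proof.
move=> mu_ u0.
have mc (c : R) : measurable_fun [set: R] (fun x : R => x + c) by exact: measurable_funD.
have mus (j : nat) : measurable_fun U (fun x => u (x + j%:R)%R).
  apply: (measurable_comp _ _ mu_) => //.
    move=> _ [x + <-] /=; rewrite !in_itv/= andbT => /andP[x0 _].
    by rewrite ltr_wpDr.
  exact: measurable_funTS (mc _).
rewrite integral_nneseries//; last first.
  by move=> n x /=; rewrite in_itv/= => /andP[x0 _]; apply: u0; rewrite ltr_wpDr.
have DE : D = \bigcup_j (`]j%:R, j.+1%:R]%classic : set R).
  apply/seteqP; split=> x /=; rewrite in_itv/= ?andbT; last first.
    by move=> [j _]; rewrite /= in_itv/= => /andP[+ _]; exact: le_lt_trans.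
  move=> x0; have c0 : (0 < Num.ceil x)%R by rewrite -ceil_gt0 in x0 *.
  exists `|(Num.ceil x - 1)%R|%N => //=; rewrite in_itv/=.
  have cE : (`|(Num.ceil x - 1)%R|%N%:R : R) = (Num.ceil x)%:~R - 1.
    rewrite natr_absz ger0_norm ?intrD//; last by rewrite subr_ge0.
  rewrite -natr1 cE subrK Num.Theory.ceil_ge andbT.
  by rewrite -[X in _ - X]/(1%:~R) -intrB Num.Theory.gt_pred_ceil.
rewrite DE ge0_integral_bigcup//; last 3 first.
- by rewrite -DE.
- by rewrite -DE => x /=; rewrite in_itv/= andbT; exact: u0.
- apply/trivIsetP => i j _ _ ij; apply/seteqP; split=> // x /=.
  rewrite !in_itv/= => -[/andP[ix xi] /andP[jx xj]].
  have := lt_le_trans ix xj; have := lt_le_trans jx xi.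
  by rewrite !ltr_nat !ltnS => a b; move: ij; rewrite eqn_leq a b.
apply: eq_eseriesr => j _.
rewrite (ge0_integral_shift j%:R)//.
- have -> : [set x | (`]j%:R, j.+1%:R]%classic : set R) (x + j%:R)] = `]0, 1]%classic.
    by apply/seteqP; split=> x /=; rewrite !in_itv/= -natr1 [x + _]addrC ltrDl lerD2l.
  exact: (esym (@integral_itv_bndo_bndc R (BRight 0) 1 _ (mus j))).
- apply: measurable_funS mu_ => // x /=; rewrite !in_itv/= andbT => /andP[+ _].
  exact: le_lt_trans.
- by move=> x /=; rewrite in_itv/= => /andP[jx _]; apply: u0; exact: le_lt_trans jx.
Qed.

Lemma integrable_recip (q : R) u : 0 < q -> mu.-integrable D (EFin \o u) ->
  mu.-integrable D (fun t => (q * t ^- 2 * u (q / t))%:E) /\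
  Rintegral mu D u = Rintegral mu D (fun t => q * t ^- 2 * u (q / t)).
Proof.
move=> q0 iu; have /integrableP[mu_ uoo] := iu.
have Dinv : forall t, D t -> D (q / t).
  by move=> t; rewrite /= !in_itv/= !andbT => t0; rewrite divr_gt0.
have muq : measurable_fun D (fun t => u (q / t)).
  apply: (measurable_comp _ _ ((measurable_EFinP _ _).1 mu_)) => //.
    by move=> _ [t Dt <-]; exact: Dinv.
  exact: measurable_funTS (measurable_recip q).
have mguq : measurable_fun D (fun t => (q * t ^- 2 * u (q / t))%:E).
  apply/measurable_EFinP; apply: measurable_funM => //.
  exact: measurable_funTS (measurable_recip_density q).
have gE t v : ((q * t ^- 2)%R%:E * v%:E = (q * t ^- 2 * v)%R%:E)%E by rewrite EFinM.
have g0 t : 0 <= q * t ^- 2 by rewrite mulr_ge0 ?(ltW q0)// invr_ge0 sqr_ge0.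
split.
  apply/integrableP; split=> //.
  have := @ge0_integral_recip R q q0 (fun x => `|(u x)%:E|)%E.
  move=> H; rewrite (_ : (\int[_]_(x in _) _)%E = (\int[mu]_(x in D) `|(u x)%:E|)%E)//.
  rewrite H//; last by apply: measurableT_comp.
  apply: eq_integral => t _.
  by rewrite /= normrM EFinM (ger0_norm (g0 t)).
congr fine.
have H (v : R -> R) : measurable_fun D v -> (forall x, 0 <= v x) ->
    (\int[mu]_(x in D) (v x)%:E = \int[mu]_(t in D) (q * t ^- 2 * v (q / t)%R)%R%:E)%E.
  move=> mv v0; rewrite (@ge0_integral_recip R q q0)//.
  - exact/measurable_EFinP.
  - by move=> x _; rewrite lee_fin.
rewrite integralE [RHS]integralE.
have mur := (measurable_EFinP _ _).1 mu_.
congr (_ - _)%E.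
- rewrite (_ : (EFin \o u)^\+%E = (fun x => (Num.max (u x) 0)%:E)); last first.
    by apply/funext => x; rewrite funeposE/= EFin_max.
  rewrite H//; last by move=> x; rewrite le_max lexx orbT.
    apply: eq_integral => t _; rewrite funeposE -EFin_max; congr (_%:E).
    by rewrite maxr_pMr// mulr0.
  exact: measurable_maxr.
- rewrite (_ : (EFin \o u)^\-%E = (fun x => (Num.max (- u x) 0)%:E)); last first.
    by apply/funext => x; rewrite funenegE/= EFin_max.
  rewrite H//; last by move=> x; rewrite le_max lexx orbT.
    apply: eq_integral => t _; rewrite funenegE -EFinN -EFin_max; congr (_%:E).
    by rewrite maxr_pMr// mulr0 mulrN.
  apply: measurable_maxr => //; exact: measurableT_comp.
Qed.

Let mshift u (j : nat) : measurable_fun D u -> measurable_fun U (fun x => u (x + j%:R)).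
Proof.
move=> mu_; apply: (measurable_comp _ _ mu_) => //.
  move=> _ [x + <-] /=; rewrite !in_itv/= andbT => /andP[x0 _].
  by rewrite ltr_wpDr.
have mc : measurable_fun [set: R] (fun x : R => x + j%:R) by exact: measurable_funD.
exact: measurable_funTS mc.
Qed.

Let P u x : \bar R := (\sum_(j <oo) (u (x + j%:R))%:E)%E.

Let mP u : measurable_fun D u -> (forall x, 0 <= u x) -> measurable_fun U (P u).
Proof.
move=> mu_ u0; apply: ge0_emeasurable_sum.
  by move=> k x _ _; rewrite lee_fin.
by move=> k _; apply/measurable_EFinP; exact: mshift.
Qed.

Let iP u : mu.-integrable D (EFin \o u) -> (forall x, 0 <= u x) ->
  mu.-integrable U (P u) /\ (\int[mu]_(x in D) (u x)%:E = \int[mu]_(x in U) P u x)%E.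
Proof.
move=> iu u0; have /integrableP[mu_ uoo] := iu.
have mur := (measurable_EFinP _ _).1 mu_.
have E := @ge0_integral_period (EFin \o u) mu_ (fun x _ => u0 x).
split=> //; apply/integrableP; split; first exact: mP.
rewrite (_ : (\int[_]_(x in _) _)%E = (\int[mu]_(x in D) `|(u x)%:E|)%E)//.
transitivity (\int[mu]_(x in D) (u x)%:E)%E.
  rewrite E; apply: eq_integral => x _; rewrite gee0_abs//.
  by apply: nneseries_ge0 => n _ _; rewrite lee_fin.
by apply: eq_integral => x _; rewrite gee0_abs// lee_fin.
Qed.

Let fineP u x : (forall x, 0 <= u x) -> (P u x < +oo)%E ->
  (fun n => \sum_(j < n) u (x + j%:R)) @ \oo --> fine (P u x).
Proof.
move=> u0 Poo; have : P u x \is a fin_num.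
  by rewrite ge0_fin_numE//; apply: nneseries_ge0 => n _ _; rewrite lee_fin.
move=> fP; apply: (@fine_cvg _ _ _ _ (fun n => (\sum_(j < n) u (x + j%:R))%:E)).
rewrite fineK//.
rewrite (_ : (fun n => _) = (fun n => \sum_(0 <= j < n) (u (x + j%:R))%:E)%E); last first.
  by apply/funext => n; rewrite big_mkord sumEFin.
by apply: is_cvg_nneseries => n _ _; rewrite lee_fin.
Qed.

Let up u := fun x => Num.max (u x) 0.
Let un u := fun x => Num.max (- u x) 0.
Let up0 u x : 0 <= up u x. Proof. by rewrite le_max lexx orbT. Qed.
Let un0 u x : 0 <= un u x. Proof. by rewrite le_max lexx orbT. Qed.
Let upE u : EFin \o up u = (EFin \o u)^\+%E.
Proof. by apply/funext => x; rewrite funeposE/= EFin_max. Qed.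
Let unE u : EFin \o un u = (EFin \o u)^\-%E.
Proof. by apply/funext => x; rewrite funenegE/= EFin_max. Qed.
Let upn u x : u x = up u x - un u x.
Proof.
rewrite /up /un; have [u0|u0] := leP 0 (u x).
  by rewrite max_r ?oppr_le0// subr0.
by rewrite (@max_l _ _ (- u x) 0) ?oppr_ge0 ?(ltW u0)// sub0r opprK.
Qed.
Let iup u : mu.-integrable D (EFin \o u) -> mu.-integrable D (EFin \o up u).
Proof. by move=> iu; rewrite upE; exact: integrable_funepos. Qed.
Let iun u : mu.-integrable D (EFin \o u) -> mu.-integrable D (EFin \o un u).
Proof. by move=> iu; rewrite unE; exact: integrable_funeneg. Qed.

Let aePfin u : mu.-integrable D (EFin \o u) -> (forall x, 0 <= u x) ->
  {ae mu, forall x, 0 < x < 1 -> P u x \is a fin_num}.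
Proof.
move=> iu u0; have [iPa _] := iP iu u0.
have mU : measurable (U : set (measurableTypeR R)) by exact: measurable_itv.
have /= := integrable_ae mU iPa.
by apply: filterS => x h x01; have := h _; rewrite /= in_itv/= => /(_ x01).
Qed.

(** This is [ge0_integral_period] for the positive and the negative part of u,
    whose periodizations are finite almost everywhere because they are
    integrable. *)
Lemma Rintegral_period u (S : R -> R) : mu.-integrable D (EFin \o u) ->
  measurable_fun U S ->
  {ae mu, forall x, 0 < x < 1 -> (fun n => \sum_(j < n) u (x + j%:R)) @ \oo --> S x} ->
  mu.-integrable U (EFin \o S) /\ Rintegral mu D u = Rintegral mu U S.
Proof.
move=> iu mS uS.
have [iPp Ep] := iP (iup iu) (up0 u).
have [iPn En] := iP (iun iu) (un0 u).
have SE : ae_eq mu U (fun x => P (up u) x - P (un u) x)%E (EFin \o S).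
  apply: ae_imp3 (aePfin (iup iu) (up0 u)) (aePfin (iun iu) (un0 u)) uS.
  move=> x fp fn uS; rewrite /= in_itv/= => x01.
  rewrite -(fineK (fn x01)) -(fineK (fp x01)) -EFinB; congr (_%:E).
  rewrite -(cvg_lim (@Rhausdorff R) (uS x01)); apply/esym/cvg_lim => //.
  rewrite (_ : (fun n => _) = (fun n => \sum_(j < n) up u (x + j%:R)) - (fun n => \sum_(j < n) un
    u (x + j%:R))); last first.
    by apply/funext => n; rewrite fctE -sumrB; apply: eq_bigr => i _; rewrite -upn.
  by apply: cvgB; apply: fineP => //; rewrite -ge0_fin_numE ?fp ?fn//;
     apply: nneseries_ge0 => n _ _; rewrite lee_fin.
have iPP : mu.-integrable U (fun x => P (up u) x - P (un u) x)%E by exact: integrableB.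
have mS' : measurable_fun U (EFin \o S) by exact/measurable_EFinP.
split.
  apply/integrableP; split=> //.
  have /integrableP[mPP] := iPP; apply: le_lt_trans.
  rewrite le_eqVlt; apply/orP; left; apply/eqP; apply: ge0_ae_eq_integral => //.
  - exact: measurableT_comp.
  - exact: measurableT_comp.
  - exact/ae_eq_sym/ae_eq_abse.
rewrite /Rintegral -(ae_eq_integral _ _ _ _ _ SE)//; last exact: measurable_int iPP.
congr fine; rewrite integralB// -Ep -En integralE; congr (_ - _)%E.
  by apply: eq_integral => x _; rewrite -upE.
by apply: eq_integral => x _; rewrite -unE.
Qed.

Lemma period_ex u : mu.-integrable D (EFin \o u) ->
  exists2 S : R -> R, measurable_fun U S &
  {ae mu, forall x, 0 < x < 1 -> (fun n => \sum_(j < n) u (x + j%:R)) @ \oo --> S x}.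
Proof.
move=> iu.
have [/measurable_int mp _] := iP (iup iu) (up0 u).
have [/measurable_int mn _] := iP (iun iu) (un0 u).
exists (fun x => fine (P (up u) x) - fine (P (un u) x)).
  by apply: measurable_funB; exact: measurableT_comp.
apply: ae_imp2 (aePfin (iup iu) (up0 u)) (aePfin (iun iu) (un0 u)).
move=> x fp fn x01.
rewrite (_ : (fun n => _) = (fun n => \sum_(j < n) up u (x + j%:R)) - (fun n => \sum_(j < n) un u
  (x + j%:R))); last first.
  by apply/funext => n; rewrite fctE -sumrB; apply: eq_bigr => i _; rewrite -upn.
by apply: cvgB; apply: fineP => //; rewrite -ge0_fin_numE ?fp ?fn//;
   apply: nneseries_ge0 => n _ _; rewrite lee_fin.
Qed.

End change_of_variables.

Notation nrm := Normc.normc.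

(** * Complex numbers: norm, limits, absolutely convergent series *)

Section complex_toolkit.
Context (R : realType).
Implicit Types (z w : R[i]) (u v : nat -> R[i]).
Local Notation Re := complex.Re.
Local Notation Im := complex.Im.

Lemma cReD z w : Re (z + w) = Re z + Re w. Proof. by case: z w => [a b] [c d]. Qed.
Lemma cImD z w : Im (z + w) = Im z + Im w. Proof. by case: z w => [a b] [c d]. Qed.
Lemma cReN z : Re (- z) = - Re z. Proof. by case: z. Qed.
Lemma cImN z : Im (- z) = - Im z. Proof. by case: z. Qed.
Lemma cReM z w : Re (z * w) = Re z * Re w - Im z * Im w.
Proof. by case: z w => [a b] [c d]. Qed.
Lemma cImM z w : Im (z * w) = Re z * Im w + Im z * Re w.
Proof. by case: z w => [a b] [c d]. Qed.
Lemma cRe_sum I (r : seq I) (P : pred I) (F : I -> R[i]) :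
  Re (\sum_(i <- r | P i) F i) = \sum_(i <- r | P i) Re (F i).
Proof. by elim/big_rec2: _ => //= i a b _ <-; rewrite cReD. Qed.
Lemma cIm_sum I (r : seq I) (P : pred I) (F : I -> R[i]) :
  Im (\sum_(i <- r | P i) F i) = \sum_(i <- r | P i) Im (F i).
Proof. by elim/big_rec2: _ => //= i a b _ <-; rewrite cImD. Qed.

Lemma complex_eq z w : Re z = Re w -> Im z = Im w -> z = w.
Proof. by case: z w => [a b] [c d] /= -> ->. Qed.

Lemma nrmE z : nrm z = Num.sqrt (Re z ^+ 2 + Im z ^+ 2). Proof. by case: z. Qed.
Lemma nrm_ge0 z : 0 <= nrm z. Proof. by rewrite nrmE sqrtr_ge0. Qed.
Lemma nrm0 : nrm 0 = 0 :> R. Proof. exact: Normc.normc0. Qed.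
Lemma nrm1 : nrm 1 = 1 :> R. Proof. exact: Normc.normc1. Qed.
Lemma nrmM z w : nrm (z * w) = nrm z * nrm w. Proof. exact: Normc.normcM. Qed.
Lemma nrmN z : nrm (- z) = nrm z. Proof. by rewrite !nrmE cReN cImN !sqrrN. Qed.
Lemma nrmD z w : nrm (z + w) <= nrm z + nrm w. Proof. exact: le_normcD. Qed.
Lemma nrmB z w : nrm (z - w) <= nrm z + nrm w.
Proof. by rewrite -(nrmN w); exact: nrmD. Qed.
Lemma nrmBC z w : nrm (z - w) = nrm (w - z). Proof. by rewrite -nrmN opprB. Qed.
Lemma nrmX z n : nrm (z ^+ n) = nrm z ^+ n.
Proof. by elim: n => [|n IH]; rewrite ?expr0 ?nrm1// !exprS nrmM IH. Qed.
Lemma nrm_real (a : R) : nrm a%:C = `|a|.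
Proof. by rewrite nrmE /= expr0n addr0 sqrtr_sqr. Qed.
Lemma nrm_eq0 z : nrm z = 0 -> z = 0. Proof. exact: Normc.eq0_normc. Qed.
Lemma nrm_tri z w t : nrm (z - t) <= nrm (z - w) + nrm (w - t).
Proof. by rewrite (le_trans _ (nrmD _ _))// addrA subrK. Qed.
Lemma nrm_dist z w : `|nrm z - nrm w| <= nrm (z - w).
Proof.
rewrite ler_norml; apply/andP; split.
  by rewrite lerNl opprB lerBlDr nrmBC (le_trans _ (nrmD _ _))// subrK.
by rewrite lerBlDr (le_trans _ (nrmD _ _))// subrK.
Qed.
Lemma nrm_sum I (r : seq I) (P : pred I) (F : I -> R[i]) :
  nrm (\sum_(i <- r | P i) F i) <= \sum_(i <- r | P i) nrm (F i).
Proof.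
elim/big_rec2: _ => [|i a b _ h]; first by rewrite nrm0.
by rewrite (le_trans (nrmD _ _))// lerD2l.
Qed.
Lemma abs_Re_le z : `|Re z| <= nrm z.
Proof. by rewrite nrmE -sqrtr_sqr ler_wsqrtr// lerDl sqr_ge0. Qed.
Lemma abs_Im_le z : `|Im z| <= nrm z.
Proof. by rewrite nrmE -sqrtr_sqr ler_wsqrtr// lerDr sqr_ge0. Qed.
Lemma nrm_le_ReIm z : nrm z <= `|Re z| + `|Im z|.
Proof.
rewrite nrmE -(ger0_norm (addr_ge0 (normr_ge0 (Re z)) (normr_ge0 (Im z)))).
rewrite -sqrtr_sqr ler_wsqrtr// sqrrD !real_normK ?num_real//.
by rewrite lerD2r lerDl mulrn_wge0// mulr_ge0.
Qed.

Lemma nrm_expipi (s : R) : nrm (expipi s) = 1.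
Proof. by rewrite nrmE /= cos2Dsin2 sqrtr1. Qed.

Lemma expipiD (s t : R) : expipi (s + t) = expipi s * expipi t.
Proof.
rewrite /expipi mulrDr cosD sinD; apply: complex_eq => //=.
by rewrite addrC.
Qed.

Lemma expipi0 : expipi (0 : R) = 1.
Proof. by rewrite /expipi mulr0 cos0 sin0. Qed.

Lemma expipi_nat (n : nat) (s : R) : expipi (n%:R * s) = expipi s ^+ n.
Proof.
elim: n => [|n IH]; first by rewrite mul0r expipi0.
by rewrite -natr1 mulrDl mul1r expipiD IH exprSr.
Qed.

Lemma expipi_2int (m : int) : expipi (2 * m%:~R : R) = 1.
Proof.
have H (n : nat) : expipi (2 * n%:R : R) = 1.
  rewrite mulrC expipi_nat /expipi mulr_natr cos2pi sin2pi.
  by rewrite (_ : 1 +i* 0 = 1)// expr1n.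
case: m => n; first exact: H.
have : expipi (2 * n.+1%:R + 2 * (- n.+1%:R) : R) = 1 by rewrite mulrN subrr expipi0.
by rewrite expipiD H mul1r NegzE mulrNz.
Qed.

(** Convergence is expressed by the two real components because these are what
    [cintegral] and the convergence theorems for real integrals see. *)
Definition ccvg u (l : R[i]) : Prop :=
  (fun n => Re (u n)) @ \oo --> Re l /\ (fun n => Im (u n)) @ \oo --> Im l.

Lemma ccvgP u l : ccvg u l ->
  forall e, 0 < e -> exists N, forall n, (N <= n)%N -> nrm (u n - l) <= e.
Proof.
move=> [/cvgrPdist_le cR /cvgrPdist_le cI] e e0.
have [] := cR (e / 2) _; first by rewrite divr_gt0.
move=> N1 _ H1; have [] := cI (e / 2) _; first by rewrite divr_gt0.
move=> N2 _ H2; exists (maxn N1 N2) => n; rewrite geq_max => /andP[n1 n2].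
rewrite nrmBC (le_trans (nrm_le_ReIm _))// [e]splitr cReD cReN cImD cImN lerD//.
  exact: H1.
exact: H2.
Qed.

Lemma ccvg_unique u l m : ccvg u l -> ccvg u m -> l = m.
Proof.
move=> [a b] [c d]; apply: complex_eq.
  by rewrite -(cvg_lim (@Rhausdorff R) a) -(cvg_lim (@Rhausdorff R) c).
by rewrite -(cvg_lim (@Rhausdorff R) b) -(cvg_lim (@Rhausdorff R) d).
Qed.

Lemma ccvgD u v l m : ccvg u l -> ccvg v m -> ccvg (fun n => u n + v n) (l + m).
Proof.
move=> [a b] [c d]; split.
  by rewrite cReD; under eq_fun do rewrite cReD; exact: cvgD.
by rewrite cImD; under eq_fun do rewrite cImD; exact: cvgD.
Qed.

Lemma ccvgMl u l z : ccvg u l -> ccvg (fun n => z * u n) (z * l).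
Proof.
move=> [a b]; split.
  by rewrite cReM; under eq_fun do rewrite cReM; apply: cvgB; exact: cvgMr.
by rewrite cImM; under eq_fun do rewrite cImM; apply: cvgD; exact: cvgMr.
Qed.

Lemma ccvg_shift u l k : ccvg (fun n => u (n + k)%N) l -> ccvg u l.
Proof.
by move=> [a b]; split; [move: a|move: b]; rewrite (cvg_shiftn k (fun n => _ (u n))).
Qed.

Lemma ccvg_le u l (B : R) : ccvg u l -> (forall n, nrm (u n) <= B) -> nrm l <= B.
Proof.
move=> /ccvgP H uB; apply/ler_addgt0Pl => e e0; have [N HN] := H e e0.
have := nrm_tri l (u N) 0; rewrite !subr0 => /le_trans; apply.
by rewrite lerD// nrmBC HN.
Qed.

(** A total operation, so that operators given by series can be defined before
    their convergence is established; [csum_cvg] gives its meaning for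
    absolutely summable u. *)
Definition csum u : R[i] :=
  limn (fun n => \sum_(k < n) Re (u k)) +i* limn (fun n => \sum_(k < n) Im (u k)).

Definition psum u n := \sum_(k < n) u k.

Lemma csumE u l : ccvg (psum u) l -> csum u = l.
Proof.
move=> [a b]; apply: complex_eq => /=.
  rewrite -(cvg_lim (@Rhausdorff R) a); congr (lim (_ @ \oo)); apply/funext => n.
  by rewrite /psum cRe_sum.
rewrite -(cvg_lim (@Rhausdorff R) b); congr (lim (_ @ \oo)); apply/funext => n.
by rewrite /psum cIm_sum.
Qed.

Lemma bnd_series_cvg (a : nat -> R) (B : R) :
  (forall n, \sum_(k < n) `|a k| <= B) -> cvgn (fun n => \sum_(k < n) a k).
Proof.
move=> H.
have C : cvgn [normed series a].
  apply: nondecreasing_is_cvgn.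
    by apply: nondecreasing_series => k _ _; exact: normr_ge0.
  by exists B => _ [n _ <-]; have := H n; rewrite -(big_mkord xpredT (fun k => `|a k|)).
have := normed_cvg C; rewrite /series/=.
by under eq_fun do rewrite big_mkord.
Qed.

Lemma csum_cvg u (B : R) : (forall n, \sum_(k < n) nrm (u k) <= B) ->
  ccvg (psum u) (csum u).
Proof.
move=> H; split.
  rewrite /psum; under eq_fun do rewrite cRe_sum.
  apply: (@bnd_series_cvg (fun k => Re (u k)) B) => n.
  by apply: le_trans (H n); apply: ler_sum => k _; exact: abs_Re_le.
rewrite /psum; under eq_fun do rewrite cIm_sum.
apply: (@bnd_series_cvg (fun k => Im (u k)) B) => n.
by apply: le_trans (H n); apply: ler_sum => k _; exact: abs_Im_le.
Qed.

Lemma nrm_csum_le u (B : R) : (forall n, \sum_(k < n) nrm (u k) <= B) ->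
  nrm (csum u) <= B.
Proof.
move=> H; apply: (ccvg_le (csum_cvg H)) => n.
exact: le_trans (nrm_sum _ _ _) (H n).
Qed.

Lemma csum_tail u (B e : R) N : (forall n, \sum_(k < n) nrm (u k) <= B) ->
  (forall n, \sum_(N <= k < n) nrm (u k) <= e) -> nrm (csum u - psum u N) <= e.
Proof.
move=> H T; apply: (@ccvg_le (fun n => psum u (n + N) + - psum u N)).
  apply: ccvgD; last first.
    by split; exact: cvg_cst.
  have [a b] := csum_cvg H; split.
    by rewrite (cvg_shiftn N (fun n => Re (psum u n))).
  by rewrite (cvg_shiftn N (fun n => Im (psum u n))).
move=> n; rewrite /psum -!(big_mkord xpredT u) (big_cat_nat (n := N))//= ?leq_addl//.
by rewrite addrAC subrr add0r (le_trans (nrm_sum _ _ _)).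
Qed.

Lemma csum_eq u v : u =1 v -> csum u = csum v.
Proof. by move=> uv; rewrite (_ : u = v)//; exact/funext. Qed.

Lemma csumD u v (B C : R) : (forall n, \sum_(k < n) nrm (u k) <= B) ->
  (forall n, \sum_(k < n) nrm (v k) <= C) ->
  csum (fun k => u k + v k) = csum u + csum v.
Proof.
move=> hu hv; apply: csumE.
rewrite (_ : psum _ = fun n => psum u n + psum v n); last first.
  by apply/funext => n; rewrite /psum big_split.
by apply: ccvgD; [exact: csum_cvg hu|exact: csum_cvg hv].
Qed.

Lemma csumZ u z (B : R) : (forall n, \sum_(k < n) nrm (u k) <= B) ->
  csum (fun k => z * u k) = z * csum u.
Proof.
move=> hu; apply: csumE.
rewrite (_ : psum _ = fun n => z * psum u n); last first.
  by apply/funext => n; rewrite /psum mulr_sumr.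
by apply: ccvgMl; exact: csum_cvg hu.
Qed.

End complex_toolkit.

(** * Uniqueness of Fourier coefficients on (0,1) *)

Section fourier.
Context (R : realType).
Local Notation mu := (@lebesgue_measure R).
Local Notation U := (`]0%R, 1%R[%classic : set R).
Implicit Types u g : R -> R.

Lemma integrableZR (E : set R) u (k : R) : measurable E ->
  mu.-integrable E (EFin \o u) -> mu.-integrable E (fun x => (k * u x)%:E).
Proof. by move=> mE iu; exact: (@integrableZl _ _ _ mu E mE k (EFin \o u) iu). Qed.

Lemma integrableDR (E : set R) u v : measurable E ->
  mu.-integrable E (EFin \o u) -> mu.-integrable E (EFin \o v) ->
  mu.-integrable E (fun x => (u x + v x)%:E).
Proof.
by move=> mE iu iv; exact: (@integrableD _ _ _ mu E mE (EFin \o u) (EFin \o v) iu iv).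
Qed.

Lemma integrable_eqR (E : set R) u v : measurable E -> (forall x, E x -> u x = v x) ->
  mu.-integrable E (EFin \o u) -> mu.-integrable E (EFin \o v).
Proof.
move=> mE uv; apply: eq_integrable => // x; rewrite inE => Ex /=.
by rewrite uv.
Qed.

Lemma integrableNR (E : set R) u : measurable E ->
  mu.-integrable E (EFin \o u) -> mu.-integrable E (fun x => (- u x)%:E).
Proof.
move=> mE iu; apply: (@integrable_eqR _ (fun x => -1 * u x)) => //.
  by move=> x _; rewrite mulN1r.
exact: integrableZR.
Qed.

Lemma integrableBR (E : set R) u v : measurable E ->
  mu.-integrable E (EFin \o u) -> mu.-integrable E (EFin \o v) ->
  mu.-integrable E (fun x => (u x - v x)%:E).
Proof. by move=> mE iu iv; apply: integrableDR => //; exact: integrableNR. Qed.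

Lemma Rint_eq (E : set R) u v : (forall x, E x -> u x = v x) ->
  Rintegral mu E u = Rintegral mu E v.
Proof. by move=> uv; apply: eq_Rintegral => x; rewrite inE; exact: uv. Qed.

Lemma RintZ (E : set R) u (k : R) : measurable E -> mu.-integrable E (EFin \o u) ->
  Rintegral mu E (fun x => k * u x) = k * Rintegral mu E u.
Proof. by move=> mE iu; rewrite RintegralZl. Qed.

Lemma RintD (E : set R) u v : measurable E ->
  mu.-integrable E (EFin \o u) -> mu.-integrable E (EFin \o v) ->
  Rintegral mu E (fun x => u x + v x) = Rintegral mu E u + Rintegral mu E v.
Proof. by move=> mE iu iv; rewrite RintegralD. Qed.

Lemma RintN (E : set R) u : measurable E -> mu.-integrable E (EFin \o u) ->
  Rintegral mu E (fun x => - u x) = - Rintegral mu E u.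
Proof.
move=> mE iu; rewrite -[RHS]mulN1r -RintZ//.
by apply: Rint_eq => x _; rewrite mulN1r.
Qed.

Lemma RintB (E : set R) u v : measurable E ->
  mu.-integrable E (EFin \o u) -> mu.-integrable E (EFin \o v) ->
  Rintegral mu E (fun x => u x - v x) = Rintegral mu E u - Rintegral mu E v.
Proof.
by move=> mE iu iv; rewrite RintD ?RintN//; exact: integrableNR.
Qed.

Lemma Rint0 (E : set R) : Rintegral mu E (fun=> 0) = 0.
Proof. by rewrite /Rintegral integral0. Qed.

Lemma integrable0R (E : set R) : mu.-integrable E (fun=> 0%:E).
Proof. exact: integrable0. Qed.

Lemma integrable_mul_bounded (E : set R) u g (C : R) :
  measurable E -> mu.-integrable E (EFin \o u) -> measurable_fun E g ->
  (forall x, E x -> `|g x| <= C) -> mu.-integrable E (fun x => (u x * g x)%:E).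
Proof.
move=> mE iu mg gC.
have mu_ := (measurable_EFinP _ _).1 (measurable_int _ iu).
apply: (@le_integrable _ _ _ mu E mE _ (fun x => (C%:E * (u x)%:E)%E)).
- by apply/measurable_EFinP; exact: measurable_funM.
- move=> x Ex /=; rewrite lee_fin !normrM mulrC ler_wpM2r//.
  by rewrite (le_trans (gC _ Ex))// ler_norm.
- exact: integrableZR.
Qed.

Lemma bernoulli_sub (y : R) N : 0 <= y <= 1 -> 1 - y *+ N <= (1 - y) ^+ N.
Proof.
move=> /andP[y0 y1]; elim: N => [|N IH]; first by rewrite mulr0n subr0 expr0.
rewrite exprS; apply: (le_trans _ (ler_wpM2l _ IH)); last by rewrite subr_ge0.
have t0 : 0 <= y *+ N by rewrite mulrn_wge0.
by rewrite mulrS; nra.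
Qed.

Lemma bernoulli_add (y : R) N : 0 <= y -> 1 + y *+ N <= (1 + y) ^+ N.
Proof.
move=> y0; elim: N => [|N IH]; first by rewrite mulr0n addr0 expr0.
rewrite exprS; apply: (le_trans _ (ler_wpM2l _ IH)); last by rewrite addr_ge0.
have t0 : 0 <= y *+ N by rewrite mulrn_wge0.
by rewrite mulrS; nra.
Qed.

(** For large n this polynomial in s approximates the indicator of s < 1/2 on
    [0,1]. Both limits follow from Bernoulli's inequality: (1 - s^n)^(2^n) >= 1
    - (2 s)^n, and its inverse is at least 1 + (2 s)^n. *)
Definition cutpow (s : R) (n : nat) : R := (1 - s ^+ n) ^+ (2 ^ n).

Lemma cutpow_itv (s : R) n : 0 <= s <= 1 -> 0 <= cutpow s n <= 1.
Proof.
move=> /andP[s0 s1]; have h : 0 <= s ^+ n <= 1 by rewrite exprn_ge0// exprn_ile1.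
have [h0 h1] := andP h.
by rewrite exprn_ge0 ?subr_ge0//= exprn_ile1 ?subr_ge0// gerBl.
Qed.

Lemma cutpow_lt (s : R) : 0 <= s -> s < 2^-1 -> (fun n => cutpow s n) @ \oo --> (1 : R).
Proof.
move=> s0 s2; have s1 : s <= 1 by lra.
apply: (@squeeze_cvgr _ _ _ _ (fun n => 1 - (2 * s) ^+ n) (fun=> 1)).
- apply: nearW => n; have := cutpow_itv n (introT andP (conj s0 s1)).
  move=> /andP[_ ->]; rewrite andbT.
  have := @bernoulli_sub (s ^+ n) (2 ^ n).
  by rewrite exprn_ge0// exprn_ile1// -[_ *+ (2 ^ n)]mulr_natl natrX -exprMn; exact.
- rewrite -[X in _ --> X]subr0; apply: cvgB; first exact: cvg_cst.
  apply: cvg_expr; rewrite ger0_norm; last by lra.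
  by lra.
- exact: cvg_cst.
Qed.

Lemma cutpow_gt (s : R) : 2^-1 < s -> s <= 1 -> (fun n => cutpow s n) @ \oo --> (0 : R).
Proof.
move=> s2 s1; have s0 : 0 <= s by lra.
apply: (@squeeze_cvgr _ _ _ _ (fun=> 0) (fun n => ((2 * s)^-1) ^+ n)).
- apply: nearW => n; have := cutpow_itv n (introT andP (conj s0 s1)).
  move=> /andP[-> _] /=.
  have sn0 : 0 <= s ^+ n by rewrite exprn_ge0.
  have sn1 : s ^+ n <= 1 by rewrite exprn_ile1.
  have p0 : 0 < (2 * s) ^+ n by rewrite exprn_gt0//; lra.
  rewrite exprVn -[leRHS]mul1r ler_pdivlMr//.
  have := @bernoulli_add (s ^+ n) (2 ^ n) sn0.
  rewrite -[_ *+ (2 ^ n)]mulr_natl natrX -exprMn => h.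
  have {}h : (2 * s) ^+ n <= (1 + s ^+ n) ^+ (2 ^ n) by apply: le_trans h; rewrite lerDr.
  apply: (le_trans (ler_wpM2l _ h)).
    by rewrite exprn_ge0// subr_ge0.
  rewrite /cutpow -exprMn -subr_sqr expr1n exprn_ile1//.
    by rewrite subr_ge0 exprn_ile1.
  by rewrite gerBl sqr_ge0.
- exact: cvg_cst.
- apply: cvg_expr; rewrite ger0_norm; last by rewrite invr_ge0; lra.
  by rewrite invf_lt1; lra.
Qed.

Lemma cosMcos (a b : R) : cos a * cos b = 2^-1 * cos (a + b) + 2^-1 * cos (a - b).
Proof. by rewrite cosD cosB; field. Qed.

Let wave (m : int) (b x : R) : R := cos (2 * pi * m%:~R * x + b).

Let mwave m b : measurable_fun [set: R] (wave m b).
Proof.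
apply: (measurableT_comp (continuous_measurable_fun (@continuous_cos R))).
by apply: measurable_funD => //; exact: measurable_funM.
Qed.

Let wave_le1 m b x : `|wave m b x| <= 1. Proof. exact: cos_max. Qed.

Section orth.
Context (u : R -> R) (iu : mu.-integrable U (EFin \o u)).
Context (u_orth : forall (m : int) (b : R),
  Rintegral mu U (fun x => u x * cos (2 * pi * m%:~R * x + b)) = 0).

Let mU : measurable (U : set (measurableTypeR R)). Proof. exact: measurable_itv. Qed.

Context (a c : R).
(** Multiplying a wave cos(2 pi m x + b) by cos(2 pi (x - a)) gives a
    combination of two waves, so a function u orthogonal to all waves is
    orthogonal to all polynomials in s. The values of s lie in [0,1], and s <
    1/2 exactly where cos(2 pi (x - a)) > c, which is an interval centred at a
    modulo 1. *)
Let s x := 2^-1 + (c - cos (2 * pi * x - 2 * pi * a)) / 4.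

Let ms : measurable_fun [set: R] s.
Proof.
apply: measurable_funD => //; apply: measurable_funM => //; apply: measurable_funB => //.
apply: (measurableT_comp (continuous_measurable_fun (@continuous_cos R))).
by apply: measurable_funB => //; exact: measurable_funM.
Qed.

Let iM (g : R -> R) (C : R) : measurable_fun [set: R] g -> (forall x, `|g x| <= C) ->
  mu.-integrable U (fun x => (u x * g x)%:E).
Proof.
move=> mg gC; apply: (@integrable_mul_bounded _ _ _ C) => //.
exact: measurable_funTS.
Qed.

Context (c1 : `|c| <= 1).

Let s01 x : 0 <= s x <= 1.
Proof.
have := cos_max (2 * pi * x - 2 * pi * a); rewrite !ler_norml => /andP[h1 h2].
by move: c1; rewrite ler_norml /s => /andP[h3 h4]; apply/andP; split; lra.
Qed.

Let orth_pow n : forall m b,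
  Rintegral mu U (fun x => u x * (s x ^+ n * wave m b x)) = 0.
Proof.
have iS k m b : mu.-integrable U (fun x => (u x * (s x ^+ k * wave m b x))%:E).
  apply: (@iM (fun x => s x ^+ k * wave m b x) 1).
    by apply: measurable_funM; [exact: measurable_funX|exact: mwave].
  move=> x; rewrite normrM -[leRHS]mulr1 ler_pM//.
  rewrite normrX exprn_ile1//; have /andP[s0 s1] := s01 x.
  by rewrite ger0_norm.
elim: n => [|n IH] m b.
  by rewrite -[RHS](u_orth m b); apply: eq_Rintegral => x _; rewrite expr0 mul1r.
have E x : u x * (s x ^+ n.+1 * wave m b x) =
  (2^-1 + c / 4) * (u x * (s x ^+ n * wave m b x)) -
  (8^-1 * (u x * (s x ^+ n * wave (m + 1) (b - 2 * pi * a) x)) +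
   8^-1 * (u x * (s x ^+ n * wave (m - 1) (b + 2 * pi * a) x))).
  have -> : s x ^+ n.+1 * wave m b x = s x ^+ n * ((2^-1 + c / 4) * wave m b x) -
     s x ^+ n * (4^-1 * (wave m b x * cos (2 * pi * x - 2 * pi * a))).
    by rewrite exprSr {2}/s; field.
  rewrite /wave cosMcos.
  have -> : 2 * pi * m%:~R * x + b + (2 * pi * x - 2 * pi * a) =
    2 * pi * (m + 1)%:~R * x + (b - 2 * pi * a) by rewrite intrD; ring.
  have -> : 2 * pi * m%:~R * x + b - (2 * pi * x - 2 * pi * a) =
    2 * pi * (m - 1)%:~R * x + (b + 2 * pi * a) by rewrite intrB; ring.
  by field.
rewrite (Rint_eq (fun x _ => E x)) RintB ?RintD ?RintZ ?IH ?mulr0 ?addr0 ?subr0//;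
  repeat (first [exact: iS | apply: integrableZR | apply: integrableDR]); exact: mU.
Qed.

Let orth_poly (P : {poly R}) : forall k,
  mu.-integrable U (fun x => (u x * (s x ^+ k * P.[s x]))%:E) /\
  Rintegral mu U (fun x => u x * (s x ^+ k * P.[s x])) = 0.
Proof.
elim/poly_ind: P => [|P d IH] k.
  split.
    apply: (@integrable_eqR _ (fun=> 0)) => //; last exact: integrable0R.
    by move=> x _; rewrite horner0 !mulr0.
  by rewrite -[RHS](Rint0 U); apply: Rint_eq => x _; rewrite horner0 !mulr0.
have E x : u x * (s x ^+ k * (P * 'X + d%:P).[s x]) =
    u x * (s x ^+ k.+1 * P.[s x]) + d * (u x * (s x ^+ k * wave 0 0 x)).
  rewrite hornerD hornerM hornerX hornerC /wave mulr0z mulr0 mul0r addr0 cos0.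
  by rewrite exprSr; ring.
have [i1 z1] := IH k.+1.
have i2 : mu.-integrable U (fun x => (u x * (s x ^+ k * wave 0 0 x))%:E).
  apply: (@iM (fun x => s x ^+ k * wave 0 0 x) 1).
    by apply: measurable_funM; [exact: measurable_funX|exact: mwave].
  move=> x; rewrite normrM -[leRHS]mulr1 ler_pM//.
  rewrite normrX exprn_ile1//; have /andP[s0 s1] := s01 x.
  by rewrite ger0_norm.
have i3 : mu.-integrable U (fun x => (d * (u x * (s x ^+ k * wave 0 0 x)))%:E).
  exact: integrableZR.
split.
  apply: (@integrable_eqR _ _ _ mU (fun x _ => esym (E x))).
  exact: integrableDR.
by rewrite (Rint_eq (fun x _ => E x)) RintD// z1 RintZ// orth_pow mulr0 addr0.
Qed.

(** Dominated convergence along the polynomials [cutpow] in s. *)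
Lemma orth_level (g : R -> R) : measurable_fun U g ->
  {ae mu, forall x, U x -> (s x < 2^-1 /\ g x = 1) \/ (2^-1 < s x /\ g x = 0)} ->
  Rintegral mu U (fun x => u x * g x) = 0.
Proof.
move=> mg ae_g.
have mu_ := (measurable_EFinP _ _).1 (measurable_int _ iu).
have PE n x : cutpow (s x) n = s x ^+ 0 * ((1 - 'X ^+ n) ^+ (2 ^ n)).[s x].
  by rewrite /cutpow expr0 mul1r horner_exp hornerD hornerN hornerXn hornerC.
have [] := @dominated_convergence _ _ _ mu U mU
  (fun n x => (u x * cutpow (s x) n)%:E) (fun x => (u x * g x)%:E)
  (fun x => `|u x|%:E).
- move=> n; apply/measurable_EFinP; apply: measurable_funM => //.
  apply: measurable_funTS; apply: measurable_funX; apply: measurable_funB => //.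
  exact: measurable_funX.
- by apply/measurable_EFinP; exact: measurable_funM.
- apply: ae_imp ae_g => x h Ux.
  apply: (@cvg_comp _ _ _ (fun n => u x * cutpow (s x) n) EFin _ (nbhs (u x * g x))) => //.
  apply: cvgMr; have /andP[s0 s1] := s01 x.
  case: (h Ux) => -[h1 ->]; [exact: cutpow_lt|exact: cutpow_gt].
- exact: integrable_norm.
- apply: aeW => x n Ux; rewrite lee_fin normrM -[leRHS]mulr1 ler_wpM2l//.
  by have /andP[? ?] := cutpow_itv n (s01 x); rewrite ger0_norm.
move=> _ _ H.
have : (fun n : nat => 0%E : \bar R) @ \oo --> (\int[mu]_(x in U) (u x * g x)%:E)%E.
  apply: cvg_trans H; apply: near_eq_cvg; apply: nearW => n /=.
  have [iP zP] := orth_poly ((1 - 'X ^+ n) ^+ (2 ^ n)) 0.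
  under eq_integral do rewrite PE.
  by rewrite -[LHS]fineK ?integrable_fin_num//; congr (_%:E).
by move=> /(cvg_lim (@ereal_hausdorff R)); rewrite lim_cst// /Rintegral => <-.
Qed.

End orth.

Lemma ae_neq (p : R) : {ae mu, forall x, x != p}.
Proof.
exists [set p]; split; [exact: measurable_set1|exact: lebesgue_measure_set1|].
by move=> x /= /negP; rewrite negbK => /eqP.
Qed.

(** The distance of x to the midpoint of (p,r), or 1 minus this distance, lies
    in [0,1/2], and there y -> cos(2 pi y) is decreasing. *)
Lemma cos_level (p r x : R) : 0 <= p -> p < r -> r <= 1 -> 0 < x < 1 ->
  let c := cos (pi * (r - p)) in
  let s := 2^-1 + (c - cos (2 * pi * x - 2 * pi * ((p + r) / 2))) / 4 in
  (p < x < r -> s < 2^-1) /\ (x < p \/ r < x -> 2^-1 < s).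
Proof.
move=> p0 pr r1 /andP[x0 x1]; set a := (p + r) / 2; pose d := (r - p) / 2; move=> c s.
have pi0 : 0 < pi :> R by exact: pi_gt0.
have cE : c = cos (2 * pi * d) by congr cos; rewrite /d; field.
have yE : cos (2 * pi * x - 2 * pi * a) = cos (2 * pi * `|x - a|).
  rewrite -mulrBr -[LHS]cos_norm normrM (@ger0_norm _ (2 * pi))//.
  by rewrite mulr_ge0// ltW.
have d0 : 0 < d by rewrite /d; lra.
have d2 : d <= 2^-1 by rewrite /d; lra.
have itv (y : R) : 0 <= y -> y <= 2^-1 -> 2 * pi * y \in `[0, pi].
  by move=> y0 y2; rewrite in_itv/=; apply/andP; split; [rewrite !mulr_ge0// ltW|nra].
have mono (y z : R) : 0 <= y -> y < z -> z <= 2^-1 -> cos (2 * pi * z) < cos (2 * pi * y).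
  move=> y0 yz z2; rewrite ltr_cos; [|apply: itv; lra..].
  by rewrite ltr_pM2l//; lra.
rewrite /s cE yE; split.
  move=> /andP[px xr]; have y1 : `|x - a| < d.
    by rewrite ltr_norml /a /d; apply/andP; split; lra.
  have := mono _ _ (normr_ge0 (x - a)) y1 d2; lra.
move=> xpr.
have [dy yd] : d < `|x - a| /\ `|x - a| < 1 - d.
  case: xpr => h.
    by rewrite ler0_norm /a /d; [split; lra|lra].
  by rewrite ger0_norm /a /d; [split; lra|lra].
have [y2|y2] := leP `|x - a| 2^-1.
  have := mono _ _ (ltW d0) dy y2; lra.
have -> : cos (2 * pi * `|x - a|) = cos (2 * pi * (1 - `|x - a|)).
  by rewrite mulrBr mulr1 cosB mulr_natl cos2pi sin2pi mul1r mul0r addr0.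
have : d < 1 - `|x - a| by lra.
move=> h; have := mono _ _ (ltW d0) h; lra.
Qed.

(** Orthogonality to the indicators of the intervals (0,t) makes the primitive
    of u constant, and u is almost everywhere the derivative of its primitive.
    *)
Lemma fourier_unique_real u : mu.-integrable U (EFin \o u) ->
  (forall (m : int) (b : R),
    Rintegral mu U (fun x => u x * cos (2 * pi * m%:~R * x + b)) = 0) ->
  ae_eq mu U u (fun=> 0).
Proof.
move=> iu u0.
have mU : measurable (U : set (measurableTypeR R)) by exact: measurable_itv.
have half t : Rintegral mu U (fun x => u x * \1_(`]-oo, t]) x) = 0.
  have [t0|t0] := leP t 0.
    rewrite -[RHS](Rint0 U); apply: Rint_eq => x; rewrite /= in_itv/= => /andP[x0 _].
    by rewrite indicE memNset ?mulr0//= in_itv/= leNgt (le_lt_trans t0 x0).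
  pose r := Num.min t 1; have r0 : 0 < r by rewrite /r lt_min t0 ltr01.
  have r1 : r <= 1 by rewrite /r ge_min lexx orbT.
  apply: (orth_level iu u0 (a := (0 + r) / 2) (c := cos (pi * (r - 0)))).
  - exact: cos_max.
  - by apply: measurable_funTS; exact: measurable_indic.
  - apply: ae_imp (ae_neq r) => x xr; rewrite /= in_itv/= => /andP[x0 x1].
    have [h1 h2] := cos_level (lexx 0) r0 r1 (introT andP (conj x0 x1)).
    have [lxr|] := ltP x r.
      left; split; first by apply: h1; rewrite x0.
      by rewrite indicE mem_set//= in_itv/= ltW// (lt_le_trans lxr)// /r ge_min lexx.
    rewrite le_eqVlt eq_sym (negbTE xr)/= => rx; right; split; first by apply: h2; right.
    rewrite indicE memNset//= in_itv/= leNgt; apply/negP; rewrite negbK.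
    by move: rx; rewrite /r gt_min => /orP[//|]; rewrite ltNge (ltW x1).
pose f := u \_ U.
have if_ : mu.-integrable setT (EFin \o f).
  have /(integrable_mkcond _ mU) := iu; rewrite /f.
  by rewrite restrict_EFin.
have := @FTC1Ny R f _ _.
have i1 y : mu.-integrable `]-oo, y] (EFin \o f) by exact: integrableS if_.
have l1 : locally_integrable [set: R] f by apply: open_integrable_locally => //; exact: openT.
move=> /(_ i1 l1).
have -> : (fun x : R => \int[mu]_(t in `]-oo, x]) f t)%R = cst 0.
  apply/funext => x /=; rewrite -(half x) [in LHS]Rintegral_mkcond [in RHS]Rintegral_mkcond.
  congr Rintegral; apply/funext => t; rewrite /f !patchE indicE.
  case: ifPn => h1; case: ifPn => h2 //; rewrite ?mulr1 ?mulr0//.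
apply: ae_imp => x [_]; rewrite derive1_cst /f patchE => h Ux.
by rewrite mem_set in h.
Qed.

(** Combining the coefficients of index m and - m isolates the cosine and sine
    coefficients of the real and imaginary parts. *)
Lemma fourier_unique (S : R -> R[i]) : L1 U S ->
  (forall m : int, cintegral U (fun x => S x * expipi (2 * m%:~R * x)) = 0) ->
  eq_ae U S (fun=> 0).
Proof.
move=> [iR iI] S0.
have mU : measurable (U : set (measurableTypeR R)) by exact: measurable_itv.
have mw m b : measurable_fun [set: R] (fun x : R => cos (2 * pi * m%:~R * x + b)) by exact: mwave.
pose C (m : int) (x : R) := cos (pi * (2 * m%:~R * x)).
pose Sn (m : int) (x : R) := sin (pi * (2 * m%:~R * x)).
have mlin (k : int) : measurable_fun [set: R] (fun x : R => pi * (2 * k%:~R * x)).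
  by apply: measurable_funM => //; exact: measurable_funM.
have mC m : measurable_fun U (C m).
  by apply: measurable_funTS; exact: (measurableT_comp (continuous_measurable_fun
    (@continuous_cos R)) (mlin m)).
have mS m : measurable_fun U (Sn m).
  by apply: measurable_funTS; exact: (measurableT_comp (continuous_measurable_fun
    (@continuous_sin R)) (mlin m)).
have iC v m : mu.-integrable U (EFin \o v) -> mu.-integrable U (fun x => (v x * C m x)%:E).
  by move=> iv; apply: (@integrable_mul_bounded _ _ _ 1) => // x _; exact: cos_max.
have iS v m : mu.-integrable U (EFin \o v) -> mu.-integrable U (fun x => (v x * Sn m x)%:E).
  by move=> iv; apply: (@integrable_mul_bounded _ _ _ 1) => // x _; exact: sin_max.
pose A := fun x => complex.Re (S x); pose B := fun x => complex.Im (S x).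
pose IC v m := Rintegral mu U (fun x => v x * C m x).
pose IS v m := Rintegral mu U (fun x => v x * Sn m x).
have E1 m : IC A m - IS B m = 0.
  have := congr1 (@complex.Re R) (S0 m); rewrite /= => <-.
  rewrite /IC /IS -RintB; [|exact: mU|exact: iC|exact: iS].
  by apply: Rint_eq => x _; rewrite cReM.
have E2 m : IS A m + IC B m = 0.
  have := congr1 (@complex.Im R) (S0 m); rewrite /= => <-.
  rewrite /IC /IS -RintD; [|exact: mU|exact: iS|exact: iC].
  by apply: Rint_eq => x _; rewrite cImM.
have NC v m : IC v (- m) = IC v m.
  by apply: Rint_eq => x _; rewrite /C intrN mulrN mulNr mulrN cosN.
have NS v m : mu.-integrable U (EFin \o v) -> IS v (- m) = - IS v m.
  move=> iv; rewrite /IS -RintN; [|exact: mU|exact: iS].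
  by apply: Rint_eq => x _; rewrite /Sn intrN mulrN mulNr mulrN sinN mulrN.
have Z m : [/\ IC A m = 0, IS A m = 0, IC B m = 0 & IS B m = 0].
  have := E1 (- m); have := E2 (- m); rewrite !NC !NS//.
  by have := E1 m; have := E2 m; split; lra.
have H v : mu.-integrable U (EFin \o v) -> (forall m, IC v m = 0) -> (forall m, IS v m = 0) ->
    ae_eq mu U v (fun=> 0).
  move=> iv c0 s0; apply: fourier_unique_real => // m b.
  transitivity (cos b * IC v m - sin b * IS v m); last by rewrite c0 s0 !mulr0 subr0.
  rewrite /IC /IS -!RintZ; [|exact: mU|exact: iS|exact: mU|exact: iC].
  rewrite -RintB; [|exact: mU|apply: integrableZR; [exact: mU|exact: iC]|apply: integrableZR;
    [exact: mU|exact: iS]].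
  apply: Rint_eq => x _; rewrite cosD /C /Sn.
  by rewrite (_ : 2 * pi * m%:~R * x = pi * (2 * m%:~R * x)); ring.
have hA := H A iR (fun m => let: And4 a _ _ _ := Z m in a) (fun m => let: And4 _ a _ _ := Z m in
  a).
have hB := H B iI (fun m => let: And4 _ _ a _ := Z m in a) (fun m => let: And4 _ _ _ a := Z m in
  a).
apply: ae_imp2 hA hB => x a b Ux; apply: complex_eq; [exact: a|exact: b].
Qed.

End fourier.

(** * The annihilator in terms of twisted periodizations *)

Section annihilator.
Context (R : realType).
Local Notation mu := (@lebesgue_measure R).
Local Notation U := (`]0%R, 1%R[%classic : set R).
Local Notation Re := complex.Re.
Local Notation Im := complex.Im.
Implicit Types (F G : R -> R[i]) (E : set R).

Lemma L1_eq E F G : measurable E -> (forall x, E x -> F x = G x) -> L1 E F -> L1 E G.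
Proof.
move=> mE FG [a b]; split; [move: a|move: b]; apply: integrable_eqR => // x Ex;
  by rewrite FG.
Qed.

Lemma cint_eq E F G : (forall x, E x -> F x = G x) -> cintegral E F = cintegral E G.
Proof.
by move=> FG; apply: complex_eq => /=; apply: Rint_eq => x Ex; rewrite FG.
Qed.

Lemma L1D E F G : measurable E -> L1 E F -> L1 E G -> L1 E (fun x => F x + G x).
Proof.
move=> mE [a b] [c d]; split.
  by apply: integrable_eqR (integrableDR mE a c) => // x _; rewrite cReD.
by apply: integrable_eqR (integrableDR mE b d) => // x _; rewrite cImD.
Qed.

Lemma cintD E F G : measurable E -> L1 E F -> L1 E G ->
  cintegral E (fun x => F x + G x) = cintegral E F + cintegral E G.
Proof.
move=> mE [a b] [c d]; apply: complex_eq => /=.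
  by rewrite -RintD//; apply: Rint_eq => x _; rewrite cReD.
by rewrite -RintD//; apply: Rint_eq => x _; rewrite cImD.
Qed.

Lemma L1Z E F (k : R[i]) : measurable E -> L1 E F -> L1 E (fun x => k * F x).
Proof.
move=> mE [a b]; split.
  apply: integrable_eqR (integrableBR mE (integrableZR (Re k) mE a) (integrableZR (Im k) mE b))
    => //.
  by move=> x _; rewrite cReM.
apply: integrable_eqR (integrableDR mE (integrableZR (Re k) mE b) (integrableZR (Im k) mE a)) =>
  //.
by move=> x _; rewrite cImM.
Qed.

Lemma cintZ E F (k : R[i]) : measurable E -> L1 E F ->
  cintegral E (fun x => k * F x) = k * cintegral E F.
Proof.
move=> mE [a b]; apply: complex_eq => /=.
  rewrite cReM/= -!RintZ// -RintB//; [|exact: integrableZR..].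
  by apply: Rint_eq => x _; rewrite cReM.
rewrite cImM/= -!RintZ// -RintD//; [|exact: integrableZR..].
by apply: Rint_eq => x _; rewrite cImM.
Qed.

Lemma cint_ae E F G : measurable E -> L1 E F -> L1 E G -> eq_ae E F G ->
  cintegral E F = cintegral E G.
Proof.
move=> mE [a b] [c d] FG.
have H (v w : R -> R) : mu.-integrable E (EFin \o v) -> mu.-integrable E (EFin \o w) ->
    {ae mu, forall x, E x -> v x = w x} -> Rintegral mu E v = Rintegral mu E w.
  move=> iv iw vw; congr fine; apply: ae_eq_integral => //.
  - exact: measurable_int iv.
  - exact: measurable_int iw.
  - by apply: ae_imp vw => x h Ex /=; rewrite h.
apply: complex_eq => /=; apply: H => //; apply: ae_imp FG => x h Ex; by rewrite h.
Qed.

Lemma L1_expipi E F (h : R -> R) : measurable E -> measurable_fun E h -> L1 E F ->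
  L1 E (fun x => F x * expipi (h x)).
Proof.
move=> mE mh [a b].
have mph : measurable_fun E (fun x => pi * h x) by exact: measurable_funM.
have mc : measurable_fun E (fun x => cos (pi * h x)).
  exact: (measurableT_comp (continuous_measurable_fun (@continuous_cos R)) mph).
have ms : measurable_fun E (fun x => sin (pi * h x)).
  exact: (measurableT_comp (continuous_measurable_fun (@continuous_sin R)) mph).
have ic v : mu.-integrable E (EFin \o v) -> mu.-integrable E (fun x => (v x * cos (pi * h x))%:E).
  by move=> iv; apply: (@integrable_mul_bounded _ _ _ _ 1) => // x _; exact: cos_max.
have is_ v : mu.-integrable E (EFin \o v) -> mu.-integrable E (fun x => (v x * sin (pi * h
  x))%:E).
  by move=> iv; apply: (@integrable_mul_bounded _ _ _ _ 1) => // x _; exact: sin_max.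
split.
  by apply: integrable_eqR (integrableBR mE (ic _ a) (is_ _ b)) => // x _; rewrite cReM.
by apply: integrable_eqR (integrableDR mE (is_ _ a) (ic _ b)) => // x _; rewrite cImM.
Qed.

Let mP : measurable (Rplus : set (measurableTypeR R)). Proof. exact: measurable_itv. Qed.

Lemma RplusE (x : R) : Rplus x = (0 < x) :> Prop.
Proof. by rewrite /Rplus /= in_itv/= andbT. Qed.

Lemma UE (x : R) : U x = (0 < x < 1) :> Prop.
Proof. by rewrite /= in_itv/=. Qed.

Lemma ccvg_ext (u v : nat -> R[i]) l : u =1 v -> ccvg u l -> ccvg v l.
Proof. by move=> uv; rewrite (_ : u = v)//; exact/funext. Qed.

(** Cutting (0,oo) into unit intervals, the m-th moment of F is the m-th
    Fourier coefficient on (0,1) of the product of e^(pi i th x) and the sum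
    over j of e^(pi i th j) F(x + j). *)
Lemma period_char F (th : R) : L1 Rplus F ->
  (forall m : int, cintegral Rplus (fun x => F x * expipi ((2 * m%:~R + th) * x)) = 0) <->
  {ae mu, forall x, 0 < x < 1 ->
    ccvg (fun n => \sum_(j < n) expipi th ^+ j * F (x + j%:R)) 0}.
Proof.
move=> LF.
have mlin (c : R) : measurable_fun Rplus (fun x : R => c * x).
  by apply: measurable_funTS; exact: measurable_funM.
pose phi (m : int) x := F x * expipi ((2 * m%:~R + th) * x).
have Lphi m : L1 Rplus (phi m) by exact: (L1_expipi mP (mlin _) LF).
have shift m x n : \sum_(j < n) phi m (x + j%:R) =
    expipi ((2 * m%:~R + th) * x) * \sum_(j < n) expipi th ^+ j * F (x + j%:R).
  rewrite mulr_sumr; apply: eq_bigr => j _.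
  rewrite /phi mulrDr expipiD.
  have -> : (2 * m%:~R + th) * j%:R = 2 * (m * j)%:~R + j%:R * th :> R.
    by rewrite intrM; ring.
  by rewrite expipiD expipi_2int mul1r expipi_nat; ring.
have key m (S : R -> R[i]) : measurable_fun U (fun x => Re (S x)) ->
    measurable_fun U (fun x => Im (S x)) ->
    {ae mu, forall x, 0 < x < 1 -> ccvg (fun n => \sum_(j < n) phi m (x + j%:R)) (S x)} ->
    L1 U S /\ cintegral Rplus (phi m) = cintegral U S.
  move=> mR mI aS; have [iR iI] := Lphi m.
  have [] := Rintegral_period iR mR.
    apply: ae_imp aS => x h x01; have [h1 _] := h x01; move: h1.
    by under eq_fun do rewrite cRe_sum.
  have [] := Rintegral_period iI mI.
    apply: ae_imp aS => x h x01; have [_ h1] := h x01; move: h1.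
    by under eq_fun do rewrite cIm_sum.
  by move=> a b c d; split=> //; apply: complex_eq.
split=> [F0|a0 m].
- have [iR iI] := Lphi 0.
  have [S1 m1 a1] := period_ex iR; have [S2 m2 a2] := period_ex iI.
  pose S x := S1 x +i* S2 x.
  have aS : {ae mu, forall x, 0 < x < 1 -> ccvg (fun n => \sum_(j < n) phi 0 (x + j%:R)) (S x)}.
    apply: ae_imp2 a1 a2 => x h1 h2 x01; split; under eq_fun do rewrite ?cRe_sum ?cIm_sum.
      exact: h1.
    exact: h2.
  have [LS _] := key 0 S m1 m2 aS.
  have mU : measurable (U : set (measurableTypeR R)) by exact: measurable_itv.
  have LSm (m : int) : L1 U (fun x => S x * expipi (2 * m%:~R * x)).
    by apply: L1_expipi => //; apply: measurable_funTS; exact: measurable_funM.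
  have := fourier_unique LS.
  have S0 : forall m : int, cintegral U (fun x => S x * expipi (2 * m%:~R * x)) = 0.
    move=> m; have [mR mI] := LSm m.
    have [|||_ <-] := key m (fun x => S x * expipi (2 * m%:~R * x)).
    - exact: (measurable_EFinP _ _).1 (measurable_int _ mR).
    - exact: (measurable_EFinP _ _).1 (measurable_int _ mI).
    - apply: ae_imp aS => x h x01; rewrite mulrC.
      apply: ccvg_ext (ccvgMl (expipi (2 * m%:~R * x)) (h x01)) => n /=.
      rewrite !shift mulrA -expipiD mulr0z mulr0 add0r.
      by rewrite -mulrDl.
    - exact: F0.
  move=> /(_ S0) Sz; apply: ae_imp2 Sz aS => x h1 h2 x01.
  have := ccvgMl (expipi (- (th * x))) (h2 x01); rewrite h1 ?UE// mulr0.
  apply: ccvg_ext => n /=; rewrite shift mulrA -expipiD mulr0z mulr0 add0r.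
  by rewrite addNr expipi0 mul1r.
- have [|||_ ->] := key m (fun=> 0).
  + exact: measurable_cst.
  + exact: measurable_cst.
  + apply: ae_imp a0 => x h x01.
    have := ccvgMl (expipi ((2 * m%:~R + th) * x)) (h x01); rewrite mulr0.
    by apply: ccvg_ext => n; rewrite shift.
  + by apply: complex_eq; rewrite /= Rint0.
Qed.

(** The isometry of L^1(0,oo) induced by t -> q / t; it is an involution by
    [flipK] and exchanges the frequencies of type x and of type 1 / x. *)
Definition flip (q : R) F : R -> R[i] := fun t => (q * t ^- 2)%:C * F (q / t).

Lemma Re_realM (a : R) (z : R[i]) : Re (a%:C * z) = a * Re z.
Proof. by rewrite cReM /= mul0r subr0. Qed.
Lemma Im_realM (a : R) (z : R[i]) : Im (a%:C * z) = a * Im z.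
Proof. by rewrite cImM /= mul0r addr0. Qed.

Lemma cint_flip (q : R) F : 0 < q -> L1 Rplus F ->
  L1 Rplus (flip q F) /\ cintegral Rplus (flip q F) = cintegral Rplus F.
Proof.
move=> q0 [a b].
have [a1 a2] := integrable_recip q0 a; have [b1 b2] := integrable_recip q0 b.
split; first split.
- by apply: integrable_eqR a1 => // x _; rewrite Re_realM.
- by apply: integrable_eqR b1 => // x _; rewrite Im_realM.
- apply: complex_eq => /=; [rewrite a2|rewrite b2]; apply: Rint_eq => x _.
    by rewrite Re_realM.
  by rewrite Im_realM.
Qed.

Lemma flipK (q : R) F x : q != 0 -> x != 0 -> flip q (flip q F) x = F x.
Proof.
move=> q0 x0; rewrite /flip mulrA -rmorphM/=.
have -> : q / (q / x) = x by field; rewrite q0 x0.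
have -> : q / x ^+ 2 * (q / (q / x) ^+ 2) = 1 by field; rewrite q0 x0.
by rewrite rmorph1 mul1r.
Qed.

Definition scale (a : R) F : R -> R[i] := fun x => (a^-1)%:C * F (x / a).

Lemma cint_scale (a : R) F : 0 < a -> L1 Rplus F ->
  L1 Rplus (scale a F) /\ cintegral Rplus (scale a F) = cintegral Rplus F.
Proof.
move=> a0 LF.
have [L1F e1] := cint_flip ltr01 LF; have [L2F e2] := cint_flip a0 L1F.
have E x : Rplus x -> flip a (flip 1 F) x = scale a F x.
  rewrite RplusE => x0; rewrite /flip /scale mulrA -rmorphM/=.
  have an0 := lt0r_neq0 a0; have xn0 := lt0r_neq0 x0.
  congr (_%:C * F _); by field; rewrite an0 xn0.
split; first exact: L1_eq E L2F.
by rewrite -e1 -e2; apply: cint_eq => x Px; rewrite E.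
Qed.

(** Substitute x = alpha t: (2 m alpha + theta1) t = (2 m + theta1 / alpha) x
    and (2 n gamma + theta2) / t = (2 n + theta2 / gamma) alpha gamma / x. *)
Lemma normalized_fourier (alpha gamma theta1 theta2 : R) F :
  0 < alpha -> 0 < gamma ->
  normalized_pre_annihilator alpha gamma theta1 theta2 F <->
  [/\ L1 Rplus F,
    forall m : int, cintegral Rplus
      (fun x => F x * expipi ((2 * m%:~R + theta1 / alpha) * x)) = 0 &
    forall n : int, cintegral Rplus
      (fun x => F x * expipi ((2 * n%:~R + theta2 / gamma) * (alpha * gamma / x))) = 0].
Proof.
move=> a0 g0.
have an0 := lt0r_neq0 a0; have gn0 := lt0r_neq0 g0.
have mlin (c : R) : measurable_fun Rplus (fun x : R => c * x).
  by apply: measurable_funTS; exact: measurable_funM.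
have minv (c d : R) : measurable_fun Rplus (fun x : R => c * (d / x)).
  by apply: measurable_funTS; apply: measurable_funM => //; exact: measurable_recip.
have minv1 (d : R) : measurable_fun Rplus (fun x : R => d / x).
  by apply: measurable_funTS; exact: measurable_recip.
have mod1 f m x : scale alpha f x * expipi ((2 * m%:~R + theta1 / alpha) * x) =
    scale alpha (fun t => f t * expipi ((2 * m%:~R * alpha + theta1) * t)) x.
  rewrite /scale -mulrA; congr (_ * (_ * expipi _)); by field.
have mod2 f m x : 0 < x ->
    scale alpha f x * expipi ((2 * m%:~R + theta2 / gamma) * (alpha * gamma / x)) =
    scale alpha (fun t => f t * expipi ((2 * m%:~R * gamma + theta2) / t)) x.
  move=> x0; have xn0 := lt0r_neq0 x0.
  by rewrite /scale -mulrA; congr (_ * (_ * expipi _)); field; rewrite an0 xn0 gn0.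
split.
- move=> [LF [f [Lf f1 f2] Ff]].
  have [Lsf _] := cint_scale a0 Lf.
  split=> // m.
    rewrite (@cint_ae _ _ (fun x => scale alpha f x * expipi ((2 * m%:~R + theta1 / alpha) *
      x)))//.
    - rewrite -[RHS](f1 m) -(cint_scale a0 (L1_expipi _ (mlin _) Lf)).2//.
      by apply: cint_eq => x _; rewrite mod1.
    - exact: L1_expipi.
    - exact: L1_expipi.
    - by apply: ae_imp Ff => x h Px; rewrite h.
  rewrite (@cint_ae _ _ (fun x => scale alpha f x * expipi ((2 * m%:~R + theta2 / gamma) * (alpha
    * gamma / x))))//.
  - rewrite -[RHS](f2 m) -(cint_scale a0 (L1_expipi _ (minv1 _) Lf)).2//.
    by apply: cint_eq => x; rewrite RplusE => x0; rewrite mod2.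
  - exact: L1_expipi.
  - exact: L1_expipi.
  - by apply: ae_imp Ff => x h Px; rewrite h.
- move=> [LF F1 F2]; split=> //.
  have ai0 : 0 < alpha^-1 by rewrite invr_gt0.
  have [Lf _] := cint_scale ai0 LF.
  have fE x : scale alpha (scale alpha^-1 F) x = F x.
    rewrite /scale mulrA -rmorphM/= invrK mulVf// rmorph1 mul1r; congr F.
    by field.
  exists (scale alpha^-1 F); last by apply: aeW => x _; rewrite -[RHS]/(scale alpha _ x) fE.
  split=> // m.
    rewrite -[RHS](F1 m) -(cint_scale a0 (L1_expipi _ (mlin _) Lf)).2//.
    by apply: cint_eq => x _; rewrite -mod1 fE.
  rewrite -[RHS](F2 m) -(cint_scale a0 (L1_expipi _ (minv1 _) Lf)).2//.
  by apply: cint_eq => x; rewrite RplusE => x0; rewrite -mod2// fE.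
Qed.

Definition zero_period (z : R[i]) F : Prop := {ae mu, forall x, 0 < x < 1 ->
  ccvg (fun n => \sum_(j < n) z ^+ j * F (x + j%:R)) 0}.

(** The moments of F of the second type are moments of the first type of the
    flip of F, with theta2 / gamma in place of theta1 / alpha. *)
Lemma normalized_period (alpha gamma theta1 theta2 : R) F :
  0 < alpha -> 0 < gamma ->
  normalized_pre_annihilator alpha gamma theta1 theta2 F <->
  [/\ L1 Rplus F, zero_period (expipi (theta1 / alpha)) F &
    zero_period (expipi (theta2 / gamma)) (flip (alpha * gamma) F)].
Proof.
move=> a0 g0; set q := alpha * gamma; have q0 : 0 < q by rewrite mulr_gt0.
have qn0 := lt0r_neq0 q0.
have minv (c d : R) : measurable_fun Rplus (fun x : R => c * (d / x)).
  by apply: measurable_funTS; apply: measurable_funM => //; exact: measurable_recip.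
have E m : L1 Rplus F -> cintegral Rplus
      (fun x => F x * expipi ((2 * m%:~R + theta2 / gamma) * (q / x))) =
    cintegral Rplus
      (fun x => flip q F x * expipi ((2 * m%:~R + theta2 / gamma) * x)).
  move=> LF; rewrite -(cint_flip q0 (L1_expipi mP (minv _ _) LF)).2.
  apply: cint_eq => x; rewrite RplusE => x0; have xn0 := lt0r_neq0 x0.
  rewrite /flip -mulrA; congr (_ * (_ * expipi (_ * _))); by field; rewrite qn0 xn0.
split.
- move=> /(normalized_fourier _ _ _ a0 g0)[LF F1 F2]; split=> //.
    exact: (period_char _ LF).1 F1.
  apply: (period_char _ (cint_flip q0 LF).1).1 => m.
  by rewrite -E.
- move=> [LF F1 F2]; apply/(normalized_fourier _ _ _ a0 g0); split=> //.
    exact: (period_char _ LF).2 F1.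
  by move=> m; rewrite E//; exact: (period_char _ (cint_flip q0 LF).1).2 F2 m.
Qed.

End annihilator.

(** * Functions of bounded variation *)

Section bv.
Context (R : realType).
Local Notation mu := (@lebesgue_measure R).
Local Notation U := (`]0%R, 1%R[%classic : set R).
Local Notation Re := complex.Re.
Local Notation Im := complex.Im.
Implicit Types (f g h : R -> R[i]) (J : set R).

Definition majorant J f (phi : R -> R) : Prop :=
  forall x y, J x -> J y -> x <= y -> nrm (f y - f x) <= phi y - phi x.

(** Total variation at most T, certified by a bounded monotone function. In
    this form it is preserved by sums, monotone substitutions and pointwise
    limits without any recourse to subdivisions; [bv_Var] and [Var_bv] make the
    link with [Var]. *)
Definition bv J f (T : R) : Prop :=
  exists2 phi, (forall x, J x -> 0 <= phi x <= T) & majorant J f phi.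

Lemma bv_sub J K f T : K `<=` J -> bv J f T -> bv K f T.
Proof. by move=> KJ [phi b m]; exists phi => [x /KJ/b//|x y /KJ ? /KJ ?]; exact: m. Qed.

Lemma bv_le J f T S : T <= S -> bv J f T -> bv J f S.
Proof.
move=> TS [phi b m]; exists phi => // x /b /andP[-> /= h].
exact: le_trans h TS.
Qed.

Lemma bv_eq J f g T : (forall x, J x -> f x = g x) -> bv J f T -> bv J g T.
Proof.
move=> fg [phi b m]; exists phi => // x y Jx Jy xy; rewrite -!fg//; exact: m.
Qed.

Lemma bvD J f g T S : bv J f T -> bv J g S -> bv J (fun x => f x + g x) (T + S).
Proof.
move=> [phi b m] [psi c n]; exists (fun x => phi x + psi x).
  move=> x Jx; have /andP[? ?] := b x Jx; have /andP[? ?] := c x Jx.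
  by apply/andP; split; lra.
move=> x y Jx Jy xy.
have -> : f y + g y - (f x + g x) = (f y - f x) + (g y - g x) by ring.
have := m x y Jx Jy xy; have := n x y Jx Jy xy.
by have := nrmD (f y - f x) (g y - g x); lra.
Qed.

Lemma bvZ J f T (k : R[i]) : bv J f T -> bv J (fun x => k * f x) (nrm k * T).
Proof.
move=> [phi b m]; exists (fun x => nrm k * phi x).
  move=> x Jx; have /andP[? ?] := b x Jx.
  by rewrite mulr_ge0 ?nrm_ge0//= ler_wpM2l ?nrm_ge0.
by move=> x y Jx Jy xy; rewrite -!mulrBr nrmM ler_wpM2l ?nrm_ge0 ?m.
Qed.

Lemma bv0 J T : 0 <= T -> bv J (fun=> 0) T.
Proof.
move=> T0; exists (fun=> 0) => [x _|x y _ _ _]; first by rewrite lexx.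
by rewrite !subrr nrm0.
Qed.

Lemma bvM J f g T S (A B : R) : 0 <= A -> 0 <= B ->
  (forall x, J x -> nrm (f x) <= A) -> (forall x, J x -> nrm (g x) <= B) ->
  bv J f T -> bv J g S -> bv J (fun x => f x * g x) (B * T + A * S).
Proof.
move=> A0 B0 fA gB [phi b m] [psi c n]; exists (fun x => B * phi x + A * psi x).
  move=> x Jx; have /andP[? ?] := b x Jx; have /andP[? ?] := c x Jx.
  by rewrite addr_ge0 ?mulr_ge0//= lerD ?ler_wpM2l.
move=> x y Jx Jy xy.
have -> : f y * g y - f x * g x = (f y - f x) * g y + f x * (g y - g x) by ring.
rewrite (le_trans (nrmD _ _))// !nrmM.
have := m x y Jx Jy xy; have := n x y Jx Jy xy.
have := gB y Jy; have := fA x Jx.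
have := nrm_ge0 (f x); have := nrm_ge0 (g y); have := nrm_ge0 (f y - f x).
have := nrm_ge0 (g y - g x).
move: (nrm _) (nrm _) (nrm _) (nrm _) => p r s t p0 r0 s0 t0 tA sB pn rm.
have : s * r <= (phi y - phi x) * B by rewrite ler_pM.
have : p * t <= A * (psi y - psi x) by rewrite ler_pM.
lra.
Qed.

Lemma bv_nrm J f T : bv J f T -> bv J (fun x => (nrm (f x))%:C) T.
Proof.
move=> [phi b m]; exists phi => // x y Jx Jy xy.
by rewrite -rmorphB nrm_real (le_trans (nrm_dist _ _))// m.
Qed.

Lemma bv_anti J K f (w : R -> R) T : (forall x, K x -> J (w x)) ->
  (forall x y, K x -> K y -> x <= y -> w y <= w x) ->
  bv J f T -> bv K (fun x => f (w x)) T.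
Proof.
move=> KJ wd [phi b m]; exists (fun x => T - phi (w x)).
  by move=> x Kx; have /andP[? ?] := b _ (KJ _ Kx); rewrite subr_ge0 gerBl; apply/andP.
move=> x y Kx Ky xy; rewrite nrmBC.
by have := m _ _ (KJ _ Ky) (KJ _ Kx) (wd _ _ Kx Ky xy); lra.
Qed.

Lemma mono_measurable (i : interval R) (u : R -> R) :
  (forall x y, [set` i] x -> [set` i] y -> x <= y -> u x <= u y) ->
  measurable_fun [set` i] u.
Proof.
move=> u_nd.
apply: (measurability (@RGenCInfty.G R)) => [|/= _ [_] [r] -> <-].
  exact: RGenCInfty.measurableE.
apply: is_interval_measurable => s t [si us] [ti ut] v /andP[sv vt].
have vi : [set` i] v by apply: (@interval_is_interval R i s t) => //; rewrite sv.
split=> //; move: us; rewrite /= !in_itv/= !andbT => us.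
by rewrite (le_trans us)// u_nd.
Qed.

Lemma bv_measurable (i : interval R) f T : bv [set` i] f T ->
  measurable_fun [set` i] (fun x => Re (f x)) /\ measurable_fun [set` i] (fun x => Im (f x)).
Proof.
move=> [phi b m].
have mphi : measurable_fun [set` i] phi.
  by apply: mono_measurable => x y ix iy xy; have := m x y ix iy xy;
    have := nrm_ge0 (f y - f x); lra.
have H (u : R -> R) : (forall x y, `|u y - u x| <= nrm (f y - f x)) ->
    measurable_fun [set` i] u.
  move=> uf; have : measurable_fun [set` i] (fun x => phi x - u x).
    apply: mono_measurable => x y ix iy xy.
    by have := le_trans (uf x y) (m x y ix iy xy); have := ler_norm (u y - u x); lra.
  move=> mpu; rewrite (_ : u = fun x => phi x - (phi x - u x)).
    exact: measurable_funB.
  by apply/funext => x; lra.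
split; apply: H => x y.
  by rewrite -cReN -cReD abs_Re_le.
by rewrite -cImN -cImD abs_Im_le.
Qed.

Lemma bv_nrm_measurable (i : interval R) f T : bv [set` i] f T ->
  measurable_fun [set` i] (fun x => nrm (f x)).
Proof. by move=> /bv_nrm/bv_measurable[]. Qed.

Lemma bounded_integrable (a b : R) (u : R -> R) (C : R) :
  measurable_fun (`]a, b[ : set R) u -> (forall x, a < x < b -> `|u x| <= C) ->
  mu.-integrable `]a, b[ (EFin \o u).
Proof.
move=> mu_ uC; have mE : measurable (`]a, b[ : set (measurableTypeR R)) by exact: measurable_itv.
have ic : mu.-integrable `]a, b[ (fun x => (cst C x)%:E).
  apply: measurable_bounded_integrable => //; last exact: bounded_cst.
  by rewrite [X in (X < _)%E]lebesgue_measure_itv/=; case: ifP => // _; rewrite -EFinB ltry.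
apply: le_integrable ic => //; first exact/measurable_EFinP.
move=> x /=; rewrite in_itv/= => /uC h; rewrite lee_fin.
by rewrite (le_trans h)// ler_norm.
Qed.

Lemma RintC (a b k : R) : a <= b -> Rintegral mu `]a, b[ (fun=> k) = k * (b - a).
Proof.
move=> ab; transitivity (k * fine (mu `]a, b[%classic)).
  by apply: Rintegral_cst; exact: measurable_itv.
rewrite [X in fine X]lebesgue_measure_itv/= lte_fin; case: ltP => [_|ba]; first by [].
by rewrite (_ : b = a) ?subrr ?mulr0//; apply/eqP; rewrite eq_le ab ba.
Qed.

Lemma integrableC (a b k : R) : mu.-integrable `]a, b[ (EFin \o (fun=> k)).
Proof.
apply: (@bounded_integrable _ _ _ `|k|) => //; exact: measurable_cst.
Qed.

Lemma Rint_le (a b : R) (u v : R -> R) :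
  mu.-integrable `]a, b[ (EFin \o u) -> mu.-integrable `]a, b[ (EFin \o v) ->
  (forall x, a < x < b -> u x <= v x) ->
  Rintegral mu `]a, b[ u <= Rintegral mu `]a, b[ v.
Proof.
move=> iu iv uv; apply: le_Rintegral => //.
Qed.

(** A value of a function of bounded variation is bounded by the mean: here K
    is the value, u the function and M its variation on ]a, b[. *)
Lemma avg_le (a b K M : R) (u : R -> R) : a < b ->
  mu.-integrable `]a, b[ (EFin \o u) -> (forall x, a < x < b -> K <= u x + M) ->
  (b - a) * (K - M) <= Rintegral mu `]a, b[ u.
Proof.
move=> ab iu h; rewrite mulrC -(RintC (K - M) (ltW ab)).
apply: Rint_le => //; first exact: integrableC.
by move=> x /h; lra.
Qed.

Definition mass h : R := Rintegral mu U (fun x => nrm (h x)).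

(** The supremum is recorded beside the variation because the series defining
    the transfer operators are summed pointwise. *)
Definition bvnorm_le h (M : R) : Prop := (forall x, 0 < x < 1 -> nrm (h x) <= M) /\ bv U h M.

Lemma bvnorm_ge0 h M : bvnorm_le h M -> 0 <= M.
Proof.
by move=> [b _]; apply: le_trans (nrm_ge0 _) (b 2^-1 _); apply/andP; split; lra.
Qed.

Lemma bvnorm_leW h M N : M <= N -> bvnorm_le h M -> bvnorm_le h N.
Proof.
move=> MN [a b]; split; last exact: bv_le b.
by move=> x /a h'; exact: le_trans h' MN.
Qed.

Lemma bvnorm_eq f g M : (forall x, 0 < x < 1 -> f x = g x) -> bvnorm_le f M -> bvnorm_le g M.
Proof.
move=> fg [a b]; split; first by move=> x x01; rewrite -fg// a.
by apply: bv_eq b => x; rewrite UE; exact: fg.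
Qed.

Lemma bvnormD f g M N : bvnorm_le f M -> bvnorm_le g N -> bvnorm_le (fun x => f x + g x) (M + N).
Proof.
move=> [a b] [c d]; split; last exact: bvD.
by move=> x x01; rewrite (le_trans (nrmD _ _))// lerD ?a ?c.
Qed.

Lemma bvnormZ f M (k : R[i]) : bvnorm_le f M -> bvnorm_le (fun x => k * f x) (nrm k * M).
Proof.
move=> [a b]; split; last exact: bvZ.
by move=> x x01; rewrite nrmM ler_wpM2l ?nrm_ge0 ?a.
Qed.

Lemma bvnorm0 : bvnorm_le (fun=> 0) 0.
Proof. by split; [move=> x _; rewrite nrm0|exact: bv0]. Qed.

Lemma bvnorm_integrable h M : bvnorm_le h M -> mu.-integrable U (EFin \o (fun x => nrm (h x))).
Proof.
move=> [a b]; apply: (@bounded_integrable _ _ _ M) => [|x /a].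
  exact: bv_nrm_measurable b.
by rewrite ger0_norm ?nrm_ge0.
Qed.

Lemma bvnorm_L1 h M : bvnorm_le h M -> L1 U h.
Proof.
move=> [a b]; have [m1 m2] := bv_measurable b; split;
 apply: (@bounded_integrable _ _ _ M) => // x /a.
  exact: le_trans (abs_Re_le _).
exact: le_trans (abs_Im_le _).
Qed.

Lemma mass_ge0 h : 0 <= mass h.
Proof. by apply: Rintegral_ge0 => x _; exact: nrm_ge0. Qed.

(** Each value of |h| differs by at most T from the mean of |h| over (0,1),
    which is the mass. *)
Lemma bv_sup_le h M T : bvnorm_le h M -> bv U h T ->
  forall x, 0 < x < 1 -> nrm (h x) <= mass h + T.
Proof.
move=> nh [phi b m] x x01.
have := @avg_le 0 1 (nrm (h x)) T _ ltr01 (bvnorm_integrable nh).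
rewrite subr0 mul1r lerBlDr; apply=> y y01.
have H s t : 0 < s < 1 -> 0 < t < 1 -> s <= t -> nrm (h t - h s) <= T.
  rewrite -!UE => Us Ut st; have := m s t Us Ut st.
  by have /andP[? ?] := b _ Us; have /andP[? ?] := b _ Ut; lra.
have D : nrm (h x - h y) <= T.
  by case: (leP y x) => [yx|/ltW xy]; [exact: H|rewrite nrmBC; exact: H].
by have := nrm_tri (h x) (h y) 0; rewrite !subr0; lra.
Qed.

End bv.

(** * Transfer operators and the Lasota-Yorke inequality *)

Section transfer.
Context (R : realType) (q : R) (q1 : 1 < q).
Local Notation mu := (@lebesgue_measure R).
Local Notation U := (`]0%R, 1%R[%classic : set R).
Local Notation D := (`]0%R, +oo[%classic : set R).
Implicit Types (f g h : R -> R[i]) (z : R[i]).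

Definition cut h : R -> R[i] := fun x => if 0 < x < 1 then h x else 0.

Definition tail z g : R -> R[i] :=
  fun x => csum (fun k => z ^+ k.+1 * g (x + k.+1%:R)).

(** The function carried by (q,oo) whose flip agrees with h on (0,1). *)
Definition lift h := flip q (cut h).

(** The twisted transfer operator of the expanding map y -> q / y mod 1 of
    (0,1): the sum at x runs over the preimages q / (x + k) of x, each weighted
    by z^k and by the inverse q (x + k)^-2 of the absolute value of the
    derivative. *)
Definition transfer z h := tail z (lift h).

Let q0 : 0 < q. Proof. exact: lt_trans q1. Qed.

Lemma lift_small h t : t <= q -> lift h t = 0.
Proof.
move=> tq; rewrite /lift /flip /cut; case: ifP => [/andP[h0 h1]|_]; last by rewrite mulr0.
have t0 : 0 < t by move: h0; rewrite pmulr_rgt0 ?invr_gt0.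
by move: h1; rewrite ltr_pdivrMr// mul1r ltNge tq.
Qed.

Lemma lift_large h t : q < t -> lift h t = (q * t ^- 2)%:C * h (q / t).
Proof.
move=> qt; have t0 : 0 < t by exact: lt_trans qt.
by rewrite /lift /flip /cut divr_gt0//= ltr_pdivrMr// mul1r qt.
Qed.

Lemma lift_bound h M t : (forall x, 0 < x < 1 -> nrm (h x) <= M) -> 0 <= M -> 0 < t ->
  nrm (lift h t) <= M * q * t ^- 2.
Proof.
move=> hM M0 t0; have e0 : 0 <= q * t ^- 2 by rewrite mulr_ge0 ?(ltW q0)// invr_ge0 sqr_ge0.
have [tq|qt] := leP t q; first by rewrite lift_small// nrm0 -mulrA mulr_ge0.
rewrite lift_large// nrmM nrm_real ger0_norm// -mulrA mulrC ler_wpM2r//.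
by rewrite hM// divr_gt0//= ltr_pdivrMr// mul1r.
Qed.

Lemma invsq_sum N n : (0 < N)%N -> \sum_(N <= k < n) ((k.+1%:R : R) ^- 2) <= N%:R^-1.
Proof.
move=> N0; have [Nn|nN] := leqP N n; last by rewrite big_geq ?invr_ge0// ltnW.
suff : \sum_(N <= k < n) ((k.+1%:R : R) ^- 2) <= N%:R^-1 - n%:R^-1.
  by move=> /le_trans; apply; rewrite gerBl invr_ge0.
elim: n Nn => [|n IH]; first by rewrite leqn0 (gtn_eqF N0).
rewrite leq_eqVlt => /orP[/eqP <-|]; first by rewrite big_geq// subrr.
rewrite ltnS => Nn; rewrite big_nat_recr//=.
have n0 : 0 < n%:R :> R by rewrite ltr0n (leq_trans N0).
have n10 : 0 < n%:R + 1 :> R by rewrite addr_gt0.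
have H : (n.+1%:R : R) ^- 2 <= n%:R^-1 - n.+1%:R^-1.
  rewrite -natr1 -subr_ge0.
  have -> : (n%:R : R)^-1 - (n%:R + 1)^-1 - (n%:R + 1) ^- 2 = n%:R^-1 * (n%:R + 1) ^- 2.
    by field; rewrite !lt0r_neq0.
  by rewrite mulr_ge0// invr_ge0 ?(ltW n0)// sqr_ge0.
by rewrite (le_trans (lerD (IH Nn) H))// addrA subrK.
Qed.

Lemma lift_sum_tail z h M x N n : nrm z = 1 -> (forall x, 0 < x < 1 -> nrm (h x) <= M) ->
  0 <= M -> 0 <= x -> (0 < N)%N ->
  \sum_(N <= k < n) nrm (z ^+ k.+1 * lift h (x + k.+1%:R)) <= M * q / N%:R.
Proof.
move=> z1 hM M0 x0 N0.
apply: (@le_trans _ _ (\sum_(N <= k < n) (M * q * (k.+1%:R : R) ^- 2))).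
  apply: ler_sum => k _; rewrite nrmM nrmX z1 expr1n mul1r.
  have k0 : 0 < x + k.+1%:R by rewrite ltr_wpDl.
  apply: (le_trans (lift_bound hM M0 k0)).
  rewrite ler_wpM2l//; first by rewrite mulr_ge0// ltW.
  by rewrite lef_pV2 ?posrE ?exprn_gt0// lerXn2r ?nnegrE ?(ltW k0)// lerDr.
by rewrite -mulr_sumr ler_wpM2l ?invsq_sum// mulr_ge0// ltW.
Qed.

Lemma lift_sum z h M x n : nrm z = 1 -> (forall x, 0 < x < 1 -> nrm (h x) <= M) ->
  0 <= M -> 0 <= x ->
  \sum_(k < n) nrm (z ^+ k.+1 * lift h (x + k.+1%:R)) <= 2 * (M * q).
Proof.
move=> z1 hM M0 x0; rewrite -(big_mkord xpredT (fun k => nrm (z ^+ k.+1 * lift h (x + k.+1%:R)))).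
have Mq0 : 0 <= M * q by rewrite mulr_ge0// ltW.
case: n => [|n]; first by rewrite big_nil mulr_ge0.
rewrite big_nat_recl//=.
have -> : \sum_(0 <= i < n) nrm (z ^+ i.+2 * lift h (x + i.+2%:R)) =
  \sum_(1 <= i < n.+1) nrm (z ^+ i.+1 * lift h (x + i.+1%:R)).
  by rewrite big_add1.
have := lift_sum_tail n.+1 z1 hM M0 x0 (ltn0Sn 0); rewrite divr1 => h1.
rewrite mulr2n mulrDl mul1r lerD//.
rewrite nrmM nrmX z1 expr1n mul1r.
have x10 : 0 < x + 1 by rewrite ltr_wpDl.
apply: (le_trans (lift_bound hM M0 x10)).
rewrite -[leRHS]mulr1 ler_wpM2l// invf_le1 ?exprn_gt0//.
by rewrite exprn_ege1// lerDr.
Qed.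

Lemma tail_diff z g x y c K B : 0 < c ->
  nrm z = 1 ->
  (forall n, \sum_(k < n) nrm (z ^+ k.+1 * g (x + k.+1%:R)) <= B) ->
  (forall n, \sum_(k < n) nrm (z ^+ k.+1 * g (y + k.+1%:R)) <= B) ->
  (forall n, \sum_(k < n) c * nrm (g (y + k.+1%:R) - g (x + k.+1%:R)) <= K) ->
  c * nrm (tail z g y - tail z g x) <= K.
Proof.
move=> c0 z1 hx hy hK.
have -> : tail z g y - tail z g x =
    csum (fun k => z ^+ k.+1 * (g (y + k.+1%:R) - g (x + k.+1%:R))).
  have hx' n : \sum_(k < n) nrm (-1 * (z ^+ k.+1 * g (x + k.+1%:R))) <= B.
    by apply: le_trans (hx n); apply: ler_sum => k _; rewrite mulN1r nrmN.
  rewrite -[- tail z g x]mulN1r -(csumZ (-1) hx) -(csumD hy hx').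
  by apply: csum_eq => k /=; ring.
rewrite mulrC -ler_pdivlMr//; apply: nrm_csum_le => n.
rewrite ler_pdivlMr// mulrC mulr_sumr; apply: le_trans (hK n).
by apply: ler_sum => k _; rewrite nrmM nrmX z1 expr1n mul1r.
Qed.

(** The intervals (x + k, y + k) are disjoint, so the sum of the increments of
    W over them is bounded; it is the increment of the monotone function y ->
    sum_k (W (y + k) - W k). *)
Lemma shift_majorant (W : R -> R) (T : R) : (forall t, 0 <= W t <= T) ->
  (forall s t, s <= t -> W s <= W t) ->
  exists2 om : R -> R, (forall y, 0 <= y <= 1 -> 0 <= om y <= T) &
  forall x y, 0 <= x -> x <= y -> y <= 1 -> forall n,
    \sum_(k < n) (W (y + k.+1%:R) - W (x + k.+1%:R)) <= om y - om x.
Proof.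
move=> WT Wm.
pose S y n := \sum_(k < n) (W (y + k.+1%:R) - W k.+1%:R).
have Snd x y : x <= y -> nondecreasing_seq (fun n => \sum_(k < n) (W (y + k.+1%:R) - W (x +
  k.+1%:R))).
  move=> xy; apply/nondecreasing_seqP => n; rewrite big_ord_recr/= lerDl subr_ge0.
  by rewrite Wm// lerD2r.
have Snd0 y : 0 <= y -> nondecreasing_seq (S y).
  move=> y0; have := Snd 0 y y0; rewrite /S.
  by under eq_fun do under eq_bigr do rewrite add0r.
have SleT y n : 0 <= y <= 1 -> S y n <= T.
  move=> /andP[y0 y1].
  apply: (@le_trans _ _ (\sum_(0 <= k < n) (W k.+2%:R - W k.+1%:R))).
    rewrite big_mkord; apply: ler_sum => k _; rewrite lerD2r Wm//.
    by rewrite -[k.+2%:R]natr1 addrC lerD2l.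
  rewrite (telescope_sumr (fun k => W k.+1%:R))//.
  by have := WT n.+1%:R; have := WT 1%:R; lra.
have Sc y : 0 <= y <= 1 -> cvgn (S y).
  move=> y01; have /andP[y0 y1] := y01; apply: nondecreasing_is_cvgn; first exact: Snd0.
  by exists T => _ [n _ <-]; exact: SleT.
exists (fun y => limn (S y)).
  move=> y y01; have /andP[y0 y1] := y01; apply/andP; split.
    by have := nondecreasing_cvgn_le (Snd0 _ y0) (Sc _ y01) 0%N; rewrite /S big_ord0.
  by apply: limr_le; [exact: Sc|apply: nearW => n; exact: SleT].
move=> x y x0 xy y1 n.
have x01 : 0 <= x <= 1 by rewrite x0 (le_trans xy).
have y01 : 0 <= y <= 1 by rewrite y1 (le_trans x0).
rewrite -limB//; [|exact: Sc..].
have E : S y - S x = fun n => \sum_(k < n) (W (y + k.+1%:R) - W (x + k.+1%:R)).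
  apply/funext => p; rewrite fctE -sumrB; apply: eq_bigr => k _; ring.
rewrite E; apply: nondecreasing_cvgn_le; first exact: Snd.
rewrite -E; apply: is_cvgB; exact: Sc.
Qed.

Lemma measurable_nrm_cut h M : bvnorm_le h M -> measurable_fun [set: R] (fun x => nrm (cut h x)).
Proof.
move=> [_ /bv_nrm_measurable mh].
have mU : measurable (U : set (measurableTypeR R)) by exact: measurable_itv.
have := (measurable_restrictT (fun x => nrm (h x)) mU).1 mh.
rewrite (_ : (fun x => nrm (h x)) \_ U = fun x => nrm (cut h x))//.
apply/funext => x; rewrite patchE /cut; case: ifPn => [|].
  by rewrite inE UE => ->.
by rewrite notin_setE UE => /negP/negbTE ->; rewrite nrm0.
Qed.

Lemma nrm_flip g t : nrm (flip q g t) = q * t ^- 2 * nrm (g (q / t)).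
Proof.
by rewrite /flip nrmM nrm_real ger0_norm// mulr_ge0 ?(ltW q0)// invr_ge0 sqr_ge0.
Qed.

Lemma measurable_nrm_lift h M : bvnorm_le h M -> measurable_fun [set: R] (fun t => nrm (lift h
  t)).
Proof.
move=> nh; under eq_fun do rewrite nrm_flip.
apply: measurable_funM; first exact: measurable_recip_density.
exact: (measurableT_comp (measurable_nrm_cut nh) (measurable_recip q)).
Qed.

Lemma integral_nrm_lift h M : bvnorm_le h M ->
  (\int[mu]_(t in D) (nrm (lift h t))%:E = (mass h)%:E)%E.
Proof.
move=> nh; have mc := measurable_nrm_cut nh.
transitivity (\int[mu]_(x in D) (nrm (cut h x))%:E)%E.
  rewrite (@ge0_integral_recip _ q q0 (fun x => (nrm (cut h x))%:E)).
  - by apply: eq_integral => t _; rewrite -EFinM nrm_flip.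
  - by apply: measurable_funTS; exact/measurable_EFinP.
  - by move=> x _; rewrite lee_fin nrm_ge0.
have mU : measurable (U : set (measurableTypeR R)) by exact: measurable_itv.
rewrite /mass /Rintegral fineK; last exact: (integrable_fin_num mU (bvnorm_integrable nh)).
rewrite [in LHS]integral_mkcond [in RHS]integral_mkcond; apply: eq_integral => x _.
rewrite !patchE /cut; have [x01|x01] := boolP (0 < x < 1).
  by rewrite !mem_set//= in_itv/= andbT; case/andP: x01.
rewrite nrm0 (memNset (A := U)) ?if_same//.
by rewrite UE; apply/negP.
Qed.

Lemma lift_local h M a b : bvnorm_le h M -> 0 <= a -> a <= b ->
  mu.-integrable `]a, b[ (EFin \o (fun t => nrm (lift h t))) /\
  Rintegral mu `]a, b[ (fun t => nrm (lift h t)) <= mass h.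
Proof.
move=> nh a0 ab.
have ml : measurable_fun D (fun t => (nrm (lift h t))%:E).
  by apply/measurable_EFinP; apply: measurable_funTS; exact: measurable_nrm_lift nh.
have abD : `]a, b[ `<=` D.
  by move=> x /=; rewrite !in_itv/= andbT => /andP[ax _]; exact: le_lt_trans ax.
have le1 : (\int[mu]_(t in `]a, b[) (nrm (lift h t))%:E <= (mass h)%:E)%E.
  rewrite -(integral_nrm_lift nh); apply: ge0_subset_integral => //.
  by move=> t _; rewrite lee_fin nrm_ge0.
split.
  apply/integrableP; split; first exact: measurable_funS ml.
  apply: (@le_lt_trans _ _ (mass h)%:E); last by rewrite ltry.
  apply: le_trans le1; rewrite le_eqVlt; apply/orP; left; apply/eqP.
  by apply: eq_integral => t _ /=; rewrite ger0_norm ?nrm_ge0.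
rewrite -lee_fin /Rintegral fineK// ge0_fin_numE; last first.
  by apply: integral_ge0 => t _; rewrite lee_fin nrm_ge0.
by apply: le_lt_trans le1 _; rewrite ltry.
Qed.

(** Triangle inequality under the integral: the sum over k of |lift h (x + k)|
    is the periodization of |lift h|, whose integral is the mass of h. *)
Lemma transfer_mass z h M N : nrm z = 1 -> bvnorm_le h M -> bvnorm_le (transfer z h) N ->
  mass (transfer z h) <= mass h.
Proof.
move=> z1 nh nL.
have mU : measurable (U : set (measurableTypeR R)) by exact: measurable_itv.
have ml := measurable_nrm_lift nh.
have u0 t : 0 < t -> (0 <= (nrm (lift h t))%:E)%E by rewrite lee_fin nrm_ge0.
have mlD : measurable_fun D (fun t => (nrm (lift h t))%:E).
  by apply/measurable_EFinP; exact: measurable_funTS.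
rewrite -lee_fin -(integral_nrm_lift nh) (ge0_integral_period mlD u0).
rewrite {1}/mass /Rintegral fineK; last exact: (integrable_fin_num mU (bvnorm_integrable nL)).
apply: ge0_le_integral => //.
- by move=> x _; rewrite lee_fin nrm_ge0.
- exact: measurable_int (bvnorm_integrable nL).
- apply: ge0_emeasurable_sum => [k x _ _|k _]; first by rewrite lee_fin nrm_ge0.
  apply/measurable_EFinP; apply: measurable_funTS; apply: (measurableT_comp ml).
  exact: measurable_funD.
- move=> x; rewrite UE => /andP[x0 x1].
  have P0 k : (0 <= (nrm (lift h (x + k%:R)))%:E)%E by rewrite lee_fin nrm_ge0.
  have [->|Sfin] := eqVneq (\sum_(k <oo) (nrm (lift h (x + k%:R)))%:E)%E +oo%E.
    by rewrite leey.
  have Sf : (\sum_(k <oo) (nrm (lift h (x + k%:R)))%:E)%E \is a fin_num.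
    by rewrite ge0_fin_numE ?nneseries_ge0// lt_neqAle Sfin leey.
  rewrite -(fineK Sf) lee_fin;
  apply: (@nrm_csum_le R (fun k => z ^+ k.+1 * lift h (x + k.+1%:R))) => n.
  rewrite -lee_fin fineK//.
  apply: le_trans (nneseries_lim_ge n.+1 (fun k _ _ => P0 k)).
  rewrite -sumEFin big_nat_recl//= -[leLHS]add0e; apply: leeD => //.
  rewrite big_mkord; apply: lee_sum => k _.
  by rewrite lee_fin nrmM nrmX z1 expr1n mul1r.
Qed.

(** With N the integer part of q, the function x -> lift h (x + k) has its jump
    inside [0,1) only for k = N, at x = q - N. The point m lies to the right of
    this jump, and 2 m^2 < q makes the coefficient max(1, 2 m^2) / q of
    [lasota_yorke] smaller than 1. *)
Lemma split_point : exists (N : nat) (m : R),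
  [/\ (0 < N)%N, N%:R <= q, q < N.+1%:R & [/\ q - N%:R < m, 0 < m, m < 1 & 2 * m ^+ 2 < q]].
Proof.
exists (Num.truncn q).
have /andP[Nq qN] := truncn_itv (ltW q0).
have N0 : (0 < Num.truncn q)%N.
  by rewrite -ltnS -(ltr_nat R) (lt_trans q1).
set N := Num.truncn q in Nq qN N0 *.
have N1 : 1 <= N%:R :> R by rewrite ler1n.
have c1 : q - N%:R < 1 by rewrite ltrBlDr addrC natr1.
have [q2|q2] := leP 2 q.
  exists ((q - N%:R + 1) / 2); split=> //; split; [lra|lra|lra|].
  have : ((q - N%:R + 1) / 2) ^+ 2 < 1 by rewrite expr_lt1//; lra.
  lra.
have NE : N%:R = 1 :> R.
  have : (N < 2)%N by rewrite -(ltr_nat R) (le_lt_trans Nq).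
  by move: N0; case: (N) => [|[|]].
exists ((q - N%:R + q / 2) / 2); rewrite NE; split=> //; first by rewrite -NE.
split; [lra|lra|lra|nra].
Qed.

Lemma integrable_sub (u : R -> R) (a b : R) : mu.-integrable U (EFin \o u) ->
  0 <= a -> b <= 1 -> mu.-integrable `]a, b[ (EFin \o u).
Proof.
move=> iu a0 b1; apply: integrableS iu => //.
by move=> s /=; rewrite !in_itv/= => /andP[sa sb]; rewrite (le_lt_trans a0 sa) (lt_le_trans sb).
Qed.

Lemma Rint_split (u : R -> R) (x y : R) : mu.-integrable U (EFin \o u) ->
  0 <= x -> x <= y -> y <= 1 ->
  Rintegral mu `]0, y[ u - Rintegral mu `]0, x[ u = Rintegral mu `]x, y[ u.
Proof.
move=> iu x0; rewrite le_eqVlt => /orP[/eqP <-|xy] y1.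
  by rewrite subrr set_itvoo0 Rintegral_set0.
rewrite -(@Rintegral_itvB _ _ (BRight 0) (BLeft y) x).
- by rewrite -[in RHS]Rintegral_itv_bndo_bndc//; apply: integrable_sub => //; apply: le_trans y1;
  exact: ltW.
- exact: integrable_sub.
- by rewrite bnd_simp.
- by rewrite bnd_simp.
Qed.

(** On either side of m the variation of f, weighted by y^2, is controlled by
    om; the variation of the weight itself costs at most twice the mass of f.
    The two sides are glued at m. *)
Lemma weighted_bv f M m om B : bvnorm_le f M -> 0 < m -> m < 1 ->
  (forall y, 0 < y < 1 -> 0 <= om y <= B) ->
  (forall x y, 0 < x -> x <= y -> y < 1 -> (y <= m \/ m <= x) ->
    y ^+ 2 * nrm (f y - f x) <= om y - om x) ->
  bv U (fun y => (y ^+ 2)%:C * f y) (2 * mass f + B).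
Proof.
move=> nL m0 m1 omU side.
have ommono x y : 0 < x -> x <= y -> y < 1 -> om x <= om y.
  move=> x0 xy y1; have y0 := lt_le_trans x0 xy.
  have H a b : 0 < a -> a <= b -> b < 1 -> (b <= m \/ m <= a) -> om a <= om b.
    move=> a0 ab b1 abm; have := side _ _ a0 ab b1 abm.
    have : 0 <= b ^+ 2 * nrm (f b - f a) by rewrite mulr_ge0 ?sqr_ge0 ?nrm_ge0.
    lra.
  case: (leP y m) => [ym|my]; first by apply: H => //; left.
  case: (leP m x) => [mx|/ltW xm]; first by apply: H => //; right.
  by apply: (@le_trans _ _ (om m)); apply: H => //; [left|exact: ltW|right].
pose A y := Rintegral mu `]0, y[ (fun s => nrm (f s)).
have ifU := bvnorm_integrable nL.
have ifab a b : 0 <= a -> b <= 1 -> mu.-integrable `]a, b[ (EFin \o (fun s => nrm (f s))).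
  exact: integrable_sub.
have AD x y : 0 <= x -> x <= y -> y <= 1 -> A y - A x = Rintegral mu `]x, y[ (fun s => nrm (f s)).
  exact: Rint_split.
have AI y : 0 < y < 1 -> 0 <= A y <= mass f.
  move=> /andP[y0 y1]; apply/andP; split; first by apply: Rintegral_ge0 => s _; exact: nrm_ge0.
  have := AD _ _ (ltW y0) (ltW y1) (lexx _).
  have : 0 <= Rintegral mu `]y, 1[ (fun s => nrm (f s)) by apply: Rintegral_ge0 => s _;
    exact: nrm_ge0.
  by rewrite /mass /A; lra.
pose th y := 2 * A y + om y.
move: (A) AD AI @th => {}A AD AI th.
have step x y : 0 < x -> x <= y -> y < 1 -> (y <= m \/ m <= x) ->
    nrm ((y ^+ 2)%:C * f y - (x ^+ 2)%:C * f x) <= th y - th x.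
  move=> x0 xy y1 xym; have y0 := lt_le_trans x0 xy.
  move: xy; rewrite le_eqVlt => /orP[/eqP ->|xy]; first by rewrite subrr nrm0 subrr.
  have y20 : 0 < y ^+ 2 by rewrite exprn_gt0.
  pose d := (om y - om x) / y ^+ 2.
  have dE : y ^+ 2 * d = om y - om x by rewrite /d mulrC divfK// gt_eqF.
  have near s : x <= s -> s <= y -> nrm (f y - f s) <= d.
    move=> xs sy; rewrite /d ler_pdivlMr// mulrC.
    have := side s y (lt_le_trans x0 xs) sy y1 _.
    have : om x <= om s by apply: ommono => //; exact: le_lt_trans y1.
    have xym' : y <= m \/ m <= s by case: xym => h'; [left|right; exact: le_trans xs].
    by move=> u1 /(_ xym'); lra.
  have iS : mu.-integrable `]x, y[ (EFin \o (fun s => nrm (f s))) by apply: ifab; exact: ltW.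
  have := @avg_le _ x y (nrm (f y)) d _ xy iS.
  have Hs s : x < s < y -> nrm (f y) <= nrm (f s) + d.
    move=> /andP[xs sy]; have := near _ (ltW xs) (ltW sy).
    by have := nrm_tri (f y) (f s) 0; rewrite !subr0; lra.
  move=> /(_ Hs) av; rewrite -AD ?(ltW x0) ?(ltW xy) ?(ltW y1)// in av.
  have -> : (y ^+ 2)%:C * f y - (x ^+ 2)%:C * f x =
     (x ^+ 2)%:C * (f y - f x) + (y ^+ 2 - x ^+ 2)%:C * f y by rewrite rmorphB/=; ring.
  have xy2 : 0 <= y ^+ 2 - x ^+ 2 by rewrite subr_ge0 lerXn2r ?nnegrE ?ltW.
  rewrite (le_trans (nrmD _ _))// !nrmM !nrm_real !ger0_norm ?sqr_ge0//.
  have n1 : x ^+ 2 * nrm (f y - f x) <= x ^+ 2 * d.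
    by rewrite ler_wpM2l ?sqr_ge0// near// ltW.
  have A0 : 0 <= A y - A x.
    by rewrite AD ?(ltW x0) ?(ltW xy) ?(ltW y1)//; apply: Rintegral_ge0 => s _; exact: nrm_ge0.
  have n2 : (y ^+ 2 - x ^+ 2) * nrm (f y) <= 2 * (A y - A x) + (y ^+ 2 - x ^+ 2) * d.
    have -> : y ^+ 2 - x ^+ 2 = (y + x) * (y - x) by ring.
    have p : (y + x) * ((y - x) * (nrm (f y) - d)) <= (y + x) * (A y - A x).
      by rewrite ler_wpM2l//; lra.
    have p2 : (y + x) * (A y - A x) <= 2 * (A y - A x) by rewrite ler_wpM2r//; lra.
    by move: p p2; rewrite !mulrBr; lra.
  rewrite /th; lra.
have thU y : 0 < y < 1 -> 0 <= th y <= 2 * mass f + B.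
  by move=> y01; have /andP[u1 u2] := AI _ y01; have /andP[u3 u4] := omU _ y01;
   rewrite /th; apply/andP; split; lra.
have thm : majorant U (fun y => (y ^+ 2)%:C * f y) th.
  move=> x y; rewrite !UE => /andP[x0 x1] /andP[y0 y1] xy.
  case: (leP y m) => [ym|my]; first by apply: step => //; left.
  case: (leP m x) => [mx|/ltW xm]; first by apply: step => //; right.
  apply: (le_trans (nrm_tri _ ((m ^+ 2)%:C * f m) _)).
  have := step m y m0 (ltW my) y1 (or_intror (lexx _)).
  have := step x m x0 xm m1 (or_introl (lexx _)); lra.
by exists th => // y; rewrite UE; exact: thU.
Qed.

(** The variation is measured on (q,oo) after lifting, that is, through the
    function y^2 f(y) / q on (0,1). For f = transfer z h the sum over k sees
    the variation V of lift h on (q,oo) and the jump of lift h at q. This jump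
    is at most V plus the mean of |lift h| over (q, q + e), and it occurs at x
    = q - N < m, where the weight y^2 is at most m^2. So V contributes at most
    max(1, 2 m^2) V before the division by q. *)
Lemma lasota_yorke : exists kappa C : R, [/\ 0 <= kappa < 1, 0 <= C &
  forall z h M V, nrm z = 1 -> bvnorm_le h M -> 0 <= V -> bv `]q, +oo[ (lift h) V ->
  [/\ bvnorm_le (transfer z h) (C * (V + mass h)),
      bv `]q, +oo[ (lift (transfer z h)) (kappa * V + C * mass h) &
      mass (transfer z h) <= mass h]].
Proof.
have [N [m [N0 Nq qN [cm m0 m1 mq]]]] := split_point.
pose K := Num.max 1 (2 * m ^+ 2); pose e := m - (q - N%:R).
have e0 : 0 < e by rewrite /e; lra.
have K1 : 1 <= K by rewrite le_max lexx.
have K2 : 2 * m ^+ 2 <= K by rewrite le_max lexx orbT.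
have Kq : K < q by rewrite gt_max q1 mq.
have ei0 : 0 <= e^-1 by rewrite invr_ge0 ltW.
have qn0 : q != 0 by rewrite gt_eqF.
exists (K / q), (3 + 2 * e^-1); split.
- by rewrite divr_ge0 ?(ltW q0)//= ?ltr_pdivrMr// ?mul1r//; lra.
- lra.
move=> z h M V z1 nh V0 [Phi PhiV Phim].
have M0 := bvnorm_ge0 nh; have I0 := mass_ge0 h.
have QE t : `]q, +oo[%classic t = (q < t) :> Prop by rewrite /= in_itv/= andbT.
have PV t : q < t -> 0 <= Phi t <= V by rewrite -QE; exact: PhiV.
have Pm s t : q < s -> s <= t -> nrm (lift h t - lift h s) <= Phi t - Phi s.
  by move=> qs st; apply: Phim => //; rewrite QE// (lt_le_trans qs).
have Pmono s t : q < s -> s <= t -> Phi s <= Phi t.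
  by move=> qs st; have := Pm s t qs st; have := nrm_ge0 (lift h t - lift h s); lra.
(* J bounds lift h just to the right of q, and hence its jump at q. *)
pose J := e^-1 * mass h + Phi (q + e).
have qqe : q < q + e by lra.
have Jb t : q < t -> t <= q + e -> nrm (lift h t) <= J.
  move=> qt tq; have [iG mG] := lift_local nh (ltW q0) (ltW qqe).
  have := @avg_le _ q (q + e) (nrm (lift h t)) (Phi (q + e)) _ qqe iG _.
  have H s : q < s < q + e -> nrm (lift h t) <= nrm (lift h s) + Phi (q + e).
    move=> /andP[qs sq].
    have d : nrm (lift h t - lift h s) <= Phi (q + e).
      have /andP[? _] := PV _ qs; have /andP[? _] := PV _ qt.
      case: (leP s t) => [st|/ltW ts].
        have := Pm _ _ qs st; have := Pmono _ _ qt tq; lra.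
      rewrite nrmBC; have := Pm _ _ qt ts; have := Pmono _ _ qs (ltW sq); lra.
    by have := nrm_tri (lift h t) (lift h s) 0; rewrite !subr0; lra.
  move=> /(_ H) h1.
  rewrite -lerBlDr /J mulrC ler_pdivlMr// mulrC; apply: le_trans mG.
  by apply: le_trans h1; rewrite addrAC subrr add0r.
have /andP[Pe0 PeV] := PV _ qqe.
have J0 : 0 <= J by rewrite /J addr_ge0// mulr_ge0.
(* W is monotone. Up to q + e its increments bound w times those of lift h, the
   jump at q included; beyond q + e they bound those of lift h. *)
pose W w t := if t <= q then 0 else if t <= q + e then w * (J + Phi t)
   else w * (J + Phi (q + e)) + Phi t - Phi (q + e).
have Wlo w s : s <= q -> W w s = 0 by rewrite /W => ->.
have Wmid w s : q < s -> s <= q + e -> W w s = w * (J + Phi s).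
  by move=> qs se; rewrite /W (leNgt s q) qs/= se.
have Wbig w s : q + e <= s -> W w s = w * (J + Phi (q + e)) + Phi s - Phi (q + e).
  move=> es; have qs := lt_le_trans qqe es; rewrite /W leNgt qs/=.
  by case: (leP s (q + e)) => // se; rewrite (_ : s = q + e) ?addrK//; apply/eqP;
    rewrite eq_le se.
move: (W) Wlo Wmid Wbig => {}W Wlo Wmid Wbig.
have W0 w t : 0 <= w -> 0 <= W w t.
  move=> w0; have [tq|qt] := leP t q; first by rewrite Wlo.
  have [te|/ltW et] := leP t (q + e).
    by rewrite Wmid// mulr_ge0// addr_ge0//; have /andP[] := PV _ qt.
  have := Pmono _ _ qqe et; have : 0 <= w * (J + Phi (q + e)) by rewrite mulr_ge0// addr_ge0.
  by rewrite Wbig//; lra.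
have Wmono w s t : 0 <= w -> s <= t -> W w s <= W w t.
  move=> w0 st; have [sq|qs] := leP s q; first by rewrite (Wlo _ _ sq); exact: W0.
  have [es|/ltW se] := leP (q + e) s.
    by rewrite !Wbig//; [have := Pmono _ _ qs st; lra|exact: le_trans st].
  have [et|/ltW te] := leP (q + e) t.
    rewrite (Wbig _ _ et) Wmid//.
    have := Pmono _ _ qqe et.
    have : w * (J + Phi s) <= w * (J + Phi (q + e)).
      by rewrite ler_wpM2l// lerD2l; apply: Pmono.
    lra.
  by rewrite !Wmid ?(lt_le_trans qs)// ler_wpM2l// lerD2l; exact: Pmono.
have WT w L t : 0 <= w -> 1 <= L -> 2 * w <= L -> W w t <= w * (e^-1 * mass h) + L * V.
  move=> w0 L1 wL.
  have H0 : 0 <= w * (e^-1 * mass h) by rewrite !mulr_ge0.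
  have HV : 0 <= L * V by rewrite mulr_ge0//; lra.
  have [tq|qt] := leP t q; first by rewrite Wlo//; lra.
  have /andP[p0 pV] := PV _ qt.
  have LV : 2 * w * V <= L * V by rewrite ler_wpM2r.
  have [te|/ltW et] := leP t (q + e).
    have : w * (Phi (q + e) + Phi t) <= w * (V + V) by rewrite ler_wpM2l// lerD.
    by rewrite Wmid// /J; lra.
  have : (L - 2 * w) * Phi (q + e) >= 0 by rewrite mulr_ge0//; lra.
  have := Pmono _ _ qqe et => pp.
  have : (L - 1) * Phi t <= (L - 1) * V by rewrite ler_wpM2l//; lra.
  have : (L - 1) * Phi (q + e) <= (L - 1) * Phi t by rewrite ler_wpM2l//; lra.
  by rewrite Wbig// /J; lra.
have lsum x n : 0 <= x -> \sum_(k < n) nrm (z ^+ k.+1 * lift h (x + k.+1%:R)) <= 2 * (M * q).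
  by move=> x0; apply: lift_sum => //; exact: nh.1.
(* The weight w = 1 gives the variation of the image itself. *)
have T1 : bv U (transfer z h) (e^-1 * mass h + 2 * V).
  have WT1 t : 0 <= W 1 t <= e^-1 * mass h + 2 * V.
    rewrite W0//=; have := WT 1 2 t ler01; rewrite mul1r mulr1; apply=> //; lra.
  have [om omT omm] := shift_majorant WT1 (fun s t => @Wmono 1 s t ler01).
  exists om; first by move=> x; rewrite UE => /andP[x0 x1]; apply: omT; rewrite !ltW.
  move=> x y; rewrite !UE => /andP[x0 x1] /andP[y0 y1] xy.
  rewrite -[leLHS]mul1r.
  apply: (@tail_diff z (lift h) x y 1 _ (2 * (M * q))) => // [n|n|n].
  - exact/lsum/ltW.
  - exact/lsum/ltW.
  - apply: le_trans (omm _ _ (ltW x0) xy (ltW y1) n); apply: ler_sum => k _.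
    rewrite mul1r; set s := x + _; set t := y + _.
    have st : s <= t by rewrite lerD2r.
    have [tq|qt] := leP t q.
      by rewrite !lift_small ?(le_trans st)// subrr nrm0 subr_ge0 Wmono.
    have W1E r : q < r -> W 1 r = J + Phi r.
      move=> qr; have [re|/ltW er] := leP r (q + e); first by rewrite Wmid// mul1r.
      by rewrite Wbig// mul1r; lra.
    have WtE := W1E _ qt.
    have [sq|qs] := leP s q.
      rewrite (lift_small _ sq) subr0 (Wlo _ _ sq) subr0 WtE.
      have [te|et] := leP t (q + e).
        by have := Jb _ qt te; have /andP[] := PV _ qt; lra.
      have := Pm _ _ qqe (ltW et); have := Jb _ qqe (lexx _).
      by have := nrm_tri (lift h t) (lift h (q + e)) 0; rewrite !subr0; lra.
    by rewrite WtE (W1E _ qs); have := Pm _ _ qs st; lra.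
have Lb : forall x, 0 < x < 1 -> nrm (transfer z h x) <= 2 * (M * q).
  by move=> x /andP[x0 _]; apply: nrm_csum_le => n; exact/lsum/ltW.
have nL : bvnorm_le (transfer z h) (Num.max (2 * (M * q)) (e^-1 * mass h + 2 * V)).
  split; first by move=> x /Lb/le_trans; apply; rewrite le_max lexx.
  by apply: bv_le T1; rewrite le_max lexx orbT.
have mL := transfer_mass z1 nh nL.
have nL' : bvnorm_le (transfer z h) ((3 + 2 * e^-1) * (V + mass h)).
  have eV : 0 <= e^-1 * V by rewrite mulr_ge0.
  have eI : 0 <= e^-1 * mass h by rewrite mulr_ge0.
  split; last by apply: bv_le T1; lra.
  by move=> x x01; have := bv_sup_le nL T1 x01; lra.
split=> //.
set f := transfer z h in T1 Lb nL mL nL' *.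
(* The weight w = m ^+ 2 suits points whose translate lies in (q, q + e), since
   these points are at most m. *)
have WT2 t : 0 <= W (m ^+ 2) t <= m ^+ 2 * (e^-1 * mass h) + K * V.
  by rewrite W0 ?sqr_ge0//=; apply: WT; rewrite ?sqr_ge0.
have [om omT omm] := shift_majorant WT2 (fun s t => @Wmono (m ^+ 2) s t (sqr_ge0 _)).
have omU y : 0 < y < 1 -> 0 <= om y <= m ^+ 2 * (e^-1 * mass h) + K * V.
  by move=> /andP[y0 y1]; apply: omT; rewrite !ltW.
have side x y : 0 < x -> x <= y -> y < 1 -> (y <= m \/ m <= x) ->
    y ^+ 2 * nrm (f y - f x) <= om y - om x.
  move=> x0 xy y1 xym; have y0 := lt_le_trans x0 xy.
  apply: (@tail_diff z (lift h) x y (y ^+ 2) _ (2 * (M * q))) => // [|n|n|n].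
  - by rewrite exprn_gt0.
  - exact/lsum/ltW.
  - exact/lsum/ltW.
  apply: le_trans (omm _ _ (ltW x0) xy (ltW y1) n); apply: ler_sum => k _.
  set s := x + _; set t := y + _.
  have st : s <= t by rewrite lerD2r.
  have w0 : 0 <= m ^+ 2 by rewrite sqr_ge0.
  have y21 : y ^+ 2 <= 1 by rewrite expr_le1 ?ltW.
  have [tq|qt] := leP t q.
    by rewrite !lift_small ?(le_trans st)// subrr nrm0 mulr0 subr_ge0 Wmono.
  have Nk : (N <= k.+1)%N.
    rewrite -ltnS -(ltr_nat R) -natr1; move: qt; rewrite /t; lra.
  have Nk' : N%:R <= k.+1%:R :> R by rewrite ler_nat.
  have smallm r : r + k.+1%:R <= q + e -> r <= m by rewrite /e; lra.
  have y2m : y <= m -> y ^+ 2 <= m ^+ 2 by move=> ym; rewrite lerXn2r ?nnegrE ?(ltW y0) ?(ltW m0).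
  have [sq|qs] := leP s q.
    have kN : (k.+1 <= N)%N.
      by rewrite -ltnS -(ltr_nat R); move: sq x0 qN; rewrite /s; lra.
    have kNE : k.+1%:R = N%:R :> R by congr (_%:R); apply/eqP; rewrite eqn_leq kN Nk.
    have te : t <= q + e.
      case: xym => [ym|mx]; first by rewrite /t kNE /e; lra.
      by move: sq; rewrite /s kNE; lra.
    rewrite (lift_small _ sq) subr0 (Wlo _ _ sq) subr0 Wmid//.
    have Jt := Jb _ qt te; have /andP[Pt _] := PV _ qt.
    have ym : y ^+ 2 <= m ^+ 2 by apply: y2m; exact: smallm.
    apply: (@le_trans _ _ (m ^+ 2 * J)); first by rewrite ler_pM ?sqr_ge0 ?nrm_ge0.
    by rewrite ler_wpM2l//; lra.
  have Pst := Pm _ _ qs st.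
  have [es|se] := leP (q + e) s.
    rewrite !Wbig//; last exact: le_trans st.
    apply: (@le_trans _ _ (Phi t - Phi s)); last lra.
    by apply: le_trans Pst; rewrite -[leRHS]mul1r ler_wpM2r ?nrm_ge0.
  have te : t <= q + e.
    have kN : (k.+1 <= N)%N.
      by rewrite -ltnS -(ltr_nat R) -natr1; move: se x0 m1; rewrite /s /e; lra.
    have kNE : k.+1%:R = N%:R :> R by congr (_%:R); apply/eqP; rewrite eqn_leq kN Nk.
    case: xym => [ym|mx]; first by rewrite /t kNE /e; lra.
    by move: se; rewrite /s kNE /e; lra.
  rewrite !Wmid ?(ltW se)//.
  have -> : m ^+ 2 * (J + Phi t) - m ^+ 2 * (J + Phi s) = m ^+ 2 * (Phi t - Phi s) by ring.
  rewrite ler_pM ?sqr_ge0 ?nrm_ge0//.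
  by apply: y2m; exact: smallm.
have m2le : m ^+ 2 <= 1 by rewrite expr_le1 ?ltW.
have qi1 : q^-1 <= 1 by rewrite invf_le1// ltW.
have bvth : bv U (fun y => (y ^+ 2)%:C * f y) (2 * mass h + (m ^+ 2 * (e^-1 * mass h) + K * V)).
  by apply: bv_le (weighted_bv nL m0 m1 omU side); rewrite lerD2r ler_wpM2l.
have := bvZ (q^-1)%:C (@bv_anti R U `]q, +oo[%classic _ (fun t => q / t) _ _ _ bvth).
rewrite nrm_real ger0_norm ?invr_ge0 ?(ltW q0)// => HH.
apply: (@bv_eq _ _ _ (lift f)); last apply: bv_le (HH _ _).
- move=> t; rewrite QE => qt; rewrite lift_large// mulrA -rmorphM/=; congr (_%:C * _).
  have t0 : t != 0 by rewrite gt_eqF// (lt_trans q0).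
  by field; rewrite t0 qn0.
- have eI : 0 <= e^-1 * mass h by rewrite mulr_ge0.
  have mm : m ^+ 2 * (e^-1 * mass h) <= e^-1 * mass h by rewrite ler_piMl.
  rewrite !mulrDr mulrA [q^-1 * (K * V)]mulrA [q^-1 * K]mulrC.
  have s1 : q^-1 * (2 * mass h) <= 2 * mass h by rewrite ler_piMl// mulr_ge0.
  have s2 : q^-1 * (m ^+ 2 * (e^-1 * mass h)) <= e^-1 * mass h.
    by apply: le_trans mm; rewrite ler_piMl// mulr_ge0 ?sqr_ge0.
  by move: s1 s2; rewrite mulrA; lra.
- move=> t; rewrite QE UE => qt; have t0 := lt_trans q0 qt.
  by rewrite divr_gt0//= ltr_pdivrMr// mul1r.
- move=> s t; rewrite !QE => qs qt st.
  by rewrite ler_wpM2l ?(ltW q0)// lef_pV2 ?posrE ?(lt_trans q0).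
Qed.

End transfer.

(** * Compactness along ultrafilters *)

Section alternative.
Context (R : realType) (q : R) (q1 : 1 < q).
Local Notation mu := (@lebesgue_measure R).
Local Notation U := (`]0%R, 1%R[%classic : set R).
Local Notation D := (`]0%R, +oo[%classic : set R).
Local Notation Re := complex.Re.
Local Notation Im := complex.Im.
Local Notation lift := (lift q).
Local Notation transfer := (transfer q).
Implicit Types (f g h : R -> R[i]) (z : R[i]).

Let q0 : 0 < q. Proof. exact: lt_trans q1. Qed.

Lemma lift_ext f g : (forall x, 0 < x < 1 -> f x = g x) -> lift f = lift g.
Proof.
move=> fg; congr flip; apply/funext => x; rewrite /cut.
by case: ifP => // /fg.
Qed.

Lemma transfer_ext z f g : (forall x, 0 < x < 1 -> f x = g x) -> transfer z f = transfer z g.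
Proof. by move=> fg; rewrite /transfer (lift_ext fg). Qed.

Lemma liftD f g t : lift (fun y => f y + g y) t = lift f t + lift g t.
Proof. by rewrite /lift /flip /cut; case: ifP => _; rewrite ?addr0 ?mulr0 ?addr0// mulrDr. Qed.

Lemma liftZ c f t : lift (fun y => c * f y) t = c * lift f t.
Proof. by rewrite /lift /flip /cut; case: ifP => _; rewrite ?mulr0// mulrCA. Qed.

Lemma transfer_sup z h B x : nrm z = 1 -> 0 <= B -> (forall x, 0 < x < 1 -> nrm (h x) <= B) ->
  0 <= x -> nrm (transfer z h x) <= 2 * (B * q).
Proof. by move=> z1 B0 hB x0; apply: nrm_csum_le => n; exact: lift_sum. Qed.

Lemma transferD z f g A B x : nrm z = 1 -> 0 <= A -> 0 <= B ->
  (forall x, 0 < x < 1 -> nrm (f x) <= A) -> (forall x, 0 < x < 1 -> nrm (g x) <= B) ->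
  0 <= x -> transfer z (fun y => f y + g y) x = transfer z f x + transfer z g x.
Proof.
move=> z1 A0 B0 fA gB x0; rewrite /transfer /tail.
rewrite -(csumD (fun n => lift_sum q1 n z1 fA A0 x0) (fun n => lift_sum q1 n z1 gB B0 x0)).
by apply: csum_eq => k; rewrite liftD mulrDr.
Qed.

Lemma transferZ z c f A x : nrm z = 1 -> 0 <= A ->
  (forall x, 0 < x < 1 -> nrm (f x) <= A) ->
  0 <= x -> transfer z (fun y => c * f y) x = c * transfer z f x.
Proof.
move=> z1 A0 fA x0; rewrite /transfer /tail.
rewrite -(csumZ c (fun n => lift_sum q1 n z1 fA A0 x0)).
by apply: csum_eq => k; rewrite liftZ mulrCA.
Qed.

Definition pointwise_cvg (G : set_system nat) (u : nat -> R -> R[i]) f := forall x, 0 < x < 1 ->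
  forall e, 0 < e -> \forall n \near G, nrm (u n x - f x) <= e.

Lemma ex_small_quotient (C e : R) : 0 <= C -> 0 < e -> exists N : nat, (1 < N)%N /\ C / N%:R <= e.
Proof.
move=> C0 e0; exists (Num.truncn (C / e)).+2; split=> //.
rewrite ler_pdivrMr// mulrC -ler_pdivrMr// ltW//.
by rewrite (lt_trans (truncnS_gt _))// ltr_nat.
Qed.

(** The tails of the series are uniformly small because the functions have a
    common bound, and finite sums converge. *)
Lemma transfer_pointwise_cvg (G : set_system nat) {FG : Filter G} z u f B : nrm z = 1 -> 0 <= B ->
  (forall n x, 0 < x < 1 -> nrm (u n x) <= B) -> (forall x, 0 < x < 1 -> nrm (f x) <= B) ->
  pointwise_cvg G u f -> pointwise_cvg G (fun n => transfer z (u n)) (transfer z f).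
Proof.
move=> z1 B0 uB fB uf x x01 e e0; have /andP[x0 x1] := x01.
pose d n y := u n y + -1 * f y.
have fB' y : 0 < y < 1 -> nrm (-1 * f y) <= B by move=> y01; rewrite mulN1r nrmN fB.
have dB n y : 0 < y < 1 -> nrm (d n y) <= B + B.
  by move=> y01; rewrite (le_trans (nrmD _ _))// lerD ?uB ?fB'.
have BB : 0 <= B + B by rewrite addr_ge0.
have dE n : transfer z (u n) x - transfer z f x = transfer z (d n) x.
  by rewrite /d (transferD z1 B0 B0 (uB n) fB' (ltW x0)) (transferZ _ z1 B0 fB (ltW x0)) mulN1r.
have e20 : 0 < e / 2 by rewrite divr_gt0.
have [N [N1 CN]] := ex_small_quotient (mulr_ge0 BB (ltW q0)) e20.
have S M : forall c, 0 < c ->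
    \forall n \near G, \sum_(k < M) nrm (z ^+ k.+1 * lift (d n) (x + k.+1%:R)) <= c.
  elim: M => [|M IH] c c0; first by apply: nearW => n; rewrite big_ord0 ltW.
  have c20 : 0 < c / 2 by rewrite divr_gt0.
  set t := x + M.+1%:R; have t0 : 0 < t by rewrite ltr_wpDr.
  have t1 : 1 <= t by rewrite ler_wpDl ?(ltW x0)// ler1n.
  have H : \forall n \near G, nrm (lift (d n) t) <= c / 2.
    have [tq|qt] := leP t q.
      by apply: nearW => n; rewrite lift_small// nrm0 ltW.
    have qt01 : 0 < q / t < 1 by rewrite divr_gt0//= ltr_pdivrMr// mul1r.
    have := uf _ qt01 (c / 2 / q) (divr_gt0 c20 q0).
    apply: filterS => n h; rewrite lift_large// nrmM nrm_real ger0_norm; last first.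
      by rewrite mulr_ge0 ?(ltW q0)// invr_ge0 sqr_ge0.
    rewrite /d mulN1r; apply: (@le_trans _ _ (q * (c / 2 / q))); last first.
      by rewrite mulrC divfK ?gt_eqF.
    rewrite ler_pM ?nrm_ge0 ?mulr_ge0 ?(ltW q0)// ?invr_ge0 ?sqr_ge0//.
    by rewrite ler_piMr ?(ltW q0)// invf_le1 ?exprn_gt0// exprn_ege1.
  have H2 := IH _ c20; apply: filterS2 H H2 => n h1 h2.
  rewrite big_ord_recr/= [c]splitr lerD// nrmM nrmX z1 expr1n mul1r//.
have := S N _ e20; apply: filterS => n h; rewrite dE.
have := @csum_tail _ (fun k => z ^+ k.+1 * lift (d n) (x + k.+1%:R)) _ _ N
  (fun m => lift_sum q1 m z1 (dB n) BB (ltW x0))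
  (fun m => lift_sum_tail q1 m z1 (dB n) BB (ltW x0) (ltnW N1)).
rewrite -/(tail z _ _) -/(transfer z (d n) x) => h'.
have h2 := le_trans (nrm_sum _ _ _) h.
have := nrm_tri (transfer z (d n) x) (psum (fun k => z ^+ k.+1 * lift (d n) (x + k.+1%:R)) N) 0.
rewrite !subr0 => /le_trans; apply; rewrite [e]splitr lerD//.
exact: le_trans h' CN.
Qed.

Lemma ultra_lim (G : set_system nat) {UG : UltraFilter G} (a : nat -> R) B :
  (forall n, `|a n| <= B) -> exists l : R, forall e, 0 < e -> \forall n \near G, `|a n - l| <= e.
Proof.
move=> aB; have PG : ProperFilter G by exact: ultra_proper.
have cpt := @segment_compact R (- B) B.
have FG : ProperFilter (a @ G) by exact: fmap_proper_filter.
have [] := cpt _ FG.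
  by apply: nearW => n; rewrite /= in_itv/= -ler_norml.
move=> l [_ cl]; exists l => e e0.
have [//|nG] := in_ultra_setVsetC [set n | `|a n - l| <= e] UG.
have nl : nbhs l [set y | `|y - l| <= e].
  by apply/nbhs_ballP; exists e => // y /=; rewrite -ball_normE/= distrC => /ltW.
have aG : (a @ G) [set y | ~ (`|y - l| <= e)] by exact: nG.
by have [y [h1 h2]] := cl _ _ aG nl; case: (h1 h2).
Qed.

Lemma near_le (G : set_system nat) {PG : ProperFilter G} (x y : R) :
  (forall e, 0 < e -> \forall n \near G, x <= y + e) -> x <= y.
Proof.
move=> H; apply/ler_addgt0Pr => e e0; have [n] := filter_ex (H e e0); by [].
Qed.

(** Helly's selection theorem with an ultrafilter in place of a subsequence: at
    every point the values and the majorants have limits by compactness. *)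
Lemma bvnorm_ultra (G : set_system nat) {UG : UltraFilter G} (u : nat -> R -> R[i]) B :
  (forall n, bvnorm_le (u n) B) -> exists2 g, bvnorm_le g B & pointwise_cvg G u g.
Proof.
move=> uB; have PG : ProperFilter G by exact: ultra_proper.
have B0 := bvnorm_ge0 (uB 0%N).
have cB n x : nrm (cut (u n) x) <= B.
  by rewrite /cut; case: ifP => [|_]; [exact: (uB n).1|rewrite nrm0].
have /choice[phi phiP] : forall n, exists p : R -> R,
    (forall x, U x -> 0 <= p x <= B) /\ majorant U (u n) p.
  by move=> n; have [_ [p pb pm]] := uB n; exists p.
pose p n x := if 0 < x < 1 then phi n x else 0.
have pB n x : `|p n x| <= B.
  rewrite /p; case: ifP => [x01|_]; last by rewrite normr0.
  by have /andP[a b] := (phiP n).1 x (eq_ind_r id x01 (UE x)); rewrite ger0_norm.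
have [gr grP] := choice (fun x => ultra_lim (fun n => le_trans (abs_Re_le _) (cB n x))).
have [gi giP] := choice (fun x => ultra_lim (fun n => le_trans (abs_Im_le _) (cB n x))).
have [ps psP] := choice (fun x => ultra_lim (fun n => pB n x)).
pose g x := gr x +i* gi x.
have ug : pointwise_cvg G u g.
  move=> x x01 e e0; have e20 : 0 < e / 2 by rewrite divr_gt0.
  apply: filterS2 (grP x _ e20) (giP x _ e20) => n; rewrite /cut x01 => h1 h2.
  apply: (le_trans (nrm_le_ReIm _)); rewrite cReD cReN cImD cImN [e]splitr.
  exact: lerD.
have pp x : 0 < x < 1 -> forall e, 0 < e -> \forall n \near G, `|phi n x - ps x| <= e.
  by move=> x01 e e0; have := psP x e e0; apply: filterS => n; rewrite /p x01.
exists g => //; split.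
  move=> x x01; apply: (near_le (G := G)) => e e0; have := ug x x01 e e0.
  apply: filterS => n h; have := nrm_tri (g x) (u n x) 0; rewrite !subr0.
  by rewrite nrmBC => /le_trans; apply; rewrite addrC lerD// (uB n).1.
exists ps.
  move=> x Ux; have x01 : 0 < x < 1 by rewrite -UE.
  apply/andP; split.
    apply: (near_le (G := G)) => e e0; have := pp x x01 e e0; apply: filterS => n.
    by have /andP[? _] := (phiP n).1 x Ux; rewrite ler_norml => /andP[? ?]; lra.
  apply: (near_le (G := G)) => e e0; have := pp x x01 e e0; apply: filterS => n.
  by have /andP[_ ?] := (phiP n).1 x Ux; rewrite ler_norml => /andP[? ?]; lra.
move=> x y Ux Uy xy; have x01 : 0 < x < 1 by rewrite -UE.
have y01 : 0 < y < 1 by rewrite -UE.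
apply: (near_le (G := G)) => e e0; have e40 : 0 < e / 4 by rewrite divr_gt0.
have A1 := pp x x01 _ e40; have A2 := pp y y01 _ e40.
have A3 := ug x x01 _ e40; have A4 := ug y y01 _ e40.
have FG : Filter G by typeclasses eauto.
have A := @filterI _ G FG _ _ (@filterI _ G FG _ _ A1 A2) (@filterI _ G FG _ _ A3 A4).
move: A; apply: filterS => n [[+ +] [h3 h4]].
rewrite !ler_norml => /andP[? ?] /andP[? ?].
have := (phiP n).2 x y Ux Uy xy => h5.
have E : g y - g x = (u n y - u n x) + ((u n x - g x) - (u n y - g y)) by ring.
have {}h3 : nrm (u n x - g x) <= e / 4 := h3.
have {}h4 : nrm (u n y - g y) <= e / 4 := h4.
change (nrm (g y - g x) <= ps y - ps x + e); rewrite E; have := nrmD (u n y - u n x) ((u n x - g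
  x) - (u n y - g y)).
by have := nrmB (u n x - g x) (u n y - g y); lra.
Qed.

(** On each of the m cells |h| exceeds d by at most the increment of the
    majorant, and these increments add up to at most B. *)
Lemma mass_sample h B (d : R) m : bvnorm_le h B -> (1 < m)%N -> 0 <= d ->
  (forall j, (j < m)%N -> exists x : R,
    [/\ j%:R / m%:R <= x <= j.+1%:R / m%:R, 0 < x < 1 & nrm (h x) <= d]) ->
  mass h <= d + B / m%:R.
Proof.
move=> nh m1 d0 hd; have [_ [phi pb pm]] := nh; have iU := bvnorm_integrable nh.
have B0 := bvnorm_ge0 nh.
have m0 : 0 < m%:R :> R by rewrite ltr0n ltnW.
pose a j : R := j%:R / m%:R.
(* The majorant at the grid points, replaced by its bounds 0 and B at the end
   points of (0,1). *)
pose psi (j : nat) := if j == 0%N then 0 else if (j < m)%N then phi (a j) else B.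
have a0 j : 0 <= a j by rewrite divr_ge0// ler0n.
have am j : (j <= m)%N -> a j <= 1 by move=> jm; rewrite ler_pdivrMr// mul1r ler_nat.
have aU j : (0 < j < m)%N -> U (a j).
  by move=> /andP[j0 jm]; rewrite UE /a divr_gt0 ?m0 ?ltr0n//= ltr_pdivrMr// mul1r ltr_nat.
have aS j : a j.+1 - a j = m%:R^-1 by rewrite /a -natr1 mulrDl mul1r addrAC subrr add0r.
have pmono x y : U x -> U y -> x <= y -> phi x <= phi y.
  by move=> Ux Uy xy; have := pm x y Ux Uy xy; have := nrm_ge0 (h y - h x); lra.
have lo j y : (j < m)%N -> U y -> a j <= y -> psi j <= phi y.
  move=> jm Uy jy; rewrite /psi jm; case: eqVneq => [_|j0]; first by have /andP[] := pb _ Uy.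
  by apply: pmono => //; apply: aU; rewrite lt0n j0.
have hi j y : U y -> y <= a j.+1 -> phi y <= psi j.+1.
  move=> Uy jy; rewrite /psi/=; case: ifP => jm; last by have /andP[] := pb _ Uy.
  by apply: pmono => //; exact: aU.
have loc j : (j < m)%N -> forall t, a j < t < a j.+1 -> nrm (h t) <= d + (psi j.+1 - psi j).
  move=> jm t /andP[jt tj].
  have Ut : U t by rewrite UE (le_lt_trans (a0 j) jt) (lt_le_trans tj (am _ jm)).
  have [x [/andP[jx xj] x01 hx]] := hd j jm; have Ux : U x by rewrite UE.
  have l1 := lo j x jm Ux jx; have l2 := lo j t jm Ut (ltW jt).
  have h1 := hi j x Ux xj; have h2 := hi j t Ut (ltW tj).
  have := nrm_tri (h t) (h x) 0; rewrite !subr0.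
  case: (leP x t) => [xt|/ltW tx]; first by have := pm x t Ux Ut xt; lra.
  by have := pm t x Ut Ux tx; rewrite nrmBC; lra.
have key j : (j <= m)%N ->
    Rintegral mu `]0, a j[ (fun s => nrm (h s)) <= (j%:R * d + psi j) / m%:R.
  elim: j => [_|j IH jm].
    by rewrite /a !mul0r set_itvoo0 Rintegral_set0 /psi/= addr0 mul0r.
  have aj : a j < a j.+1 by rewrite -subr_gt0 aS invr_gt0.
  have sp := Rint_split iU (a0 j) (ltW aj) (am _ jm).
  have up : Rintegral mu `]a j, a j.+1[ (fun s => nrm (h s)) <= (d + (psi j.+1 - psi j)) / m%:R.
    rewrite -(aS j) -RintC ?(ltW aj)//; apply: Rint_le.
    - by apply: (integrable_sub iU) => //; exact: am.
    - exact: integrableC.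
    - by move=> t tj; exact: (loc j jm t tj).
  have IHj := IH (ltnW jm).
  have -> : (j.+1%:R * d + psi j.+1) / m%:R =
      (j%:R * d + psi j) / m%:R + (d + (psi j.+1 - psi j)) / m%:R.
    by rewrite -natr1; ring.
  by move: IHj up sp; move: (Rintegral _ _ _) (Rintegral _ _ _) (Rintegral _ _ _) (_ / _) (_ / _)
    => r1 r2 r3 r4 r5; lra.
have := key m (leqnn m); rewrite /a divff ?gt_eqF//.
move=> /le_trans; apply; rewrite mulrDl mulrAC divff ?gt_eqF// mul1r lerD2l.
by rewrite /psi ltnn; case: ifP => // /eqP mE; rewrite mE in m1.
Qed.

(** By [mass_sample] it is enough that the functions are small at finitely many
    points. *)
Lemma mass_pointwise_cvg (G : set_system nat) {FG : Filter G} u B : (forall n,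
  bvnorm_le (u n) B) ->
  pointwise_cvg G u (fun=> 0) -> forall e, 0 < e -> \forall n \near G, mass (u n) <= e.
Proof.
move=> uB uG e e0; have B0 := bvnorm_ge0 (uB 0%N).
have e20 : 0 < e / 2 by rewrite divr_gt0.
have [m [m1 Bm]] := ex_small_quotient B0 e20.
have S k : \forall n \near G, forall j, (0 < j < m)%N -> (j < k)%N ->
    nrm (u n (j%:R / m%:R)) <= e / 2.
  elim: k => [|k IH]; first by apply: nearW => n j.
  have [km|km] := boolP (0 < k < m)%N; last first.
    move: IH; apply: filterS => n h j j0; rewrite ltnS leq_eqVlt => /orP[/eqP jk|]; last exact: h.
    by rewrite jk (negbTE km) in j0.
  have k01 : 0 < (k%:R / m%:R : R) < 1.
    have m0 : 0 < m%:R :> R by rewrite ltr0n ltnW.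
    by case/andP: km => k0 km; rewrite divr_gt0 ?m0 ?ltr0n//= ltr_pdivrMr// mul1r ltr_nat.
  have H := uG _ k01 _ e20.
  apply: filterS2 IH H => n h1 h2 j j0; rewrite ltnS leq_eqVlt => /orP[/eqP ->|]; last exact: h1.
  by rewrite subr0 in h2.
have := S m; apply: filterS => n h.
apply: (le_trans (mass_sample (uB n) m1 (ltW e20) _)); last by rewrite [leRHS]splitr lerD2l.
have m0 : 0 < m%:R :> R by rewrite ltr0n ltnW.
(* The first cell is sampled at its right end point, 0 being excluded. *)
move=> j jm; pose i := if j == 0%N then 1%N else j.
have i0 : (0 < i < m)%N by rewrite /i; case: eqVneq => // j0; rewrite lt0n j0.
have ji : (j <= i <= j.+1)%N by rewrite /i; case: eqVneq => [->//|_]; rewrite leqnn leqnSn.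
exists (i%:R / m%:R); split; last by apply: h => //; case/andP: i0.
  by case/andP: ji => ? ?; rewrite !ler_pM2r ?invr_gt0// !ler_nat; apply/andP.
by case/andP: i0 => ? ?; rewrite divr_gt0 ?m0 ?ltr0n//= ltr_pdivrMr// mul1r ltr_nat.
Qed.

End alternative.

(** * The Fredholm alternative *)

Section fredholm.
Context (R : realType) (q : R) (q1 : 1 < q).
Local Notation mu := (@lebesgue_measure R).
Local Notation U := (`]0%R, 1%R[%classic : set R).
Local Notation Re := complex.Re.
Local Notation Im := complex.Im.
Local Notation lift := (lift q).
Local Notation transfer := (transfer q).
Implicit Types (f g h w : R -> R[i]) (z e : R[i]).

Let q0 : 0 < q. Proof. exact: lt_trans q1. Qed.
Let mU : measurable U. Proof. exact: measurable_itv. Qed.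

Lemma bvnorm_lift h M : bvnorm_le h M -> bv `]q, +oo[ (lift h) (2 * M).
Proof.
move=> nh; have M0 := bvnorm_ge0 nh.
have QE t : `]q, +oo[%classic t = (q < t) :> Prop by rewrite /= in_itv/= andbT.
have dn s t : q < s -> s <= t -> q * t ^- 2 <= q * s ^- 2.
  move=> qs st; have s0 := lt_trans q0 qs; have t0 := lt_le_trans s0 st.
  by rewrite ler_wpM2l ?(ltW q0)// lef_pV2 ?posrE ?exprn_gt0// lerXn2r ?nnegrE ?(ltW s0) ?(ltW
    t0).
have d0 t : 0 <= q * t ^- 2 by rewrite mulr_ge0 ?(ltW q0)// invr_ge0 sqr_ge0.
have d1 t : q < t -> q * t ^- 2 <= 1.
  move=> qt; have t0 := lt_trans q0 qt; rewrite ler_pdivrMr ?exprn_gt0// mul1r expr2.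
  apply: (le_trans (ltW qt)); rewrite ler_pMr//; apply: ltW; exact: lt_trans qt.
have b1 : bv `]q, +oo[ (fun t => (q * t ^- 2)%:C) 1.
  exists (fun t => 1 - q * t ^- 2).
    by move=> t; rewrite QE => qt; rewrite subr_ge0 d1//= gerBl d0.
  move=> s t; rewrite !QE => qs qt st; rewrite -rmorphB nrm_real distrC ger0_norm ?subr_ge0 ?dn//.
  lra.
have b2 : bv `]q, +oo[ (fun t => h (q / t)) M.
  apply: (@bv_anti R U _ h (fun t => q / t) _ _ _ nh.2).
    move=> t; rewrite QE UE => qt; have t0 := lt_trans q0 qt.
    by rewrite divr_gt0//= ltr_pdivrMr// mul1r.
  move=> s t; rewrite !QE => qs qt st.
  by rewrite ler_wpM2l ?(ltW q0)// lef_pV2 ?posrE ?(lt_trans q0).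
have b := bvM ler01 M0 _ _ b1 b2.
apply: (@bv_eq _ _ (fun t => (q * t ^- 2)%:C * h (q / t))).
  by move=> t; rewrite QE => qt; rewrite lift_large.
apply: (@bv_le _ _ _ (M * 1 + 1 * M)); first lra.
apply: b => t; rewrite QE => qt; first by rewrite nrm_real ger0_norm ?d0// d1.
by have t0 := lt_trans q0 qt; apply: nh.1; rewrite divr_gt0//= ltr_pdivrMr// mul1r.
Qed.

Lemma transfer_bvnorm z h M : nrm z = 1 -> bvnorm_le h M -> exists N, bvnorm_le (transfer z h) N.
Proof.
move=> z1 nh; have [k [C [k1 C0 LY]]] := lasota_yorke q1.
have M0 := bvnorm_ge0 nh; have [] := LY z h M (2 * M) z1 nh (mulr_ge0 _ M0) (bvnorm_lift nh) =>
  //.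
by move=> n1 _ _; eexists; exact: n1.
Qed.

Definition double_transfer z e h := transfer z (transfer e h).

Lemma double_transfer_LY : exists kappa C : R, [/\ 0 <= kappa < 1, 0 <= C &
  forall z e h M V, nrm z = 1 -> nrm e = 1 -> bvnorm_le h M -> 0 <= V -> bv `]q,
    +oo[ (lift h) V ->
  [/\ bvnorm_le (double_transfer z e h) (C * (V + mass h)),
      bv `]q, +oo[ (lift (double_transfer z e h)) (kappa * V + C * mass h) &
      mass (double_transfer z e h) <= mass h]].
Proof.
have [k [C [/andP[k0 k1] C0 LY]]] := lasota_yorke q1.
exists k, (C * (3 + C)); split; [by rewrite k0|by rewrite mulr_ge0// addr_ge0|].
move=> z e h M V z1 e1 nh V0 bV; have m0 := mass_ge0 h.
have [n1 b1 m1] := LY e h M V e1 nh V0 bV.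
have kV : k * V <= V by rewrite ler_piMl// ltW.
have kV0 : 0 <= k * V by rewrite mulr_ge0.
have Cm0 : 0 <= C * mass h by rewrite mulr_ge0.
have V1 : 0 <= k * V + C * mass h by rewrite addr_ge0.
have [n2 b2 m2] := LY z _ _ _ z1 n1 V1 b1.
have CC0 : 0 <= C * (C * mass h) by rewrite mulr_ge0.
have CV0 : 0 <= C * V by rewrite mulr_ge0.
have CCV0 : 0 <= C * (C * V) by rewrite mulr_ge0.
have CkV : C * (k * V) <= C * V by rewrite ler_wpM2l.
have Cm1 : C * mass (transfer e h) <= C * mass h by rewrite ler_wpM2l.
have kkV : k * (k * V) <= k * V by rewrite ler_wpM2l.
have kCm : k * (C * mass h) <= C * mass h by rewrite ler_piMl// ltW.
have -> : C * (3 + C) * (V + mass h) = 3 * (C * V) + 3 * (C * mass h) + C * (C * V) + C * (C *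
  mass h).
  by ring.
have EC : C * (3 + C) * mass h = 3 * (C * mass h) + C * (C * mass h) by ring.
split; last exact: le_trans m2 m1.
- apply: bvnorm_leW n2; rewrite !mulrDr.
  move: {V1 V0 EC kV kkV kCm} (C * (C * V)) (C * (C * mass h)) (C * V) (C * mass h) (C * (k * V))
    (C * mass _) CC0 CV0 CCV0 CkV Cm1 Cm0 => a1 a2 a3 a4 a5 a6; clear; lra.
- apply: bv_le b2; rewrite EC mulrDr.
  move: (C * (C * mass h)) (C * mass h) (C * mass _) (k * (k * V)) (k * V) (k * (C * _)) CC0 Cm0
    Cm1 kkV kCm.
  by clear; move=> a1 a2 a3 a4 a5 a6; lra.
Qed.

Lemma double_transfer_ext z e f g : (forall x, 0 < x < 1 -> f x = g x) ->
  double_transfer z e f = double_transfer z e g.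
Proof. by move=> fg; rewrite /double_transfer (transfer_ext q e fg). Qed.

Lemma double_transfer_linear z e f g (c : R[i]) M N x : nrm z = 1 -> nrm e = 1 ->
  bvnorm_le f M -> bvnorm_le g N -> 0 <= x ->
  double_transfer z e (fun y => f y + c * g y) x = double_transfer z e f x + c * double_transfer
    z e g x.
Proof.
move=> z1 e1 nf ng x0; rewrite /double_transfer.
have M0 := bvnorm_ge0 nf; have N0 := bvnorm_ge0 ng.
have [N' ng'] : exists N', bvnorm_le (fun y => c * g y) N' by exists (nrm c * N); exact: bvnormZ.
have N'0 := bvnorm_ge0 ng'.
have [A nA] := transfer_bvnorm e1 nf; have [B nB] := transfer_bvnorm e1 ng.
have nB' := bvnormZ c nB.
rewrite (@transfer_ext _ q z _ (fun y => transfer e f y + c * transfer e g y)); last first.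
  move=> y /andP[/ltW y0 _].
  by rewrite (transferD q1 e1 M0 N'0 nf.1 ng'.1 y0) (transferZ q1 c e1 N0 ng.1 y0).
rewrite (transferD q1 z1 (bvnorm_ge0 nA) (bvnorm_ge0 nB') nA.1 nB'.1 x0).
by rewrite (transferZ q1 c z1 (bvnorm_ge0 nB) nB.1 x0).
Qed.

Lemma double_transfer_bvnorm z e h M : nrm z = 1 -> nrm e = 1 -> bvnorm_le h M -> exists N,
  bvnorm_le (double_transfer z e h) N.
Proof.
by move=> z1 e1 nh; have [N nN] := transfer_bvnorm e1 nh; exact: transfer_bvnorm z1 nN.
Qed.

Lemma L1_extend E K f g : measurable E -> measurable K -> E `<=` K ->
  (forall x, E x -> f x = g x) -> (forall x, K x -> ~ E x -> f x = 0) ->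
  L1 E g -> L1 K f /\ cintegral K f = cintegral E g.
Proof.
move=> mE mK EK fg f0 [a b].
have H (u v : R -> R) : (forall x : R, E x -> u x = v x) ->
    (forall x : R, K x -> ~ E x -> u x = 0) -> mu.-integrable E (EFin \o v) ->
    mu.-integrable K (EFin \o u) /\ Rintegral mu K u = Rintegral mu E v.
  move=> uv u0 iv.
  have pE (x : R) : K x -> ((EFin \o v) \_ E) x = (u x)%:E.
    move=> Kx; rewrite patchE; case: ifPn => [/set_mem Ex|/negP Ex]; first by rewrite /= uv.
    by rewrite u0// => h; apply: Ex; exact/mem_set.
  have KE : K `&` E = E by apply/seteqP; split=> [x []//|x Ex]; split=> //; exact: EK.
  split.
    have iT := (@integrable_mkcond _ _ _ mu E (EFin \o v) mE).1 iv.
    have iK := @integrableS _ _ _ mu setT K _ measurableT mK (@subsetT _ K) iT.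
    by apply: eq_integrable iK => // x /set_mem Kx; rewrite pE.
  rewrite /Rintegral; congr fine.
  transitivity (\int[mu]_(x in K) ((EFin \o v) \_ E) x)%E.
    by apply: eq_integral => x /set_mem Kx; rewrite pE.
  by rewrite -integral_mkcondr KE.
have [a1 a2] := H (fun x => Re (f x)) (fun x => Re (g x)) (fun x Ex => congr1 (@complex.Re R) (fg
  x Ex))
  (fun x Kx nE => congr1 (@complex.Re R) (f0 x Kx nE)) a.
have [b1 b2] := H (fun x => Im (f x)) (fun x => Im (g x)) (fun x Ex => congr1 (@complex.Im R) (fg
  x Ex))
  (fun x Kx nE => congr1 (@complex.Im R) (f0 x Kx nE)) b.
by split => //; apply: complex_eq.
Qed.

Lemma cint_tail g B M : L1 Rplus g -> (forall x, 0 < x < 1 -> g x = 0) ->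
  (forall x n, 0 < x < 1 -> \sum_(k < n) nrm (g (x + k.+1%:R)) <= B) ->
  bvnorm_le (tail 1 g) M -> cintegral U (tail 1 g) = cintegral Rplus g.
Proof.
move=> Lg g0 gB nN; have [mR mI] := bv_measurable nN.2.
have conv x : 0 < x < 1 -> ccvg (fun n => \sum_(j < n) g (x + j%:R)) (tail 1 g x).
  move=> x01; apply: (@ccvg_shift _ _ _ 1).
  have H := @csum_cvg _ (fun k => 1 ^+ k.+1 * g (x + k.+1%:R)) B.
  have {}H := H (fun n => le_trans (eq_ind_r (fun c => c <= _) (lexx _)
    (eq_bigr _ (fun k _ => eq_ind_r (fun c => nrm (c * _) = _) (congr1 (@Normc.normc R) (mul1r _))
      (expr1n _ _)))) (gB x n x01)).
  apply: (ccvg_ext _ H) => n; rewrite addn1 big_ord_recl addr0 g0// add0r.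
  by apply: eq_bigr => k _; rewrite expr1n mul1r.
have R1 := @Rintegral_period _ (fun x => Re (g x)) (fun x => Re (tail 1 g x)) Lg.1 mR.
have R2 := @Rintegral_period _ (fun x => Im (g x)) (fun x => Im (tail 1 g x)) Lg.2 mI.
have [|_ E1] := R1.
  by apply: aeW => x x01; have [c _] := conv x x01; move: c; under eq_fun do rewrite cRe_sum.
have [|_ E2] := R2.
  by apply: aeW => x x01; have [_ c] := conv x x01; move: c; under eq_fun do rewrite cIm_sum.
by apply: complex_eq => /=; [exact: esym E1|exact: esym E2].
Qed.

Lemma L1_cut h : L1 U h -> L1 Rplus (cut h) /\ cintegral Rplus (cut h) = cintegral U h.
Proof.
move=> Lh; have UD : U `<=` Rplus by move=> x; rewrite UE RplusE => /andP[].
apply: L1_extend Lh => // [|x|x]; first exact: measurable_itv.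
  by rewrite UE /cut => ->.
by rewrite UE /cut => _ /negP/negbTE ->.
Qed.

Lemma cint_transfer h M : bvnorm_le h M -> cintegral U (transfer 1 h) = cintegral U h.
Proof.
move=> nh; have M0 := bvnorm_ge0 nh; have [Lc <-] := L1_cut (bvnorm_L1 nh).
have [Ll <-] := cint_flip q0 Lc; have [N nN] := transfer_bvnorm (nrm1 _) nh.
apply: (@cint_tail _ (2 * (M * q)) N) => // [x /andP[x0 x1]|x n /andP[x0 x1]].
  by apply: (lift_small q1); exact: ltW (lt_trans x1 q1).
apply: le_trans (lift_sum q1 n (nrm1 R) nh.1 M0 (ltW x0)).
by apply: ler_sum => k _; rewrite expr1n mul1r.
Qed.

Lemma cint_double_transfer h M : bvnorm_le h M -> cintegral U (double_transfer 1 1 h) = cintegral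
  U h.
Proof.
move=> nh; have [N nN] := transfer_bvnorm (nrm1 R) nh.
by rewrite /double_transfer (cint_transfer nN) (cint_transfer nh).
Qed.

Lemma ex_small_power (k C e : R) : 0 <= k < 1 -> 0 < e -> exists n, k ^+ n * C <= e.
Proof.
move=> /andP[k0 k1] e0.
have e1 : 0 < e / (`|C| + 1) by rewrite divr_gt0// ltr_wpDl.
have := cvg_expr (z := k); rewrite ger0_norm// => /(_ k1)/cvgrPdist_le/(_ _ e1)[n _ H].
exists n; have := H n (leqnn n); rewrite sub0r normrN ger0_norm ?exprn_ge0// => h.
apply: (@le_trans _ _ (k ^+ n * (`|C| + 1))).
  by rewrite ler_wpM2l ?exprn_ge0// (le_trans (ler_norm _))// lerDl.
by rewrite -ler_pdivlMr// ltr_wpDl.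
Qed.

(** The Lasota-Yorke inequality turns a bound V on the variation of lift f into
    k V + Dc with k < 1. Iterated from any finite bound it gives 1 + Dc / (1 -
    k), where Dc depends on f through its mass only. *)
Lemma resolvent_bound : exists2 K : R, 0 <= K & forall z e lam f u Nf Mu, nrm z = 1 ->
  nrm e = 1 ->
  0 <= lam <= 1 -> bvnorm_le f Nf -> bvnorm_le u Mu ->
  (forall x, 0 < x < 1 -> f x = u x + lam%:C * double_transfer z e f x) ->
  bvnorm_le f (K * (mass f + Mu + 1)).
Proof.
have [k [C [/andP[k0 k1] C0 LY]]] := double_transfer_LY.
have k10 : 0 < 1 - k by rewrite subr_gt0.
pose A := 1 + (C + 2) / (1 - k).
have A1 : 1 <= A by rewrite /A lerDl; apply: divr_ge0; [exact: addr_ge0|exact: ltW].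
exists (1 + C * (A + 1)); first by rewrite addr_ge0// mulr_ge0// addr_ge0//; exact: le_trans A1.
move=> z e lam f u Nf Mu z1 e1 /andP[l0 l1] nf nu fu.
have m0 := mass_ge0 f; have Mu0 := bvnorm_ge0 nu; have Nf0 := bvnorm_ge0 nf.
pose Dc := C * mass f + 2 * Mu.
have D0 : 0 <= Dc by rewrite addr_ge0 ?mulr_ge0.
have Dk0 : 0 <= Dc / (1 - k) by rewrite divr_ge0// ltW.
have l1' : nrm lam%:C <= 1 by rewrite nrm_real ger0_norm.
have step V : 0 <= V -> bv `]q, +oo[ (lift f) V -> bv `]q, +oo[ (lift f) (k * V + Dc).
  move=> V0 bV; have [_ b _] := LY z e f Nf V z1 e1 nf V0 bV.
  have := bvD (bvnorm_lift nu) (bvZ lam%:C b).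
  have fE t : lift f t = lift u t + lam%:C * lift (double_transfer z e f) t.
    by rewrite -liftZ -liftD (lift_ext q fu).
  move=> b'; apply: (bv_eq (f := fun t => lift u t + lam%:C * lift (double_transfer z e f) t)).
    by move=> t _; rewrite fE.
  apply: bv_le b'; have W0 : 0 <= k * V + C * mass f by rewrite addr_ge0 ?mulr_ge0.
  have : nrm lam%:C * (k * V + C * mass f) <= k * V + C * mass f by rewrite ler_piMl.
  by rewrite /Dc; lra.
have V0 n : 0 <= k ^+ n * (2 * Nf) + Dc / (1 - k) by rewrite addr_ge0// !mulr_ge0// exprn_ge0.
have iter n : bv `]q, +oo[ (lift f) (k ^+ n * (2 * Nf) + Dc / (1 - k)).
  elim: n => [|n IH]; first by rewrite mul1r; apply: bv_le (bvnorm_lift nf); rewrite lerDl.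
  have := step _ (V0 n) IH; apply: bv_le.
  have -> : k * (k ^+ n * (2 * Nf) + Dc / (1 - k)) + Dc = k ^+ n.+1 * (2 * Nf) + Dc / (1 - k).
    by rewrite exprS; field; rewrite gt_eqF.
  by [].
have [n kn] := @ex_small_power k (2 * Nf) 1 (introT andP (conj k0 k1)) ltr01.
have bV : bv `]q, +oo[ (lift f) (1 + Dc / (1 - k)) by apply: bv_le (iter n); rewrite lerD2r.
have V10 : 0 <= 1 + Dc / (1 - k) by rewrite addr_ge0.
have [nP _ _] := LY z e f Nf _ z1 e1 nf V10 bV.
pose S := mass f + Mu + 1.
have S1 : 1 <= S by rewrite /S; lra.
have mS : mass f <= S by rewrite /S; lra.
have MS : Mu <= S by rewrite /S; lra.
have S0 : 0 <= S by exact: le_trans S1.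
have DS : 1 + Dc / (1 - k) <= A * S.
  have : Dc / (1 - k) <= (C + 2) / (1 - k) * S.
    rewrite mulrAC ler_wpM2r ?invr_ge0 ?(ltW k10)//.
    have : 0 <= C * Mu by rewrite mulr_ge0.
    by rewrite /Dc /S; lra.
  have -> : A * S = S + (C + 2) / (1 - k) * S by rewrite /A; ring.
  lra.
have bnd : C * (1 + Dc / (1 - k) + mass f) <= C * ((A + 1) * S).
  by rewrite ler_wpM2l//; have -> : (A + 1) * S = A * S + S by [ring]; rewrite lerD.
have nf' : bvnorm_le (fun x => u x + lam%:C * double_transfer z e f x) (Mu + nrm lam%:C * (C * (1
  + Dc / (1 - k) + mass f))).
  by apply: bvnormD => //; exact: bvnormZ.
apply: bvnorm_eq (fun x x01 => esym (fu x x01)) _; apply: bvnorm_leW nf'.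
have -> : (1 + C * (A + 1)) * (mass f + Mu + 1) = S + C * ((A + 1) * S) by rewrite /S; ring.
rewrite lerD//.
apply: le_trans bnd; by rewrite ler_piMl// mulr_ge0// addr_ge0.
Qed.

Lemma iterates_bvnorm z e w Mw : nrm z = 1 -> nrm e = 1 -> bvnorm_le w Mw ->
  exists Ms, forall n, bvnorm_le (iter n (double_transfer z e) w) Ms.
Proof.
move=> z1 e1 nw; have [k [C [/andP[k0 k1] C0 LY]]] := double_transfer_LY.
have k10 : 0 < 1 - k by rewrite subr_gt0.
have M0 := bvnorm_ge0 nw; have m0 := mass_ge0 w.
have Cm0 : 0 <= C * mass w by rewrite mulr_ge0.
pose Vs := 2 * Mw + C * mass w / (1 - k).
have X0 : 0 <= C * mass w / (1 - k) by rewrite divr_ge0// ltW.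
have Vs0 : 0 <= Vs by rewrite addr_ge0// mulr_ge0.
pose Ms := Mw + C * (Vs + mass w).
have Y0 : 0 <= C * (Vs + mass w) by rewrite mulr_ge0// addr_ge0.
exists Ms => n.
have [//] : [/\ bvnorm_le (iter n (double_transfer z e) w) Ms, bv `]q,
  +oo[ (lift (iter n (double_transfer z e) w)) Vs &
  mass (iter n (double_transfer z e) w) <= mass w].
elim: n => [|n [n1 b1 m1]].
  split=> //=; first by apply: bvnorm_leW nw; rewrite lerDl.
  by apply: bv_le (bvnorm_lift nw); rewrite lerDl.
have [n2 b2 m2] := LY z e _ _ _ z1 e1 n1 Vs0 b1.
rewrite iterS; split; last exact: le_trans m2 m1.
  apply: bvnorm_leW n2; rewrite -[leLHS]add0r lerD// ler_wpM2l// lerD2l//.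
apply: bv_le b2; apply: (@le_trans _ _ (k * Vs + C * mass w)).
  by rewrite lerD2l ler_wpM2l.
have : k * (2 * Mw) <= 2 * Mw by rewrite ler_piMl ?mulr_ge0// ltW.
have -> : k * Vs + C * mass w = k * (2 * Mw) + C * mass w / (1 - k).
  by rewrite /Vs; field; rewrite gt_eqF.
by rewrite /Vs; lra.
Qed.

(** Write P for the double transfer. A truncated Neumann series, the sum of
    lam^j P^j w over j < n, solves the equation up to lam^n P^n w, which is
    small because the iterates of w are bounded. If P preserves integrals and w
    has integral 0, so does the series. *)
Lemma resolvent_approximation z e w Mw : nrm z = 1 -> nrm e = 1 -> bvnorm_le w Mw -> forall eps :
  R, 0 < eps ->
  exists (lam : R) f v M, [/\ 0 <= lam <= 1, 1 - lam <= eps, bvnorm_le f M,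
    bvnorm_le (fun x => v x + -1 * w x) eps &
    (forall x, 0 < x < 1 -> f x = v x + lam%:C * double_transfer z e f x) /\
    (z = 1 -> e = 1 -> cintegral U w = 0 -> cintegral U f = 0)].
Proof.
move=> z1 e1 nw eps eps0.
have [Ms nM] := iterates_bvnorm z1 e1 nw.
pose lam := 1 - Num.min eps 2^-1.
have ml : 0 < Num.min eps 2^-1 by rewrite lt_min eps0 invr_gt0 ltr0n.
have mu1 : Num.min eps 2^-1 <= 2^-1 by rewrite ge_min lexx orbT.
have l0 : 0 <= lam by rewrite /lam; lra.
have l1 : lam < 1 by rewrite /lam; lra.
have [n ln] := @ex_small_power lam Ms eps (introT andP (conj l0 l1)) eps0.
pose p n := iter n (double_transfer z e) w.
pose a n := iter n (fun f x => w x + lam%:C * double_transfer z e f x) (fun=> 0).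
have na m : exists N, bvnorm_le (a m) N.
  elim: m => [|m [N nN]]; first by exists 0; exact: bvnorm0.
  have [N' nN'] := double_transfer_bvnorm z1 e1 nN.
  by eexists; apply: bvnormD nw (bvnormZ lam%:C nN').
have a0 x : 0 < x < 1 -> double_transfer z e (a 0%N) x = 0.
  move=> /andP[/ltW x0 _].
  have := @double_transfer_linear z e (fun=> 0) (fun=> 0) (-1) 0 0 x z1 e1 (bvnorm0 R) (bvnorm0
    R) x0.
  rewrite (_ : (fun y => _ + _) = fun=> 0); last by apply/funext => y; rewrite mulr0 addr0.
  by rewrite /a /= mulN1r subrr.
have aE m : forall x, 0 < x < 1 ->
    a m x = w x + (- lam ^+ m)%:C * p m x + lam%:C * double_transfer z e (a m) x.
  elim: m => [|m IH] x x01.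
    by rewrite a0// mulr0 addr0 /= expr0 rmorphN1 mulN1r subrr.
  have [N nN] := na m; have [N1 nN1] := na m.+1.
  have x0 : 0 <= x by case/andP: x01 => /ltW.
  have aS y : a m.+1 y = w y + lam%:C * double_transfer z e (a m) y by [].
  have := @double_transfer_linear z e (a m.+1) (p m) (- lam ^+ m)%:C _ _ x z1 e1 nN1 (nM m) x0.
  rewrite -(@double_transfer_ext z e (a m)); last first.
    by move=> y y01; rewrite [LHS]IH// aS; ring.
  rewrite -[double_transfer z e (p m)]/(p m.+1) => Ec.
  have -> : double_transfer z e (a m.+1) x = double_transfer z e (a m) x - (- lam ^+ m)%:C * p
    m.+1 x.
    by rewrite Ec addrK.
  rewrite aS exprS !rmorphN/= rmorphM/=.
  by move: (double_transfer z e (a m) x) (p m.+1 x) (lam ^+ m)%:C lam%:C (w x) => A B c d w1;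
    clear; ring.
have [N nN] := na n.
exists lam, (a n), (fun x => w x + (- lam ^+ n)%:C * p n x), N; split=> //.
- by rewrite l0 ltW.
- by rewrite /lam opprB addrC subrK ge_min lexx.
- apply: (@bvnorm_eq _ (fun x => (- lam ^+ n)%:C * p n x)); first by move=> x _; ring.
  apply: bvnorm_leW (bvnormZ _ (nM n)); by rewrite nrm_real normrN ger0_norm ?exprn_ge0.
split; first exact: aE.
move=> zE eE w0; elim: (n) => [|m IH].
  by rewrite /a/=; apply: complex_eq => /=; rewrite Rint0.
have [N' nN'] := na m; have [N2 nN2] := double_transfer_bvnorm z1 e1 nN'.
rewrite /a iterS -/(a m) cintD//; [|exact: bvnorm_L1 nw|exact: bvnorm_L1 (bvnormZ _ nN2)].
rewrite cintZ//; last exact: bvnorm_L1 nN2.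
by rewrite w0 add0r zE eE (cint_double_transfer nN') IH mulr0.
Qed.

Lemma massZ (c : R[i]) f M : bvnorm_le f M -> mass (fun x => c * f x) = nrm c * mass f.
Proof.
move=> nf; rewrite /mass -RintZ//; last exact: bvnorm_integrable nf.
by apply: Rint_eq => x _; rewrite nrmM.
Qed.

Lemma mass_triangle f g M N : bvnorm_le f M -> bvnorm_le g N ->
  mass f <= mass g + mass (fun x => f x + -1 * g x).
Proof.
move=> nf ng; have nd := bvnormD nf (bvnormZ (-1) ng).
rewrite /mass -RintD//; [|exact: bvnorm_integrable ng|exact: bvnorm_integrable nd].
apply: Rint_le; first exact: bvnorm_integrable nf.
  by apply: integrableDR => //; [exact: bvnorm_integrable ng|exact: bvnorm_integrable nd].
move=> x _; have := nrm_tri (f x) (g x) 0; rewrite !subr0 mulN1r; lra.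
Qed.

Lemma nrm_cint_le f M : bvnorm_le f M -> nrm (cintegral U f) <= 2 * mass f.
Proof.
move=> nf; have [a b] := bvnorm_L1 nf; have c := bvnorm_integrable nf.
apply: (le_trans (nrm_le_ReIm _)); rewrite /= mulr2n mulrDl mul1r.
have H (u : R -> R) : (forall x, `|u x| <= nrm (f x)) -> mu.-integrable U (EFin \o u) ->
    `|Rintegral mu U u| <= mass f.
  move=> uf iu; apply: le_trans (@le_normr_Rintegral _ _ _ mu U u mU iu) _.
  apply: Rint_le => //; exact: integrable_norm iu.
apply: lerD; apply: H => // x; [exact: abs_Re_le|exact: abs_Im_le].
Qed.

(** The functions converge along an ultrafilter, and the transfer operators
    commute with this limit. *)
Lemma limit_fixed z e (lam : nat -> R) (u v : nat -> R -> R[i]) w B : nrm z = 1 -> nrm e = 1 ->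
  (forall n, bvnorm_le (u n) B) -> (forall n, 0 <= lam n <= 1) ->
  (forall n, 1 - lam n <= n.+1%:R^-1) ->
  (forall n x, 0 < x < 1 -> nrm (v n x - w x) <= n.+1%:R^-1) ->
  (forall n x, 0 < x < 1 -> u n x = v n x + (lam n)%:C * double_transfer z e (u n) x) ->
  exists g, [/\ bvnorm_le g B, forall x, 0 < x < 1 -> g x = w x + double_transfer z e g x &
    forall eps, 0 < eps -> exists n, mass (fun x => g x + -1 * u n x) <= eps].
Proof.
move=> z1 e1 nu l01 l1 vw uE; have B0 := bvnorm_ge0 (nu 0%N).
have [G [UG oG]] := ultraFilterLemma (@eventually_filter).
have PG : ProperFilter G by exact: ultra_proper.
have FG : Filter G by typeclasses eauto.
have [g ng ug] := @bvnorm_ultra _ G UG _ _ nu.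
exists g; split=> //; last first.
  move=> eps eps0.
  have nd n : bvnorm_le (fun x => g x + -1 * u n x) (B + nrm (-1) * B).
    by apply: bvnormD => //; exact: bvnormZ.
  have pd : pointwise_cvg G (fun n x => g x + -1 * u n x) (fun=> 0).
    move=> x x01 d d0; have := ug x x01 d d0; apply: filterS => n.
    by rewrite subr0 mulN1r nrmBC.
  by have [n Hn] := filter_ex (@mass_pointwise_cvg _ G FG _ _ nd pd _ eps0); exists n.
have B1 : 0 <= 2 * (B * q) by rewrite !mulr_ge0// ltW.
have s1 h : (forall x, 0 < x < 1 -> nrm (h x) <= B) -> forall x, 0 < x < 1 ->
    nrm (transfer e h x) <= 2 * (B * q).
  by move=> hB x /andP[x0 _]; apply: transfer_sup => //; exact: ltW.
have pc := @transfer_pointwise_cvg _ _ q1 G FG _ _ _ _ z1 B1 (fun n => s1 _ (nu n).1) (s1 _ ng.1)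
  (@transfer_pointwise_cvg _ _ q1 G FG _ _ _ _ e1 B0 (fun n => (nu n).1) ng.1 ug).
pose B2 := 2 * (2 * (B * q) * q).
have B20 : 0 <= B2 by rewrite !mulr_ge0// ltW.
have s2 h : (forall x, 0 < x < 1 -> nrm (h x) <= B) -> forall x, 0 < x < 1 ->
    nrm (double_transfer z e h x) <= B2.
  by move=> hB x /andP[x0 _]; apply: transfer_sup => //; [exact: s1|exact: ltW].
move=> x x01; apply/subr0_eq/nrm_eq0/eqP; rewrite eq_le nrm_ge0 andbT.
apply: (near_le (G := G)) => eps eps0; rewrite add0r.
have e40 : 0 < eps / 4 by rewrite divr_gt0.
have A1 := ug x x01 _ e40; have A2 := pc x x01 _ e40.
have [N [N1 CN]] := ex_small_quotient (ltW ltr01) e40.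
have [N' [N1' CN']] := ex_small_quotient B20 e40.
have A3 : G [set n | (maxn N N' <= n)%N] by apply: oG; exists (maxn N N').
have A := @filterI _ G FG _ _ (@filterI _ G FG _ _ A1 A2) A3.
move: A; apply: filterS => n [[h1 h2] h3].
have {}h1 : nrm (u n x - g x) <= eps / 4 := h1.
have {}h2 : nrm (double_transfer z e (u n) x - double_transfer z e g x) <= eps / 4 := h2.
have {}h3 : (maxn N N' <= n)%N := h3.
have n1 : n.+1%:R^-1 <= N%:R^-1 :> R.
  by rewrite lef_pV2 ?posrE ?ltr0n ?(ltnW N1)// ler_nat ltnW// ltnS (leq_trans (leq_maxl _ _) h3).
have n2 : n.+1%:R^-1 <= N'%:R^-1 :> R.
  by rewrite lef_pV2 ?posrE ?ltr0n ?(ltnW N1')// ler_nat ltnW// ltnS (leq_trans (leq_maxr _ _)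
    h3).
change (nrm (g x - (w x + double_transfer z e g x)) <= eps).
have -> : g x - (w x + double_transfer z e g x) = - (u n x - g x) + ((v n x - w x) +
   (- ((1 - lam n)%:C * double_transfer z e (u n) x) + (double_transfer z e (u n) x -
     double_transfer z e g x))).
  rewrite {1}(uE n x x01) rmorphB rmorph1 /=.
  by move: (double_transfer z e (u n) x) (double_transfer z e g x) (g x) (v n x) (w x) (lam n)%:C
    => c1 c2 c3 c4 c5 c6; clear; ring.
have t1 : nrm ((1 - lam n)%:C * double_transfer z e (u n) x) <= eps / 4.
  rewrite nrmM nrm_real; have /andP[? ?] := l01 n; rewrite ger0_norm ?subr_ge0//.
  apply: (le_trans _ CN'); rewrite mulrC ler_pM ?nrm_ge0 ?subr_ge0//.
    exact: (s2 _ (nu n).1).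
  exact: le_trans (l1 n) n2.
have t2 : nrm (v n x - w x) <= eps / 4.
  by apply: (le_trans (vw n x x01)); apply: le_trans n1 _; rewrite div1r in CN.
apply: (le_trans (nrmD _ _)); rewrite nrmN.
have := nrmD (v n x - w x) (- ((1 - lam n)%:C * double_transfer z e (u n) x) + (double_transfer z
  e (u n) x - double_transfer z e g x)).
have := nrmD (- ((1 - lam n)%:C * double_transfer z e (u n) x)) (double_transfer z e (u n) x -
  double_transfer z e g x).
rewrite nrmN; lra.
Qed.

(** Let lam tend to 1 in the approximate equations f_k = v_k + lam_k P f_k,
    where P is the double transfer. If infinitely many f_k have mass below a
    common bound, [resolvent_bound] bounds their norms and a limit of them
    solves f = w + P f. Otherwise the functions f_k / mass f_k solve the
    equation with right-hand sides tending to 0, and a limit of them is a fixed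
    point of mass 1. *)
Theorem fredholm_alternative z e w Mw : nrm z = 1 -> nrm e = 1 -> bvnorm_le w Mw ->
  (exists f M, bvnorm_le f M /\ forall x, 0 < x < 1 -> f x = w x + double_transfer z e f x) \/
  (exists g M, [/\ bvnorm_le g M, mass g = 1, forall x, 0 < x < 1 ->
    g x = double_transfer z e g x &
    z = 1 -> e = 1 -> cintegral U w = 0 -> cintegral U g = 0]).
Proof.
move=> z1 e1 nw; have Mw0 := bvnorm_ge0 nw; have [K K0 HK] := resolvent_bound.
have k0 k : 0 < (k.+1%:R : R)^-1 by rewrite invr_gt0.
(* The components of t k are lam_k, f_k, v_k and a bound for f_k. *)
have /choice[t tP] : forall k : nat, exists t : R * (R -> R[i]) * (R -> R[i]) * R,
  [/\ 0 <= t.1.1.1 <= 1, 1 - t.1.1.1 <= k.+1%:R^-1, bvnorm_le t.1.1.2 t.2,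
    bvnorm_le (fun x => t.1.2 x + -1 * w x) k.+1%:R^-1 &
    (forall x, 0 < x < 1 -> t.1.1.2 x = t.1.2 x + t.1.1.1%:C * double_transfer z e t.1.1.2 x) /\
    (z = 1 -> e = 1 -> cintegral U w = 0 -> cintegral U t.1.1.2 = 0)].
  move=> k; have [lam [f [v [M H]]]] := resolvent_approximation z1 e1 nw (k0 k).
  by exists (lam, f, v, M).
pose lam k := (t k).1.1.1; pose f k := (t k).1.1.2; pose v k := (t k).1.2.
have k1 k : (k.+1%:R : R)^-1 <= 1 by rewrite invf_le1// ler1n.
have l01 k : 0 <= lam k <= 1 by have [] := tP k.
have l1 k : 1 - lam k <= k.+1%:R^-1 by have [] := tP k.
have nf k : bvnorm_le (f k) (t k).2 by have [] := tP k.
have vw k x : 0 < x < 1 -> nrm (v k x - w x) <= k.+1%:R^-1.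
  by move=> x01; have [_ _ _ [H _] _] := tP k; have := H x x01; rewrite mulN1r.
have nv k : bvnorm_le (v k) (Mw + 1).
  have [_ _ _ H _] := tP k; have := bvnormD nw H.
  move=> /(bvnorm_leW (lerD (lexx Mw) (k1 k))); apply: bvnorm_eq => x _; rewrite -/(v k); ring.
have fE k x : 0 < x < 1 -> f k x = v k x + (lam k)%:C * double_transfer z e (f k) x.
  by have [_ _ _ _ [H _]] := tP k; exact: H.
have f0 k : z = 1 -> e = 1 -> cintegral U w = 0 -> cintegral U (f k) = 0.
  by have [_ _ _ _ [_ H]] := tP k.
have inv_le (n m : nat) : (n <= m)%N -> (m.+1%:R : R)^-1 <= n.+1%:R^-1.
  by move=> nm; rewrite lef_pV2 ?posrE// ler_nat ltnS.
have [[B bdd]|unb] := pselect (exists B, forall N, exists2 k, (N <= k)%N & mass (f k) <= B).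
  left; have /choice[s sP] : forall N, exists k, (N <= k)%N /\ mass (f k) <= B.
    by move=> N; have [k ? ?] := bdd N; exists k.
  have nu n : bvnorm_le (f (s n)) (K * (B + (Mw + 1) + 1)).
    apply: bvnorm_leW (HK z e _ _ _ _ _ z1 e1 (l01 _) (nf _) (nv _) (fE _)).
    by rewrite ler_wpM2l// !lerD2r (sP n).2.
  have [g [ng gE _]] := @limit_fixed z e (lam \o s) (fun n => f (s n)) (fun n => v (s n)) w _ z1
    e1
    nu (fun n => l01 _) (fun n => le_trans (l1 _) (inv_le _ _ (sP n).1))
    (fun n x x01 => le_trans (vw _ x x01) (inv_le _ _ (sP n).1)) (fun n x x01 => fE _ x x01).
  by exists g; eexists; split; [exact: ng|].
right; have /choice[s sP] : forall N : nat, exists k, (N <= k)%N /\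
  N.+1%:R * (Mw + 1) < mass (f k).
  move=> N; apply: contrapT => nk; apply: unb; exists (N.+1%:R * (Mw + 1)) => N'.
  exists (maxn N N'); first exact: leq_maxr.
  rewrite leNgt; apply/negP => h; apply: nk; exists (maxn N N'); split=> //; exact: leq_maxl.
pose m n := mass (f (s n)).
have m1 n : 1 <= m n.
  apply: ltW; apply: le_lt_trans (sP n).2; rewrite -[leLHS]mul1r ler_pM//; first by rewrite ler1n.
  by rewrite lerDr.
have m0 n : 0 < m n by exact: lt_le_trans (m1 n).
have nmi n : nrm ((m n)^-1%:C) = (m n)^-1 by rewrite nrm_real ger0_norm// invr_ge0 ltW.
have mi1 n : (m n)^-1 <= 1 by rewrite invf_le1.
pose u n x := (m n)^-1%:C * f (s n) x; pose v' n x := (m n)^-1%:C * v (s n) x.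
have nu0 n : bvnorm_le (u n) ((m n)^-1 * (t (s n)).2) by rewrite -nmi; exact: bvnormZ.
have mu1 n : mass (u n) = 1 by rewrite (massZ _ (nf _)) nmi mulVf// gt_eqF.
have Mv n : (m n)^-1 * (Mw + 1) <= n.+1%:R^-1.
  by rewrite mulrC ler_pdivrMr// mulrC ler_pdivlMr// mulrC ltW// (sP n).2.
have nv' n : bvnorm_le (v' n) 1.
  apply: bvnorm_leW (bvnormZ _ (nv (s n))); rewrite nmi; exact: le_trans (Mv n) (k1 n).
have uE n x : 0 < x < 1 -> u n x = v' n x + (lam (s n))%:C * double_transfer z e (u n) x.
  move=> x01; have x0 : 0 <= x by case/andP: x01 => /ltW.
  have := @double_transfer_linear z e (fun=> 0) (f (s n)) (m n)^-1%:C 0 _ x z1 e1 (bvnorm0 R) (nf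
    _) x0.
  have := @double_transfer_linear z e (fun=> 0) (fun=> 0) (-1) 0 0 x z1 e1 (bvnorm0 R) (bvnorm0
    R) x0.
  rewrite (_ : (fun y => _ + -1 * _) = fun=> 0); last by apply/funext => y; rewrite mulr0 addr0.
  rewrite mulN1r subrr => ->.
  rewrite (_ : (fun y => _ + _) = u n); last by apply/funext => y; rewrite add0r.
  by rewrite add0r => ->; rewrite /u /v' {1}fE//; ring.
have nu n : bvnorm_le (u n) (K * (1 + 1 + 1)).
  by have := HK z e _ _ _ _ _ z1 e1 (l01 _) (nu0 n) (nv' n) (uE n); rewrite mu1.
have [g [ng gE gm]] := @limit_fixed z e (lam \o s) u v' (fun=> 0) _ z1 e1 nu (fun n => l01 _)
  (fun n => le_trans (l1 _) (inv_le _ _ (sP n).1))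
  (fun n x x01 => (eq_ind_r (fun c => nrm c <= _) (le_trans ((bvnormZ _ (nv (s n))).1 x x01)
     (eq_ind_r (fun c => c * _ <= _) (Mv n) (nmi n))) (subr0 _))) uE.
have gd n : bvnorm_le (fun x => g x + -1 * u n x) (K * (1 + 1 + 1) + nrm (-1) * (K * (1 + 1 +
  1))).
  by apply: bvnormD => //; exact: bvnormZ.
have dg n : mass (fun x => u n x + -1 * g x) = mass (fun x => g x + -1 * u n x).
  by apply: Rint_eq => x _; rewrite !mulN1r nrmBC.
exists g; eexists; split; first exact: ng.
- apply/eqP; rewrite eq_le; apply/andP; split; apply/ler_addgt0Pr => eps eps0;
    have [n Hn] := gm _ eps0.
    by have := mass_triangle ng (nu n); rewrite mu1; lra.
  by have := mass_triangle (nu n) ng; rewrite mu1 dg; lra.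
- by move=> x x01; rewrite {1}gE// add0r.
move=> zE eE w0; apply/nrm_eq0/eqP; rewrite eq_le nrm_ge0 andbT; apply/ler_addgt0Pr => eps eps0.
have e20 : 0 < eps / 2 by rewrite divr_gt0.
have [n Hn] := gm _ e20.
have u0 : cintegral U (u n) = 0.
  by rewrite cintZ// ?f0 ?mulr0//; exact: bvnorm_L1 (nf _).
have -> : cintegral U g = cintegral U (fun x => g x + -1 * u n x).
  rewrite cintD//; [|exact: bvnorm_L1 ng|exact: bvnorm_L1 (bvnormZ _ (nu n))].
  by rewrite cintZ ?u0 ?mulr0 ?addr0//; exact: bvnorm_L1 (nu n).
apply: (le_trans (nrm_cint_le (gd n))); rewrite add0r; lra.
Qed.

End fredholm.

(** * Fixed points of the double transfer *)

Section kernel.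
Context (R : realType) (q : R) (q1 : 1 < q).
Local Notation mu := (@lebesgue_measure R).
Local Notation U := (`]0%R, 1%R[%classic : set R).
Local Notation D := (`]0%R, +oo[%classic : set R).
Local Notation Re := complex.Re.
Local Notation Im := complex.Im.
Local Notation lift := (lift q).
Local Notation transfer := (transfer q).
Implicit Types (f g h : R -> R[i]) (z e : R[i]).

Let q0 : 0 < q. Proof. exact: lt_trans q1. Qed.
Let mU : measurable U. Proof. exact: measurable_itv. Qed.

Lemma mass_ae f g M N : bvnorm_le f M -> bvnorm_le g N ->
  {ae mu, forall x, 0 < x < 1 -> nrm (f x) = nrm (g x)} -> mass f = mass g.
Proof.
move=> nf ng fg; rewrite /mass /Rintegral; congr fine; apply: ae_eq_integral => //.
- exact: measurable_int (bvnorm_integrable nf).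
- exact: measurable_int (bvnorm_integrable ng).
- by apply: ae_imp fg => x h; rewrite UE => /h /= ->.
Qed.

(** Integrating |f x| <= sum_k |lift K (x + k)| over (0,1) gives mass f <= mass
    K. If mass K <= mass f as well, the pointwise inequality is an equality
    almost everywhere. *)
Lemma extremal_image z f K M N : nrm z = 1 -> bvnorm_le f N -> bvnorm_le K M ->
  {ae mu, forall x, 0 < x < 1 -> f x = - transfer z K x} -> mass K <= mass f ->
  {ae mu, forall x, 0 < x < 1 ->
    forall n, \sum_(k < n) nrm (z ^+ k.+1 * lift K (x + k.+1%:R)) <= nrm (f x)}.
Proof.
move=> z1 nf nK fK Kf; have M0 := bvnorm_ge0 nK.
have ml := measurable_nrm_lift q1 nK.
have u0 t : 0 < t -> (0 <= (nrm (lift K t))%:E)%E by rewrite lee_fin nrm_ge0.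
have mlD : measurable_fun D (fun t => (nrm (lift K t))%:E).
  by apply/measurable_EFinP; exact: measurable_funTS.
pose E x := (\sum_(j <oo) (nrm (lift K (x + j%:R)))%:E)%E.
have P0 x k : (0 <= (nrm (lift K (x + k%:R)))%:E)%E by rewrite lee_fin nrm_ge0.
have termE x k : nrm (z ^+ k.+1 * lift K (x + k.+1%:R)) = nrm (lift K (x + k.+1%:R)).
  by rewrite nrmM nrmX z1 expr1n mul1r.
have Efin x : 0 < x < 1 -> E x \is a fin_num.
  move=> /andP[x0 x1]; rewrite ge0_fin_numE ?nneseries_ge0//.
  apply: (@le_lt_trans _ _ (2 * (M * q))%:E); last by rewrite ltry.
  apply: lime_le; first exact: is_cvg_nneseries.
  apply: nearW => n; rewrite sumEFin lee_fin.
  apply: (@le_trans _ _ (\sum_(0 <= k < n.+1) nrm (lift K (x + k%:R)))).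
    by rewrite big_nat_recr//= lerDl nrm_ge0.
  rewrite big_nat_recl//= addr0 (lift_small q1) ?(ltW (lt_trans x1 q1))// nrm0 add0r big_mkord.
  apply: le_trans (lift_sum q1 n z1 nK.1 M0 (ltW x0)).
  by apply: ler_sum => k _; rewrite termE.
pose s x := fine (E x).
have ps x n : 0 < x < 1 -> \sum_(k < n) nrm (z ^+ k.+1 * lift K (x + k.+1%:R)) <= s x.
  move=> x01; rewrite -lee_fin fineK ?Efin//.
  apply: le_trans (nneseries_lim_ge n.+1 (fun k _ _ => P0 x k)).
  rewrite -sumEFin big_nat_recl//= -[leLHS]add0e; apply: leeD => //.
  by rewrite big_mkord; apply: lee_sum => k _; rewrite lee_fin termE.
have mE : measurable_fun U E.
  apply: ge0_emeasurable_sum => [k x _ _|k _]; first by rewrite lee_fin nrm_ge0.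
  apply/measurable_EFinP; apply: measurable_funTS; apply: (measurableT_comp ml).
  exact: measurable_funD.
have ms : measurable_fun U s by exact: measurableT_comp.
have sE x : U x -> (s x)%:E = E x by rewrite UE => x01; rewrite fineK ?Efin.
have s0 x : 0 <= s x by apply: fine_ge0; exact: nneseries_ge0.
have intE : (\int[mu]_(x in U) (s x)%:E = (mass K)%:E)%E.
  rewrite -(integral_nrm_lift q1 nK) (ge0_integral_period mlD u0).
  by apply: eq_integral => x /set_mem Ux; rewrite sE.
have is_ : mu.-integrable U (EFin \o s).
  apply/integrableP; split; first exact/measurable_EFinP.
  apply: (@le_lt_trans _ _ (mass K)%:E); last by rewrite ltry.
  rewrite -intE le_eqVlt; apply/orP; left; apply/eqP.
  by apply: eq_integral => x _ /=; rewrite ger0_norm.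
have RsE : Rintegral mu U s = mass K by rewrite /Rintegral intE.
have iff := bvnorm_integrable nf.
have fs : {ae mu, forall x, 0 < x < 1 -> nrm (f x) <= s x}.
  apply: ae_imp fK => x h x01; rewrite h// nrmN; apply: nrm_csum_le => n; exact: ps.
have id : mu.-integrable U (EFin \o (fun x => s x - nrm (f x))) by exact: integrableBR.
have Id : Rintegral mu U (fun x => `|s x - nrm (f x)|) = mass K - mass f.
  rewrite -RsE -RintB//; rewrite /Rintegral; congr fine; apply: ae_eq_integral => //.
  - exact: measurable_int (integrable_norm id).
  - exact: measurable_int id.
  - by apply: ae_imp fs => x h; rewrite UE => /h; rewrite -subr_ge0 => /ger0_norm /= ->.
have I0 : (\int[mu]_(x in U) `|(s x - nrm (f x))%:E| = 0)%E.
  have fin : (\int[mu]_(x in U) (`|s x - nrm (f x)|)%:E)%E \is a fin_num.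
    exact: integrable_fin_num (integrable_norm id).
  transitivity (\int[mu]_(x in U) (`|s x - nrm (f x)|)%:E)%E; first by [].
  rewrite -(fineK fin); congr EFin.
  have h : 0 <= Rintegral mu U (fun x => `|s x - nrm (f x)|) by apply: Rintegral_ge0 => x _.
  by apply/eqP; rewrite eq_le [X in _ && X]h andbT -/(Rintegral mu U _) Id subr_le0.
have := (ae_eq_integral_abs mu mU (measurable_int _ id)).1 I0.
apply: ae_imp => x h x01 n; apply: le_trans (ps x n x01) _.
have := h; rewrite UE => /(_ x01) /= [/eqP]; rewrite subr_eq0 => /eqP ->; exact: lexx.
Qed.

Lemma ae_point (P : R -> Prop) (a b : R) : a < b -> {ae mu, forall x, P x} ->
  exists x, a < x < b /\ P x.
Proof.
move=> ab aP; apply: contrapT => no.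
have mab : measurable (`]a, b[ : set (measurableTypeR R)) by exact: measurable_itv.
have [B [mB B0 PB]] := aP.
have : (mu `]a, b[ <= mu B)%E.
  apply: le_measure; rewrite ?inE// => y; rewrite /= in_itv/= => yab; apply: PB => Py.
  by apply: no; exists y.
by rewrite B0 lebesgue_measure_itv/= lte_fin ab -EFinB lee_fin subr_le0 leNgt ab.
Qed.

(** In the equality case |S| = |T| + |S - T| the numbers S and T have the same
    phase. The product form avoids dividing by norms that may vanish. *)
Lemma triangle_eq (S T : R[i]) : nrm (S - T) <= nrm S - nrm T ->
  T * (nrm S)%:C = S * (nrm T)%:C.
Proof.
move=> H; have E : nrm (S - T) = nrm S - nrm T.
  by apply/eqP; rewrite eq_le H/=; have := nrm_tri S T 0; rewrite !subr0; lra.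
have sq (w : R[i]) : nrm w ^+ 2 = Re w ^+ 2 + Im w ^+ 2.
  by rewrite nrmE sqr_sqrtr// addr_ge0 ?sqr_ge0.
have := sq S; have := sq T; have := sq (S - T); rewrite E.
move: (nrm S) (nrm T) => r t; case: S {H E} => a b; case: T => c d /= h1 h2 h3.
have K : (c * r - a * t) ^+ 2 + (d * r - b * t) ^+ 2 = 0.
  have -> : (c * r - a * t) ^+ 2 + (d * r - b * t) ^+ 2 =
    (c ^+ 2 + d ^+ 2) * r ^+ 2 + (a ^+ 2 + b ^+ 2) * t ^+ 2 - 2 * r * t * (a * c + b * d) by ring.
  have h4 : a * c + b * d = r * t.
    have : 2 * (a * c + b * d) = 2 * (r * t).
      have -> : 2 * (a * c + b * d) = (a ^+ 2 + b ^+ 2) + (c ^+ 2 + d ^+ 2) - ((a - c) ^+ 2 + (b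
        - d) ^+ 2).
        by ring.
      by rewrite -h1 -h2 -h3; ring.
    by lra.
  by rewrite -h2 -h3 h4; ring.
move/eqP: K; rewrite paddr_eq0 ?sqr_ge0// !sqrf_eq0 !subr_eq0 => /andP[/eqP e1 /eqP e2].
by apply: complex_eq; rewrite [_ * r%:C]mulrC [_ * t%:C]mulrC ?Re_realM ?Im_realM/=;
  rewrite mulrC ?e1 ?e2 mulrC.
Qed.

Lemma csum_phase (T : nat -> R[i]) : (forall n, \sum_(k < n) nrm (T k) <= nrm (csum T)) ->
  forall k, T k * (nrm (csum T))%:C = csum T * (nrm (T k))%:C.
Proof.
move=> H k; apply: triangle_eq.
have cv := csum_cvg H.
have cv' : ccvg (fun n => psum T (n + k.+1) + - T k) (csum T - T k).
  apply: ccvgD; last by split; exact: cvg_cst.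
  have [a b] := cv; split.
    by rewrite (cvg_shiftn k.+1 (fun n => Re (psum T n))).
  by rewrite (cvg_shiftn k.+1 (fun n => Im (psum T n))).
apply: (ccvg_le cv') => n.
have kn : (k < n + k.+1)%N by rewrite ltn_addl.
rewrite /psum (bigD1 (Ordinal kn))//= addrAC subrr add0r.
apply: (le_trans (nrm_sum _ _ _)); rewrite lerBrDr.
by have := H (n + k.+1)%N; rewrite (bigD1 (Ordinal kn))//= addrC.
Qed.

(** What the identity |f x| = sum_k |lift K (x + k)| says about u = |f| and v =
    |K| once all terms but one are dropped. *)
Definition dominates (u v : R -> R) : Prop := {ae mu, forall x, 0 < x < 1 -> forall k : nat,
  q < x + k.+1%:R -> q * (x + k.+1%:R) ^- 2 * v (q / (x + k.+1%:R)) <= u x}.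

Definition lower_bounded (u : R -> R) (s t : R) : Prop := exists2 c, 0 < c &
  {ae mu, forall x, s < x < t -> c <= u x}.

Lemma ae_pull (P : R -> Prop) : {ae mu, forall x, 0 < x -> P x} ->
  {ae mu, forall x, 0 < x -> forall k : nat, P (q / (x + k.+1%:R))}.
Proof.
move=> h; apply: ae_imp (negligible_shift (negligible_recip q0 h)) => x H x0 k.
exact: H.
Qed.

Lemma lower_bounded_step u v s t (k : nat) : dominates u v -> 0 <= s -> t <= 1 ->
  lower_bounded v s t ->
  forall a b, 0 <= a -> b <= 1 -> (forall x, a < x < b -> s < q / (x + k.+1%:R) < t) ->
  lower_bounded u a b.
Proof.
move=> duv s0 t1 [c c0 cv] a b a0 b1 ab.
have d0 : 0 < q * (1 + k.+1%:R) ^- 2 by rewrite mulr_gt0// invr_gt0 exprn_gt0// addr_gt0.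
exists (q * (1 + k.+1%:R) ^- 2 * c); first by rewrite mulr_gt0.
have cv' : {ae mu, forall x, 0 < x -> s < x < t -> c <= v x} by apply: ae_imp cv => x h _.
apply: ae_imp2 duv (ae_pull cv') => x h1 h2 xab.
have /andP[ax xb] := xab; have x0 : 0 < x by exact: le_lt_trans ax.
have x1 : x < 1 by exact: lt_le_trans xb b1.
have y0 : 0 < x + k.+1%:R by rewrite ltr_wpDr.
have st := ab x xab; have /andP[_ qt] := st.
have qy : q < x + k.+1%:R by rewrite -[ltRHS]mul1r -ltr_pdivrMr// (lt_le_trans qt).
apply: le_trans (h1 (introT andP (conj x0 x1)) k qy).
apply: ler_pM; [exact: ltW|exact: ltW| |exact: h2].
by rewrite ler_pM2l// lef_pV2 ?posrE ?exprn_gt0 ?addr_gt0// lerXn2r ?nnegrE ?(ltW y0) ?addr_ge0//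
  lerD2r ltW.
Qed.

(** For x in (0,1) and N large the points q / (x + N + 1) all lie in (0,t), so
    that a single term of the sum bounds u below. *)
Lemma lower_bounded_full u v t : dominates u v -> 0 < t -> t <= 1 -> lower_bounded v 0 t ->
  lower_bounded u 0 1.
Proof.
move=> duv t0 t1 lv; have [N [N1 qN]] := ex_small_quotient (ltW q0) t0.
apply: (lower_bounded_step (k := N) duv (lexx 0) t1 lv) => // x /andP[x0 x1].
have y0 : 0 < x + N.+1%:R by rewrite ltr_wpDr.
have N0 : 0 < N%:R :> R by rewrite ltr0n ltnW.
rewrite divr_gt0//=; apply: lt_le_trans qN.
rewrite ltr_pM2l// ltf_pV2 ?posrE//; rewrite -natr1; lra.
Qed.

(** A lower bound on (s,t) passes to the image of (s,t) under the map y -> q /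
    y mod 1. As long as there is no integer inside (q / t, q / s) the image is
    again an interval, longer by a factor at least q, and lengths never exceed
    1. Once there is one, the image contains an interval starting at 0 and
    [lower_bounded_full] applies. *)
Lemma lower_bounded_spread n : forall u v s t, dominates u v -> dominates v u -> 0 <= s ->
  s < t -> t <= 1 ->
  1 < q ^+ n * (t - s) -> lower_bounded v s t -> lower_bounded u 0 1 /\ lower_bounded v 0 1.
Proof.
elim: n => [|n IH] u v s t duv dvu s0 st t1 big lv; first by move: big; rewrite mul1r; lra.
have t0 : 0 < t by exact: le_lt_trans st.
have fin w (w0 : 0 < w) (w1 : w <= 1) : lower_bounded u 0 w -> lower_bounded u 0 1 /\
  lower_bounded v 0 1.
  move=> lu; have lv1 := lower_bounded_full dvu w0 w1 lu.
  by split=> //; exact: (lower_bounded_full duv ltr01 (lexx 1) lv1).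
move: s0; rewrite le_eqVlt => /orP[/eqP s0|s0].
  rewrite -s0 in lv; apply: (fin 1) => //; exact: (lower_bounded_full duv t0 t1 lv).
have qt1 : 1 <= q / t by rewrite ler_pdivlMr// mul1r; exact: le_trans t1 (ltW q1).
pose m := Num.truncn (q / t).
have /andP[mq qm] : m%:R <= q / t < m.+1%:R by apply: truncn_itv; exact: le_trans qt1.
have m1 : (0 < m)%N by rewrite -ltnS -(ltr_nat R) (le_lt_trans qt1).
have [le|gt] := leP (q / s) m.+1%:R.
  (* the image is a single interval, longer by a factor at least q *)
  have ab : q / t < q / s by rewrite ltr_pM2l// ltf_pV2 ?posrE.
  have lu : lower_bounded u (q / t - m%:R) (q / s - m%:R).
    have a0 : 0 <= q / t - m%:R by rewrite subr_ge0.
    have b1 : q / s - m%:R <= 1 by rewrite lerBlDr addrC natr1.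
    apply: (lower_bounded_step (k := m.-1) duv (ltW s0) t1 lv a0 b1) => x; rewrite prednK//.
    move=> /andP[ax xb]; have y1 : q / t < x + m%:R by lra.
    have y2 : x + m%:R < q / s by lra.
    have y0 : 0 < x + m%:R by apply: lt_trans y1; rewrite divr_gt0.
    rewrite ltr_pdivlMr// mulrC -ltr_pdivlMr// y2/= ltr_pdivrMr// mulrC -ltr_pdivrMr//.
  have [||||lv1 lu1] := IH v u (q / t - m%:R) (q / s - m%:R) dvu duv _ _ _ _ lu.
  - by rewrite subr_ge0.
  - lra.
  - by rewrite lerBlDr addrC natr1.
  - apply: lt_le_trans big _; rewrite exprSr -mulrA ler_wpM2l ?exprn_ge0 ?(ltW q0)//.
    have -> : q / s - m%:R - (q / t - m%:R) = q * (t - s) / (s * t).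
      by field; rewrite !gt_eqF.
    rewrite ler_pdivlMr ?mulr_gt0// ler_piMr ?mulr_ge0 ?(ltW q0) ?subr_ge0 ?(ltW st)//.
    by rewrite mulr_ile1 ?(ltW s0) ?(ltW t0)//; exact: le_trans (ltW st) t1.
  - by split.
pose w := Num.min 1 (q / s - m.+1%:R).
have w0 : 0 < w by rewrite lt_min ltr01 subr_gt0.
have w1 : w <= 1 by rewrite ge_min lexx.
apply: (fin w w0 w1).
apply: (lower_bounded_step (k := m) duv (ltW s0) t1 lv (lexx 0) w1) => x /andP[x0 xw].
have y2 : x + m.+1%:R < q / s by move: xw; rewrite lt_min => /andP[_]; lra.
have y1 : q / t < x + m.+1%:R by lra.
have y0 : 0 < x + m.+1%:R by rewrite ltr_wpDr.
by rewrite ltr_pdivlMr// mulrC -ltr_pdivlMr// y2/= ltr_pdivrMr// mulrC -ltr_pdivrMr.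
Qed.

(** Otherwise |h| is small at some point of every cell of a fine grid, and
    [mass_sample] contradicts the size of the mass. *)
Lemma lower_bounded_init h M : bvnorm_le h M -> 0 < mass h ->
  exists s t, [/\ 0 <= s, s < t, t <= 1 & lower_bounded (fun x => nrm (h x)) s t].
Proof.
move=> nh m0; apply: contrapT => no.
have M0 := bvnorm_ge0 nh; have e0 : 0 < mass h / 4 by rewrite divr_gt0.
have [m [m1 Mm]] := ex_small_quotient M0 e0.
have mp : 0 < m%:R :> R by rewrite ltr0n ltnW.
suff : mass h <= mass h / 4 + M / m%:R by lra.
apply: (mass_sample nh m1 (ltW e0)) => j jm; apply: contrapT => nx; apply: no.
have a0 : 0 <= j%:R / m%:R :> R by rewrite divr_ge0.
have ab : j%:R / m%:R < j.+1%:R / m%:R :> R by rewrite ltr_pM2r ?invr_gt0// ltr_nat.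
have b1 : j.+1%:R / m%:R <= 1 :> R by rewrite ler_pdivrMr// mul1r ler_nat.
exists (j%:R / m%:R), (j.+1%:R / m%:R); split=> //; exists (mass h / 4) => //.
apply: aeW => x /andP[jx xj]; rewrite leNgt; apply/negP => hx; apply: nx.
exists x; split; [by rewrite (ltW jx) (ltW xj)| |exact: ltW].
by rewrite (le_lt_trans a0 jx) (lt_le_trans xj b1).
Qed.

(** Near 0 the function h oscillates no more than its majorant, which has a
    limit there by monotonicity. *)
Lemma cauchy_at0 h M : bvnorm_le h M -> forall eps, 0 < eps -> exists2 d : R, 0 < d &
  forall s t, 0 < s < 1 -> 0 < t < 1 -> s < d -> t < d -> nrm (h s - h t) <= eps.
Proof.
move=> [_ [phi pb pm]] eps e0.
have hi : has_inf (phi @` U).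
  split; first by exists (phi 2^-1), 2^-1 => //; rewrite UE; lra.
  by exists 0 => _ [x Ux <-]; have /andP[] := pb x Ux.
have [_ [d Ud <-] dinf] := inf_adherent e0 hi.
have d01 : 0 < d < 1 by rewrite -UE.
exists d; first by case/andP: d01.
have low x : U x -> inf (phi @` U) <= phi x.
  by move=> Ux; apply: ge_inf; [exact: hi.2|exists x].
have pmono x y : U x -> U y -> x <= y -> phi x <= phi y.
  by move=> Ux Uy xy; have := pm x y Ux Uy xy; have := nrm_ge0 (h y - h x); lra.
have H s t : U s -> U t -> t < d -> s <= t -> nrm (h t - h s) <= eps.
  move=> Us Ut td st; have := pm s t Us Ut st; have := low s Us;
    have := pmono t d Ut Ud (ltW td); lra.
move=> s t; rewrite -!UE => Us Ut sd td; case: (leP s t) => [st|/ltW ts]; last exact: H.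
by rewrite nrmBC; exact: H.
Qed.

Definition direction (a : R[i]) : R[i] := a * ((nrm a)^-1)%:C.

Lemma nrm_direction a : 0 < nrm a -> nrm (direction a) = 1.
Proof. by move=> a0; rewrite /direction nrmM nrm_real ger0_norm ?invr_ge0 ?ltW// divff ?gt_eqF.
  Qed.

Lemma direction_lip (a b : R[i]) c : 0 < c -> c <= nrm a -> c <= nrm b ->
  nrm (direction a - direction b) <= 2 * nrm (a - b) / c.
Proof.
move=> c0 ca cb; have a0 := lt_le_trans c0 ca; have b0 := lt_le_trans c0 cb.
have -> : direction a - direction b = (a - b) * ((nrm a)^-1)%:C + b * ((nrm a)^-1 - (nrm
  b)^-1)%:C.
  by rewrite /direction rmorphB/=; ring.
have i1 : (nrm a)^-1 <= c^-1 by rewrite lef_pV2 ?posrE.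
have ia0 : 0 <= (nrm a)^-1 by rewrite invr_ge0 ltW.
have t1 : nrm (a - b) * (nrm a)^-1 <= nrm (a - b) * c^-1 by rewrite ler_wpM2l ?nrm_ge0.
have e2 : nrm b * ((nrm a)^-1 - (nrm b)^-1) = (nrm b - nrm a) * (nrm a)^-1.
  by field; rewrite !gt_eqF.
have t2 : `|nrm b - nrm a| * (nrm a)^-1 <= nrm (a - b) * c^-1.
  by rewrite ler_pM ?normr_ge0// distrC nrm_dist.
apply: (le_trans (nrmD _ _)); rewrite !nrmM !nrm_real.
rewrite (ger0_norm ia0) -{1}[nrm b]ger0_norm ?nrm_ge0// -normrM e2 normrM (ger0_norm ia0).
lra.
Qed.

Lemma directionE a : nrm (a) != 0 -> a = (nrm a)%:C * direction a.
Proof.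
by move=> a0; rewrite /direction mulrCA -rmorphM/= divff// rmorph1 mulr1.
Qed.

(** All terms of the series at x share the phase of - f x. The far terms
    evaluate K near 0, where K has a limit, of norm at least c; so the phase of
    K along them converges. Comparing consecutive terms gives z = 1, and
    comparing far terms at two points shows that f has the same phase at both.
    *)
Lemma phase_alignment z f K M N : nrm z = 1 -> bvnorm_le f N -> bvnorm_le K M ->
  {ae mu, forall x, 0 < x < 1 -> f x = - transfer z K x} -> mass K <= mass f ->
  lower_bounded (fun x => nrm (K x)) 0 1 ->
  z = 1 /\ exists2 d, nrm d = 1 & {ae mu, forall x, 0 < x < 1 -> f x = (nrm (f x))%:C * d}.
Proof.
move=> z1 nf nK fK Kf [c c0 cK].
have ext := extremal_image z1 nf nK fK Kf.
have cK' : {ae mu, forall x, 0 < x -> 0 < x < 1 -> c <= nrm (K x)} by apply: ae_imp cK => x h _.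
pose good x := [/\ f x = - transfer z K x,
  forall n, \sum_(k < n) nrm (z ^+ k.+1 * lift K (x + k.+1%:R)) <= nrm (f x) &
  forall k : nat, q < x + k.+1%:R -> c <= nrm (K (q / (x + k.+1%:R)))].
have gd : {ae mu, forall x, 0 < x < 1 -> good x}.
  apply: ae_imp3 fK ext (ae_pull cK') => x h1 h2 h3 x01; split; [exact: h1|exact: h2|].
  move=> k qk; have /andP[x0 x1] := x01; apply: h3 => //.
  have y0 := lt_trans q0 qk; by rewrite divr_gt0//= ltr_pdivrMr// mul1r.
(* Up to a positive factor, z ^+ k.+1 * K (q / (x + k.+1)) is the term of index
   k at x. *)
have ph x : 0 < x < 1 -> good x -> forall k : nat, q < x + k.+1%:R ->
    z ^+ k.+1 * direction (K (q / (x + k.+1%:R))) = - direction (f x).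
  move=> x01 [h1 h2 h3] k qk.
  have y0 := lt_trans q0 qk; have Kc := h3 k qk; have K0 := lt_le_trans c0 Kc.
  have E : csum (fun k => z ^+ k.+1 * lift K (x + k.+1%:R)) = - f x by rewrite h1 opprK.
  have := @csum_phase (fun k => z ^+ k.+1 * lift K (x + k.+1%:R)) _ k.
  rewrite E nrmN => /(_ h2) P.
  set w := q * (x + k.+1%:R) ^- 2; have w0 : 0 < w by rewrite mulr_gt0// invr_gt0 exprn_gt0.
  have lE : lift K (x + k.+1%:R) = w%:C * K (q / (x + k.+1%:R)) by rewrite (lift_large q1).
  have nT : nrm (z ^+ k.+1 * lift K (x + k.+1%:R)) = w * nrm (K (q / (x + k.+1%:R))).
    by rewrite nrmM nrmX z1 expr1n mul1r lE nrmM nrm_real ger0_norm// ltW.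
  have f0 : 0 < nrm (f x).
    apply: lt_le_trans (h2 k.+1); rewrite big_ord_recr/= ltr_wpDl ?sumr_ge0//.
      by move=> i _; exact: nrm_ge0.
    by rewrite nT mulr_gt0.
  move: P; rewrite nT lE; move: (K _) K0 => a a0 P.
  have wC : w%:C != 0 :> R[i] by apply/eqP => /(congr1 (@complex.Re R)) /= /eqP; rewrite gt_eqF.
  have aC : (nrm a)%:C != 0 :> R[i].
    by apply/eqP => /(congr1 (@complex.Re R)) /= /eqP; rewrite gt_eqF.
  have fC : (nrm (f x))%:C != 0 :> R[i].
    by apply/eqP => /(congr1 (@complex.Re R)) /= /eqP; rewrite gt_eqF.
  rewrite /direction !fmorphV/=; apply: (mulfI wC); apply: (mulfI aC); apply: (mulfI fC).
  transitivity (z ^+ k.+1 * (w%:C * a) * (nrm (f x))%:C); first by field.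
  rewrite P rmorphM/=; by field.
have [x [x01 gd']] := ae_point ltr01 gd; have gx := gd' x01.
(* For k >= k0 the point q / (x + k.+1) is so close to 0 that the phase of K
   varies by at most eps. *)
have far eps : 0 < eps -> exists k0 : nat, forall x y (k l : nat), 0 < x < 1 -> 0 < y < 1 ->
    (k0 <= k)%N -> (k0 <= l)%N -> good x -> good y ->
    [/\ q < x + k.+1%:R, q < y + l.+1%:R &
      nrm (direction (K (q / (x + k.+1%:R))) - direction (K (q / (y + l.+1%:R)))) <= eps].
  move=> e0; have e1 : 0 < eps * c / 2 by rewrite divr_gt0// mulr_gt0.
  have [d d0 dH] := cauchy_at0 nK e1.
  pose m := Num.min d 1; have m0 : 0 < m by rewrite lt_min d0 ltr01.
  have [k0 [k01 qk]] := ex_small_quotient (ltW q0) m0; exists k0.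
  have pt (x' : R) (k : nat) : 0 < x' < 1 -> (k0 <= k)%N -> q < x' + k.+1%:R /\
    q / (x' + k.+1%:R) < d.
    move=> /andP[x0 x1] kk.
    have k0R : 0 < k0%:R :> R by rewrite ltr0n ltnW.
    have y0 : k0%:R < x' + k.+1%:R by apply: (@le_lt_trans _ _ k.+1%:R);
      [rewrite ler_nat ltnW|lra].
    have y00 := lt_trans k0R y0.
    have : q / (x' + k.+1%:R) < m.
      by apply: lt_le_trans qk; rewrite ltr_pM2l// ltf_pV2 ?posrE.
    by rewrite lt_min => /andP[? ]; rewrite ltr_pdivrMr// mul1r.
  move=> x' y' k l x'01 y'01 kk kl [_ _ gx'] [_ _ gy'].
  have [a1 a2] := pt x' k x'01 kk; have [b1 b2] := pt y' l y'01 kl.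
  have y01 t : q < t -> 0 < q / t < 1.
    by move=> qt; have t0 := lt_trans q0 qt; rewrite divr_gt0//= ltr_pdivrMr// mul1r.
  split=> //; apply: (le_trans (direction_lip c0 (gx' k a1) (gy' l b1))).
  rewrite ler_pdivrMr// -ler_pdivlMl//.
  have -> : 2^-1 * (eps * c) = eps * c / 2 by rewrite mulrC.
  by apply: dH => //; exact: y01.
have zE : z = 1.
  apply/subr0_eq/nrm_eq0/eqP; rewrite eq_le nrm_ge0 andbT.
  apply/ler_addgt0Pr => eps e0; rewrite add0r; have [k0 Hk] := far eps e0.
  have [a1 a2 a3] := Hk x x k0 k0.+1 x01 x01 (leqnn _) (leqnSn _) gx gx.
  have p1 := ph x x01 gx k0 a1; have p2 := ph x x01 gx k0.+1 a2.
  have K1 : nrm (direction (K (q / (x + k0.+2%:R)))) = 1.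
    by apply: nrm_direction; case: gx => _ _ h; exact: lt_le_trans c0 (h _ a2).
  have zk : z ^+ k0.+1 != 0.
    apply/eqP => h; have := congr1 (@Normc.normc R) h.
    by rewrite nrmX z1 expr1n nrm0 => /eqP; rewrite oner_eq0.
  have E : direction (K (q / (x + k0.+1%:R))) = z * direction (K (q / (x + k0.+2%:R))).
    by apply: (mulfI zk); rewrite /= p1 mulrA -exprSr p2.
  move: a3; rewrite E.
  by rewrite -{2}[direction (K (q / (x + k0.+2%:R)))]mul1r -mulrBl nrmM K1 mulr1.
split=> //; exists (direction (f x)).
  apply: nrm_direction; have [k0 Hk] := far 1 ltr01.
  have [a1 _ _] := Hk x x k0 k0 x01 x01 (leqnn _) (leqnn _) gx gx.
  have [_ h2 h3] := gx; apply: lt_le_trans (h2 k0.+1); rewrite big_ord_recr/= ltr_wpDl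
    ?sumr_ge0//.
    by move=> i _; exact: nrm_ge0.
  rewrite nrmM nrmX z1 expr1n mul1r (lift_large q1)// nrmM nrm_real.
  have w0 : 0 < q * (x + k0.+1%:R) ^- 2.
    by rewrite mulr_gt0// invr_gt0 exprn_gt0// (lt_trans q0).
  by rewrite ger0_norm ?ltW// mulr_gt0// (lt_le_trans c0)// h3.
apply: ae_imp gd => y gy' y01; have gy := gy' y01.
have [f0|f0] := eqVneq (nrm (f y)) 0.
  by rewrite (nrm_eq0 f0) nrm0 mul0r.
rewrite {1}(directionE f0); congr (_ * _).
apply/subr0_eq/nrm_eq0/eqP; rewrite eq_le nrm_ge0 andbT.
apply/ler_addgt0Pr => eps e0; rewrite add0r; have [k0 Hk] := far eps e0.
have [a1 a2 a3] := Hk y x k0 k0 y01 x01 (leqnn _) (leqnn _) gy gx.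
have := ph y y01 gy k0 a1; have := ph x x01 gx k0 a2.
rewrite zE expr1n !mul1r => h1 h2; move: a3; rewrite h1 h2.
by rewrite opprK addrC nrmBC.
Qed.

(** Both equations are contractions for the mass, so f and K have the same mass
    and [extremal_image] applies to either. If the mass is positive, |K| has a
    positive lower bound on some interval, which spreads: |f| and |K| are
    bounded below on (0,1). Then [phase_alignment] gives z = e = 1 and a
    constant phase of f, so that the norm of the integral of f is the mass. *)
Theorem kernel_dichotomy z e f K M N : nrm z = 1 -> nrm e = 1 -> bvnorm_le f N -> bvnorm_le K M ->
  {ae mu, forall x, 0 < x < 1 -> f x = - transfer z K x} ->
  {ae mu, forall x, 0 < x < 1 -> K x = - transfer e f x} ->
  (mass f = 0 /\ mass K = 0) \/ [/\ z = 1, e = 1 & cintegral U f <> 0].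
Proof.
move=> z1 e1 nf nK fK Kf.
have mle z' f' K' M' N' : nrm z' = 1 -> bvnorm_le f' N' -> bvnorm_le K' M' ->
    {ae mu, forall x, 0 < x < 1 -> f' x = - transfer z' K' x} -> mass f' <= mass K'.
  move=> z'1 nf' nK' h; have [B nB] := transfer_bvnorm q1 z'1 nK'.
  rewrite (@mass_ae f' (transfer z' K') _ _ nf' nB); first exact: transfer_mass q1 _ _ _ _ z'1
    nK' nB.
  by apply: ae_imp h => x h x01; rewrite h// nrmN.
have m1 := mle _ _ _ _ _ z1 nf nK fK; have m2 := mle _ _ _ _ _ e1 nK nf Kf.
have mE : mass K = mass f by apply/eqP; rewrite eq_le m1 m2.
have [m0|m0] := eqVneq (mass f) 0; first by left; rewrite mE.
right; have mp : 0 < mass K by rewrite mE lt_neqAle eq_sym m0 mass_ge0.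
have dom z' f' K' M' N' : nrm z' = 1 -> bvnorm_le f' N' -> bvnorm_le K' M' ->
    {ae mu, forall x, 0 < x < 1 -> f' x = - transfer z' K' x} -> mass K' <= mass f' ->
    dominates (fun x => nrm (f' x)) (fun x => nrm (K' x)).
  move=> z'1 nf' nK' h hm; apply: ae_imp (extremal_image z'1 nf' nK' h hm) => x H x01 k qk.
  apply: le_trans (H x01 k.+1); rewrite big_ord_recr/= ler_wpDl ?sumr_ge0//.
    by move=> i _; exact: nrm_ge0.
  rewrite nrmM nrmX z'1 expr1n mul1r (lift_large q1)// nrmM nrm_real ler_wpM2r ?nrm_ge0//.
  exact: ler_norm.
have d1 := dom _ _ _ _ _ z1 nf nK fK m2; have d2 := dom _ _ _ _ _ e1 nK nf Kf m1.
have [s [t [s0 st t1 lK]]] := lower_bounded_init nK mp.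
have qi : 0 <= q^-1 < 1 by rewrite invr_ge0 (ltW q0) invf_lt1.
have st0 : 0 < (t - s) / 2 by rewrite divr_gt0// subr_gt0.
have [n qn] := ex_small_power 1 qi st0.
have big : 1 < q ^+ n * (t - s).
  have qn0 : 0 < q ^+ n by rewrite exprn_gt0.
  move: qn; rewrite mulr1 exprVn -[leLHS]mul1r ler_pdivrMr// mulrC => h; lra.
have [lf1 lK1] := lower_bounded_spread d1 d2 s0 st t1 big lK.
have [zE [d d1' fd]] := phase_alignment z1 nf nK fK m2 lK1.
have [eE _] := phase_alignment e1 nK nf Kf m1 lf1.
split=> // I0; move/negP: m0; apply; apply/eqP.
have nn : bvnorm_le (fun x => (nrm (f x))%:C) N.
  split; last exact: bv_nrm nf.2.
  by move=> x x01; rewrite nrm_real ger0_norm ?nrm_ge0// nf.1.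
have E1 : cintegral U f = d * cintegral U (fun x => (nrm (f x))%:C).
  rewrite -cintZ//; last exact: bvnorm_L1 nn.
  apply: cint_ae => //; [exact: bvnorm_L1 nf|exact: bvnorm_L1 (bvnormZ d nn)|].
  by apply: ae_imp fd => x h; rewrite UE => /h {1}->; rewrite mulrC.
have E2 : cintegral U (fun x => (nrm (f x))%:C) = (mass f)%:C.
  by apply: complex_eq => //=; exact: Rint0.
have := congr1 (@Normc.normc R) I0; rewrite E1 E2 nrmM d1' mul1r nrm_real nrm0.
by rewrite ger0_norm ?mass_ge0.
Qed.

End kernel.

(** * Total variation and monotone majorants *)

Section variation.
Context (R : realType).
Local Notation mu := (@lebesgue_measure R).
Implicit Types (J : set R) (f g h : R -> R[i]).

Definition variation_sum g (s : seq R) : R :=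
  \sum_(i < (size s).-1) nrm (g s`_i.+1 - g s`_i).

Lemma variation_sum_rcons g s a b :
  variation_sum g (rcons (rcons s a) b) = variation_sum g (rcons s a) + nrm (g b - g a).
Proof.
rewrite /variation_sum !size_rcons/= big_ord_recr/=; congr (_ + nrm (g _ - g _)); last first.
- by rewrite nth_rcons size_rcons ltnS leqnn nth_rcons ltnn eqxx.
- by rewrite nth_rcons size_rcons ltnn eqxx.
apply: eq_bigr => i _; rewrite !(nth_rcons 0 (rcons s a)) size_rcons !ltnS.
by rewrite (ltn_ord i) (ltnW (ltn_ord i)).
Qed.

Lemma sorted_rcons (s : seq R) a b :
  sorted <%R (rcons (rcons s a) b) = sorted <%R (rcons s a) && (a < b).
Proof. by case: s => [|c s] /=; rewrite ?andbT// rcons_path last_rcons. Qed.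

Lemma bv_Var J g T : bv J g T -> (Var J g < +oo)%E.
Proof.
move=> [phi pb pm]; apply: (@le_lt_trans _ _ (Num.max 0 T)%:E); last by rewrite ltry.
apply: ge_ereal_sup => _ [s [ss sJ] <-]; rewrite lee_fin.
case: s ss sJ => [|c s] ss sJ; first by rewrite big_ord0 le_max lexx.
have sn (i : nat) : (i < size (c :: s))%N -> J (c :: s)`_i by move=> h; apply: sJ; exact: mem_nth.
apply: (@le_trans _ _ (\sum_(0 <= i < (size (c :: s)).-1) (phi (c :: s)`_i.+1 - phi (c ::
  s)`_i))).
  rewrite big_mkord; apply: ler_sum => i _; have il : (i.+1 < size (c :: s))%N by exact: ltn_ord.
  apply: pm; [exact: sn (ltnW il)|exact: sn|].
  by apply: ltW; exact: (sortedP 0 ss).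
rewrite (telescope_sumr (fun i => phi (c :: s)`_i))//.
have l1 : (size s < size (c :: s))%N by [].
have /andP[? ?] := pb _ (sn _ l1); have /andP[? ?] := pb _ (sn 0%N isT).
by rewrite le_max; apply/orP; right; rewrite /=; lra.
Qed.

(** The majorant at x is the variation over the part of J up to x. *)
Lemma Var_bv J g : (Var J g < +oo)%E -> exists T, bv J g T.
Proof.
move=> Voo.
have V0 : (0 <= Var J g)%E.
  by apply: ereal_sup_ubound; exists [::]; [split|rewrite /= big_ord0].
have Vf : Var J g \is a fin_num by rewrite ge0_fin_numE.
pose T := fine (Var J g).
pose S x := [set variation_sum g s | s in [set s : seq R | sorted <%R s /\ {in s, forall y,
  J y /\ y <= x}]].
have ST x r : S x r -> r <= T.
  move=> [s [ss sJ] <-]; rewrite -lee_fin fineK//; apply: ereal_sup_ubound.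
  by exists s => //; split=> // y /sJ[].
have S0 x : S x 0 by exists [::]; [split|rewrite /variation_sum big_ord0].
have hs x : has_sup (S x) by split; [exists 0|exists T => r; exact: ST].
exists T; exists (fun x => sup (S x)).
  move=> x _; apply/andP; split; first by apply: sup_ubound; [exact: (hs x).2|exact: S0].
  by apply: ge_sup; [exists 0|move=> r; exact: ST].
move=> x y Jx Jy; rewrite le_eqVlt => /orP[/eqP <-|xy]; first by rewrite !subrr nrm0.
rewrite lerBrDr addrC -lerBrDr; apply: ge_sup; first by exists 0.
move=> _ [s [ss sJ] <-]; rewrite lerBrDr.
suff [s' [s's s'J le]] : exists s', [/\ sorted <%R s', {in s', forall t, J t /\ t <= y} &
    variation_sum g s + nrm (g y - g x) <= variation_sum g s'].
  by apply: le_trans le _; apply: sup_ubound; [exact: (hs y).2|exists s'].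
case/lastP: s ss sJ => [|s a] ss sJ.
  exists (rcons (rcons [::] x) y); split.
  - by rewrite sorted_rcons.
  - by move=> t; rewrite !inE => /orP[] /eqP ->; rewrite ?lexx// ltW.
  - by rewrite variation_sum_rcons lerD2r /variation_sum big_ord0 big_ord0.
have [Ja ax] : J a /\ a <= x by apply: sJ; rewrite mem_rcons inE eqxx.
have sy t : t \in rcons s a -> J t /\ t <= y.
  by move=> /sJ[? tx]; split=> //; apply: le_trans tx _; exact: ltW.
move: ax; rewrite le_eqVlt => /orP[/eqP ax|ax].
  exists (rcons (rcons s a) y); split.
  - by rewrite sorted_rcons ss ax.
  - by move=> t; rewrite mem_rcons inE => /orP[/eqP ->//|]; exact: sy.
  - by rewrite variation_sum_rcons ax.
exists (rcons (rcons (rcons s a) x) y); split.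
- by rewrite !sorted_rcons ss ax.
- move=> t; rewrite mem_rcons inE => /orP[/eqP ->//|].
  by rewrite mem_rcons inE => /orP[/eqP ->|]; [split=> //; exact: ltW|exact: sy].
- by rewrite !variation_sum_rcons lerD2r lerDl nrm_ge0.
Qed.

Lemma BVP J h : BV J h <-> L1 J h /\ exists g T, eq_ae J h g /\ bv J g T.
Proof.
split=> [[Lh [g hg /Var_bv[T gT]]]|[Lh [g [T [hg gT]]]]]; split=> //.
  by exists g, T.
by exists g => //; exact: bv_Var gT.
Qed.

Lemma bv_shift J K f T (c : R) : (forall x, K x -> J (x + c)) -> bv J f T ->
  bv K (fun x => f (x + c)) T.
Proof.
move=> KJ [phi b m]; exists (fun x => phi (x + c)) => [x /KJ/b//|x y Kx Ky xy].
by apply: m; rewrite ?lerD2r//; exact: KJ.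
Qed.

Lemma bv_extend_itv f (a b : R) M T : 0 <= M -> 0 <= T ->
  (forall x, a < x < b -> nrm (f x) <= M) -> bv `]a, b[ f T ->
  bv setT (fun x => if a < x < b then f x else 0) (2 * M + T).
Proof.
move=> M0 T0 fM [phi pb pm].
have IE x : `]a, b[%classic x = (a < x < b) :> Prop by rewrite /= in_itv.
have pB x : a < x < b -> 0 <= phi x <= T by rewrite -IE; exact: pb.
exists (fun x => if a < x then (if x < b then M + phi x else 2 * M + T) else 0).
  move=> x _; case: (ltP a x) => ax; last by rewrite lexx; lra.
  by case: (ltP x b) => xb; [have := pB x; rewrite ax xb => /(_ isT)/andP[]; lra|lra].
move=> x y _ _ xy.
case: (ltP a x) => ax /=; case: (ltP a y) => ay /=; try lra.
- case: (ltP x b) => xb; case: (ltP y b) => yb.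
  + by have := pm x y; rewrite !IE ax xb ay yb => /(_ isT isT xy); lra.
  + have xab : a < x < b by rewrite ax xb.
    by rewrite sub0r nrmN; have := fM x xab; have /andP[] := pB x xab; lra.
  + lra.
  + by rewrite subrr nrm0; lra.
- case: (ltP y b) => yb; last by rewrite subrr nrm0; lra.
  have yab : a < y < b by rewrite ay yb.
  by rewrite subr0; have := fM y yab; have /andP[] := pB y yab; lra.
- by change (nrm (0 - 0 : R[i]) <= 0 - 0); rewrite !subrr nrm0.
Qed.

Lemma bv_extend_right f (a : R) M T : 0 <= M -> 0 <= T ->
  (forall x, x <= a -> f x = 0) ->
  (forall x, a < x -> nrm (f x) <= M) -> bv `]a, +oo[ f T -> bv setT f (M + T).
Proof.
move=> M0 T0 f0 fM [phi pb pm].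
have IE x : `]a, +oo[%classic x = (a < x) :> Prop by rewrite /= in_itv/= andbT.
have pB x : a < x -> 0 <= phi x <= T by rewrite -IE; exact: pb.
exists (fun x => if a < x then M + phi x else 0).
  by move=> x _; case: (ltP a x) => ax; [have /andP[] := pB x ax; lra|rewrite lexx; lra].
move=> x y _ _ xy.
case: (ltP a x) => ax /=; case: (ltP a y) => ay /=; try lra.
- by have := pm x y; rewrite !IE => /(_ ax ay xy); lra.
- by rewrite (f0 x)// subr0; have := fM y ay; have /andP[] := pB y ay; lra.
- by rewrite !f0// subrr nrm0 subrr.
Qed.

Lemma bv_bounded J f T x0 : J x0 -> bv J f T ->
  exists2 M, 0 <= M & forall x, J x -> nrm (f x) <= M.
Proof.
move=> J0 [phi pb pm]; have /andP[a0 aT] := pb _ J0.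
exists (nrm (f x0) + T); first by rewrite addr_ge0 ?nrm_ge0//; lra.
move=> x Jx; have /andP[? ?] := pb _ Jx.
have := nrm_tri (f x) (f x0) 0; rewrite !subr0.
case: (leP x x0) => [xx|/ltW xx]; first by have := pm _ _ Jx J0 xx; rewrite nrmBC; lra.
by have := pm _ _ J0 Jx xx; lra.
Qed.

End variation.

(** * Gluing the unknown parts to the prescribed one *)

Section assembly.
Context (R : realType) (q : R) (q1 : 1 < q).
Local Notation mu := (@lebesgue_measure R).
Local Notation U := (`]0%R, 1%R[%classic : set R).
Local Notation I1q := (`]1%R, q[%classic : set R).
Local Notation Re := complex.Re.
Local Notation Im := complex.Im.
Local Notation lift := (lift q).
Local Notation transfer := (transfer q).
Local Notation double_transfer := (double_transfer q).
Implicit Types (f g h F G : R -> R[i]) (z e : R[i]).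

Let q0 : 0 < q. Proof. exact: lt_trans q1. Qed.
Let qn0 : q != 0. Proof. by rewrite gt_eqF. Qed.
Let mU : measurable U. Proof. exact: measurable_itv. Qed.
Let mD : measurable (Rplus : set R). Proof. exact: measurable_itv. Qed.

(** Bounded functions of bounded variation carried by the interval (1,q) on
    which the solution is prescribed. *)
Definition slab g (B T : R) : Prop :=
  [/\ 0 <= B, forall t, ~ (1 < t < q) -> g t = 0, forall t, nrm (g t) <= B & bv setT g T].

Lemma slab_sum z g B T x n : nrm z = 1 -> slab g B T -> 0 < x < 1 ->
  \sum_(k < n) nrm (z ^+ k.+1 * g (x + k.+1%:R)) <= B *+ Num.truncn q.
Proof.
move=> z1 [B0 g0 gB _] /andP[x0 x1]; set N := Num.truncn q.
have far k : (N <= k)%N -> g (x + k.+1%:R) = 0.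
  move=> Nk; apply: g0 => /andP[_]; apply/negP; rewrite -leNgt.
  apply: (@le_trans _ _ k.+1%:R); last by rewrite lerDr ltW.
  by apply: (le_trans (ltW (truncnS_gt q))); rewrite ler_nat ltnS.
have bd k : nrm (z ^+ k.+1 * g (x + k.+1%:R)) <= B.
  by rewrite nrmM nrmX z1 expr1n mul1r gB.
have sm m : (m <= N)%N -> \sum_(k < m) nrm (z ^+ k.+1 * g (x + k.+1%:R)) <= B *+ N.
  move=> mN; apply: (@le_trans _ _ (\sum_(k < m) B)); first by apply: ler_sum => k _.
  by rewrite sumr_const card_ord ler_wpMn2l.
have [nN|/ltnW Nn] := leqP n N; first exact: sm.
rewrite -(subnKC Nn) big_split_ord/= [X in _ + X]big1 ?addr0; first exact: sm.
by move=> k _; rewrite far ?mulr0 ?nrm0// leq_addr.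
Qed.

(** Only finitely many translates of (0,1) meet (1,q). *)
Lemma bvnorm_tail z g B T : nrm z = 1 -> slab g B T -> exists M, bvnorm_le (tail z g) M.
Proof.
move=> z1 sg; have [B0 g0 gB gT] := sg; set N := Num.truncn q.
have E x : 0 < x < 1 -> tail z g x = \sum_(k < N) z ^+ k.+1 * g (x + k.+1%:R).
  move=> /andP[x0 x1]; apply: csumE; apply: (@ccvg_shift _ _ _ N).
  apply: (@ccvg_ext _ (fun=> \sum_(k < N) z ^+ k.+1 * g (x + k.+1%:R))).
    move=> n; rewrite /psum addnC big_split_ord/= [X in _ + X]big1 ?addr0// => k _.
    rewrite g0 ?mulr0// => /andP[_]; apply/negP; rewrite -leNgt.
    apply: (@le_trans _ _ N.+1%:R); first exact: ltW (truncnS_gt q).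
    by apply: (@le_trans _ _ (N + k).+1%:R); [rewrite ler_nat ltnS leq_addr|rewrite lerDr ltW].
  by split; exact: cvg_cst.
have [M nM] : exists M, bvnorm_le (fun x => \sum_(k < N) z ^+ k.+1 * g (x + k.+1%:R)) M.
  elim: (N) => [|n [M nM]].
    by exists 0; apply: bvnorm_eq (bvnorm0 R) => x _; rewrite big_ord0.
  have n1 : bvnorm_le (fun x => g (x + n.+1%:R)) (Num.max B T).
    split; first by move=> x _; rewrite le_max gB.
    by apply: (@bv_le _ _ _ T); [rewrite le_max lexx orbT|exact: bv_shift gT].
  eexists; apply: bvnorm_eq (bvnormD nM (bvnormZ (z ^+ n.+1) n1)) => x _.
  by rewrite big_ord_recr.
by exists M; apply: bvnorm_eq nM => x /E.
Qed.

(** The map t -> q / t sends (1,q) to itself. *)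
Lemma slab_flip g B T : slab g B T -> exists B' T', slab (flip q g) B' T'.
Proof.
move=> [B0 g0 gB gT].
have qE t : 1 < t < q -> 1 < q / t < q.
  move=> /andP[t1 tq]; have t0 : 0 < t by lra.
  by rewrite ltr_pdivlMr// mul1r tq/= ltr_pdivrMr// ltr_pMr.
have z0 t : ~ (1 < t < q) -> flip q g t = 0.
  move=> nt; rewrite /flip g0 ?mulr0// => /andP[h1 h2]; apply: nt.
  have t0 : 0 < t.
    by rewrite -invr_gt0 -(pmulr_rgt0 _ q0); exact: lt_trans h1.
  by move: h1 h2; rewrite ltr_pdivlMr// mul1r ltr_pdivrMr// ltr_pMr// => -> ->.
have T0 : 0 <= T by case: gT => phi pb _; have /andP[] := pb 0 I; lra.
have d0 t : 0 <= q * t ^- 2 by rewrite mulr_ge0 ?(ltW q0)// invr_ge0 sqr_ge0.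
have d1 t : 1 < t < q -> q * t ^- 2 <= q.
  move=> /andP[t1 _]; rewrite ler_piMr ?(ltW q0)// invf_le1 ?exprn_gt0 ?(lt_trans ltr01)//.
  by rewrite exprn_ege1// ltW.
have fb t : nrm (flip q g t) <= q * B.
  have [t1|/negP/z0 ->] := boolP (1 < t < q); last by rewrite nrm0 mulr_ge0// ltW.
  by rewrite (nrm_flip q1) ler_pM ?nrm_ge0 ?d0 ?d1.
have IE t : `]1, q[%classic t = (1 < t < q) :> Prop by rewrite /= in_itv.
have b1 : bv `]1, q[ (fun t => (q * t ^- 2)%:C) q.
  exists (fun t => q - q * t ^- 2).
    by move=> t; rewrite IE => tq; rewrite subr_ge0 d1//= gerBl d0.
  move=> s t; rewrite !IE => /andP[s1 sq] /andP[t1 tq] st.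
  have s0 : 0 < s by lra.
  have t0 : 0 < t by lra.
  have dn : q * t ^- 2 <= q * s ^- 2.
    by rewrite ler_wpM2l ?(ltW q0)// lef_pV2 ?posrE ?exprn_gt0// lerXn2r ?nnegrE ?(ltW s0) ?(ltW
      t0).
  rewrite -rmorphB nrm_real distrC ger0_norm ?subr_ge0//; lra.
have b2 : bv `]1, q[ (fun t => g (q / t)) T.
  apply: (@bv_anti R setT _ g (fun t => q / t) _ _ _ gT) => // s t.
  rewrite !IE => /andP[s1 sq] /andP[t1 tq] st.
  by rewrite ler_wpM2l ?(ltW q0)// lef_pV2 ?posrE//; lra.
have b3 : bv `]1, q[ (flip q g) (B * q + q * T).
  apply: (bvM (ltW q0) B0 _ _ b1 b2) => t; rewrite IE => tq; last exact: gB.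
  by rewrite nrm_real ger0_norm ?d0 ?d1.
have qB : 0 <= q * B by rewrite mulr_ge0// ltW.
have qT : 0 <= B * q + q * T by rewrite addr_ge0// mulr_ge0// ltW.
have b4 := bv_extend_itv qB qT (fun x _ => fb x) b3.
exists (q * B), (2 * (q * B) + (B * q + q * T)); split=> //.
apply: bv_eq b4 => t _; case: ifPn => // /negP nt; by rewrite z0.
Qed.

Lemma slab_L1 g B T : slab g B T -> L1 Rplus g.
Proof.
move=> [B0 g0 gB gT].
have IE t : `]1, q[%classic t = (1 < t < q) :> Prop by rewrite /= in_itv.
have m1q : measurable I1q by exact: measurable_itv.
have L : L1 I1q g.
  have [mR mI] := bv_measurable (bv_sub (@subsetT _ I1q) gT).
  split; apply: (@bounded_integrable _ _ _ _ B) => // x _.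
    exact: le_trans (abs_Re_le _) (gB x).
  exact: le_trans (abs_Im_le _) (gB x).
have S : I1q `<=` Rplus by move=> t; rewrite IE RplusE => /andP[t1 _]; lra.
apply: (L1_extend m1q mD S _ _ L).1 => // x _; rewrite IE; exact: g0.
Qed.

Lemma cint_tail_slab g B T : slab g B T -> cintegral U (tail 1 g) = cintegral Rplus g.
Proof.
move=> sg; have [M nM] := bvnorm_tail (nrm1 R) sg; have [B0 g0 gB gT] := sg.
apply: cint_tail (slab_L1 sg) _ _ nM => [x /andP[x0 x1]|x n x01].
  by apply: g0 => /andP[]; lra.
apply: le_trans (slab_sum n (nrm1 R) sg x01).
by apply: ler_sum => k _; rewrite expr1n mul1r.
Qed.

(** A fixed point of mass 1 is excluded by [kernel_dichotomy] unless z = e = 1,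
    and in this case the one provided by the alternative has integral 0. *)
Lemma equation_solvable z e w Mw : nrm z = 1 -> nrm e = 1 -> bvnorm_le w Mw ->
  (z = 1 -> e = 1 -> cintegral U w = 0) ->
  exists f M, bvnorm_le f M /\ forall x, 0 < x < 1 -> f x = w x + double_transfer z e f x.
Proof.
move=> z1 e1 nw w0; have [//|[g [M [ng mg gE g0]]]] := fredholm_alternative q1 z1 e1 nw.
exfalso; pose K := fun x => -1 * transfer e g x.
have [N nN] := transfer_bvnorm q1 e1 ng; have nK := bvnormZ (-1) nN.
have gK : {ae mu, forall x, 0 < x < 1 -> g x = - transfer z K x}.
  apply: aeW => x x01; rewrite gE// /K.
  by rewrite (transferZ q1 (-1) z1 (bvnorm_ge0 nN) nN.1) ?mulN1r ?opprK//; case/andP: x01 => /ltW.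
have Kg : {ae mu, forall x, 0 < x < 1 -> K x = - transfer e g x}.
  by apply: aeW => x _; rewrite /K mulN1r.
have [[m0 _]|[zE eE]] := kernel_dichotomy q1 z1 e1 ng nK gK Kg.
  by move: mg; rewrite m0 => /eqP; rewrite eq_sym oner_eq0.
by rewrite g0// w0.
Qed.

(** f is the restriction of the glued function to (0,1), and K that of its
    flip. *)
Definition glue f g K : R -> R[i] := fun t => cut f t + g t + lift K t.

Definition period_solution z e F := [/\ L1 Rplus F, zero_period z F & zero_period e (flip q F)].

Lemma glue_mid f g K t : 1 < t < q -> glue f g K t = g t.
Proof.
move=> /andP[t1 tq]; rewrite /glue (lift_small q1) ?ltW// addr0 /cut.
by rewrite [t < 1]ltNge (ltW t1) andbF add0r.
Qed.

Lemma flip_lift K t : 0 < t -> flip q (lift K) t = cut K t.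
Proof. by move=> t0; rewrite /lift flipK// gt_eqF. Qed.

Lemma sum_shift z F g B x :
  (forall n, \sum_(k < n) nrm (z ^+ k.+1 * g (x + k.+1%:R)) <= B) ->
  (forall k : nat, F (x + k.+1%:R) = g (x + k.+1%:R)) ->
  ccvg (fun n => \sum_(j < n) z ^+ j * F (x + j%:R)) (F x + tail z g x).
Proof.
move=> gB Fg; apply: (@ccvg_shift _ _ _ 1); have H := @csum_cvg _ (fun k => z ^+ k.+1 * g (x +
  k.+1%:R)) _ gB.
have C : ccvg (fun=> F x) (F x) by split; exact: cvg_cst.
apply: (ccvg_ext _ (ccvgD C H)) => n; rewrite addn1 big_ord_recl expr0 mul1r addr0; congr (_ + _).
by apply: eq_bigr => k _; rewrite Fg.
Qed.

(** In the sum over j of z^j F(x + j) the term j = 0 is f x, and the others add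
    up to tail z g x + transfer z K x. *)
Lemma glue_zero_period z f g K B T MK : nrm z = 1 -> slab g B T -> bvnorm_le K MK ->
  (forall x, 0 < x < 1 -> f x = - tail z g x - transfer z K x) ->
  zero_period z (glue f g K).
Proof.
move=> z1 sg nK fE; have [B0 g0 gB gT] := sg.
apply: aeW => x x01; have /andP[x0 x1] := x01.
pose G t := g t + lift K t.
have a1 n := slab_sum n z1 sg x01.
have a2 n := lift_sum q1 n z1 nK.1 (bvnorm_ge0 nK) (ltW x0).
have s1 n : \sum_(k < n) nrm (z ^+ k.+1 * G (x + k.+1%:R)) <= B *+ Num.truncn q + 2 * (MK * q).
  apply: le_trans (lerD (a1 n) (a2 n)).
  by rewrite -big_split; apply: ler_sum => k _; rewrite mulrDr nrmD.
have big1 (k : nat) : 1 <= x + k.+1%:R.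
  by rewrite (@le_trans _ _ k.+1%:R) ?ler1n// lerDr ltW.
have E0 : glue f g K x + tail z G x = 0.
  have xq : x <= q by exact: ltW (lt_trans x1 q1).
  rewrite /glue /cut x01 (lift_small q1 _ xq) (g0 x) ?addr0; last first.
    by move=> /andP[h _]; have := lt_trans h x1; rewrite ltxx.
  have -> : tail z G x = tail z g x + transfer z K x.
    rewrite [LHS](_ : _ = csum (fun k => z ^+ k.+1 * g (x + k.+1%:R) + z ^+ k.+1 * lift K (x +
      k.+1%:R))).
      exact: csumD a1 a2.
    by apply: csum_eq => k; rewrite /G mulrDr.
  by rewrite fE//; ring.
have := @sum_shift z (glue f g K) G _ x s1; rewrite E0; apply => k.
by rewrite /glue /cut [_ < 1]ltNge big1 andbF add0r.
Qed.

Lemma zero_period_eq z F G : (forall t, 0 < t -> F t = G t) -> zero_period z F -> zero_period z G.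
Proof.
move=> FG; apply: ae_imp => x h x01; apply: ccvg_ext (h x01) => n.
by apply: eq_bigr => j _; rewrite FG// ltr_wpDr//; case/andP: x01.
Qed.

(** The flip exchanges the roles of f and K. *)
Lemma flip_glue f g K t : 0 < t -> flip q (glue f g K) t = glue K (flip q g) f t.
Proof.
move=> t0; rewrite [RHS]/glue -(flip_lift K t0) {1}/flip /glue /lift /flip; ring.
Qed.

Lemma glue_period_solution z e f g K Mf B T MK : nrm z = 1 -> nrm e = 1 -> bvnorm_le f Mf ->
  slab g B T ->
  bvnorm_le K MK ->
  (forall x, 0 < x < 1 -> f x = - tail z g x - transfer z K x) ->
  (forall x, 0 < x < 1 -> K x = - tail e (flip q g) x - transfer e f x) ->
  period_solution z e (glue f g K).
Proof.
move=> z1 e1 nf sg nK fE KE.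
have [Lf _] := L1_cut (bvnorm_L1 nf); have [LK _] := L1_cut (bvnorm_L1 nK).
have [LlK _] := cint_flip q0 LK; have Lg := slab_L1 sg.
have [B' [T' sg']] := slab_flip sg.
split; first by apply: L1D => //; exact: L1D.
  exact: glue_zero_period z1 sg nK fE.
apply: (zero_period_eq (F := glue K (flip q g) f)) => [t t0|]; first by rewrite flip_glue.
exact: glue_zero_period e1 sg' nf KE.
Qed.

Lemma glue_bv f g K Mf B T MK : bvnorm_le f Mf -> slab g B T -> bvnorm_le K MK ->
  exists S, bv Rplus (glue f g K) S.
Proof.
move=> nf [_ _ _ gT] nK; have Mf0 := bvnorm_ge0 nf; have MK0 := bvnorm_ge0 nK.
have b1 := bv_extend_itv Mf0 Mf0 nf.1 nf.2.
have b3 : bv setT (lift K) (MK * q + 2 * MK).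
  have MKq0 : 0 <= MK * q by rewrite mulr_ge0// ltW.
  apply: (@bv_extend_right _ _ q) => //; [exact: mulr_ge0|exact: lift_small| |exact: bvnorm_lift].
  move=> t qt; have t0 := lt_trans q0 qt; apply: (le_trans (lift_bound q1 nK.1 MK0 t0)).
  by rewrite ler_piMr// invf_le1 ?exprn_gt0// exprn_ege1// ltW// (lt_trans q1).
by eexists; exact: (bv_sub (@subsetT _ Rplus) (bvD (bvD b1 gT) b3)).
Qed.

(** Eliminating K from the two equations of [glue_period_solution] leaves f = w
    + double_transfer z e f. If z = e = 1, the integral of w vanishes because
    tail, transfer and flip preserve integrals. *)
Lemma slab_extension z e g B T : nrm z = 1 -> nrm e = 1 -> slab g B T ->
  exists F S, [/\ period_solution z e F, bv Rplus F S & forall t, 1 < t < q -> F t = g t].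
Proof.
move=> z1 e1 sg; have [B' [T' sg']] := slab_flip sg.
have [M1 n1] := bvnorm_tail z1 sg; have [M2 n2] := bvnorm_tail e1 sg'.
have [M3 n3] := transfer_bvnorm q1 z1 n2.
pose w x := transfer z (tail e (flip q g)) x + -1 * tail z g x.
have nw := bvnormD n3 (bvnormZ (-1) n1).
have [|f [Mf [nf fE]]] := equation_solvable z1 e1 nw.
  move=> zE eE; rewrite zE eE in n1 n2 n3 *.
  rewrite cintD//; [|exact: bvnorm_L1 n3|exact: bvnorm_L1 (bvnormZ (-1) n1)].
  rewrite cintZ//; last exact: bvnorm_L1 n1.
  rewrite (cint_transfer q1 n2) (cint_tail_slab sg) (cint_tail_slab sg').
  by rewrite (cint_flip q0 (slab_L1 sg)).2 mulN1r subrr.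
have [M4 n4] := transfer_bvnorm q1 e1 nf.
pose K x := -1 * tail e (flip q g) x + -1 * transfer e f x.
have nK := bvnormD (bvnormZ (-1) n2) (bvnormZ (-1) n4).
have [S bS] := glue_bv nf sg nK.
exists (glue f g K), S; split=> //; last exact: glue_mid.
apply: (glue_period_solution z1 e1 nf sg nK) => x x01; last by rewrite /K !mulN1r.
have x0 : 0 <= x by case/andP: x01 => /ltW.
have a := bvnormZ (-1) n2; have b := bvnormZ (-1) n4.
rewrite (transferD q1 z1 (bvnorm_ge0 a) (bvnorm_ge0 b) a.1 b.1 x0).
rewrite (transferZ q1 (-1) z1 (bvnorm_ge0 n2) n2.1 x0) (transferZ q1 (-1) z1 (bvnorm_ge0 n4) n4.1
  x0).
rewrite fE//; rewrite /double_transfer; ring.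
Qed.

Lemma BV_slab v : BV I1q v -> exists g B T, slab g B T /\ eq_ae I1q v g.
Proof.
move=> /BVP[Lv [g [T [vg gT]]]].
have IE t : `]1, q[%classic t = (1 < t < q) :> Prop by rewrite /= in_itv.
have mid : I1q ((1 + q) / 2) by rewrite IE; apply/andP; split; have := q1; lra.
have T0 : 0 <= T by case: gT => phi pb _; have /andP[] := pb _ mid; lra.
have [M M0 gM] := bv_bounded mid gT.
have gM' x : 1 < x < q -> nrm (g x) <= M by move=> h; apply: gM; rewrite IE.
have b := bv_extend_itv M0 T0 gM' gT.
exists (fun x => if 1 < x < q then g x else 0), M, (2 * M + T); split; first split=> //.
- by move=> t /negP/negbTE ->.
- by move=> t; case: ifP => [h|_]; [exact: gM'|rewrite nrm0].
- by apply: ae_imp vg => x h; rewrite IE => x1q; rewrite x1q h// IE.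
Qed.

Lemma zero_period_lin z F G (c : R[i]) : zero_period z F -> zero_period z G ->
  zero_period z (fun x => F x + c * G x).
Proof.
apply: ae_imp2 => x h1 h2 x01; have := ccvgD (h1 x01) (ccvgMl c (h2 x01)).
rewrite mulr0 addr0; apply: ccvg_ext => n; rewrite mulr_sumr -big_split/=.
by apply: eq_bigr => j _; ring.
Qed.

Lemma period_solution_lin z e F G (c : R[i]) : period_solution z e F -> period_solution z e G ->
  period_solution z e (fun x => F x + c * G x).
Proof.
move=> [a1 a2 a3] [b1 b2 b3]; split; first by apply: L1D => //; exact: L1Z.
  exact: zero_period_lin.
apply: (zero_period_eq (F := fun x => flip q F x + c * flip q G x)); last exact: zero_period_lin.
by move=> t _; rewrite /flip; ring.
Qed.

(** As D vanishes on (1,q), the flip of D agrees with lift g on (1,oo). So its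
    periodization condition identifies it with K on (0,1), whence D agrees with
    lift K on (1,oo), and the periodization condition of D is the other
    equation. *)
Lemma homogeneous_equations z e D g T : nrm z = 1 -> nrm e = 1 -> period_solution z e D ->
  eq_ae Rplus D g ->
  bv Rplus g T -> eq_ae I1q D (fun=> 0) ->
  exists K M N, [/\ bvnorm_le g M, bvnorm_le K N,
    {ae mu, forall x, 0 < x < 1 -> g x = - transfer z K x} /\
    {ae mu, forall x, 0 < x < 1 -> K x = - transfer e g x} &
    {ae mu, forall x, 0 < x < 1 -> g x = 0} -> {ae mu, forall x, 0 < x < 1 -> K x = 0} ->
    eq_ae Rplus D (fun=> 0)].
Proof.
move=> z1 e1 [LD D1 D2] Dg gT D0.
have IE t : `]1, q[%classic t = (1 < t < q) :> Prop by rewrite /= in_itv.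
have [M M0 gM] : exists2 M, 0 <= M & forall x, Rplus x -> nrm (g x) <= M.
  by apply: (@bv_bounded _ _ _ _ 1 _ gT); rewrite RplusE.
have UD : U `<=` Rplus by move=> x; rewrite UE RplusE => /andP[].
have ng : bvnorm_le g (Num.max M T).
  split; first by move=> x /andP[x0 _]; rewrite le_max gM// RplusE.
  by apply: (@bv_le _ _ _ T); [rewrite le_max lexx orbT|exact: bv_sub gT].
have [N nN] := transfer_bvnorm q1 e1 ng.
pose K x := -1 * transfer e g x; have nK := bvnormZ (-1) nN.
have g0 := bvnorm_ge0 ng; have K0 := bvnorm_ge0 nK.
(* If t > 1, then q / t lies either in (0,1), where D is g, or in (1,q), where
   D vanishes. *)
have ptD : {ae mu, forall x, 0 < x -> x != 1 -> (0 < x < 1 -> D x = g x) /\ (1 < x < q ->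
  D x = 0)}.
  apply: ae_imp2 Dg D0 => x h1 h2 x0 _; split=> [_|x1q]; first by apply: h1; rewrite RplusE.
  by apply: h2; rewrite IE.
have qdiv (t : R) : 0 < t -> 1 < t -> t != q -> (0 < q / t < 1 /\ q < t) \/ 1 < q / t < q.
  move=> t0 t1 tq; have [h|h] := ltP q t.
    by left; rewrite divr_gt0//= ltr_pdivrMr// mul1r.
  right; rewrite ltr_pdivlMr// mul1r lt_neqAle tq h/=.
  by rewrite ltr_pdivrMr// ltr_pMr.
have fD : {ae mu, forall t, 0 < t -> 1 < t -> flip q D t = lift g t}.
  have := negligible_recip q0 ptD; apply: ae_imp2 (ae_neq q) => t tq h t0 t1.
  have n1 : q / t != 1 by apply: contra_neq tq => h'; rewrite -[t]mul1r -h' divfK ?gt_eqF.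
  have [a b] := h t0 n1; rewrite {1}/flip.
  have [[c qt]|c] := qdiv t t0 t1 tq; first by rewrite a// lift_large.
  have tq' : t <= q by rewrite leNgt; apply/negP => qt; move: c => /andP[c _];
    move: c; rewrite ltr_pdivlMr// mul1r ltNge (ltW qt).
  by rewrite b// mulr0 (lift_small q1 _ tq').
have big1 (x : R) (k : nat) : 0 < x -> 1 < x + k.+1%:R.
  by move=> x0; rewrite (@le_lt_trans _ _ k.+1%:R) ?ler1n// ltrDr.
have fK : {ae mu, forall x, 0 < x < 1 -> flip q D x = K x}.
  apply: ae_imp2 D2 (negligible_shift fD) => x h1 h2 x01; have /andP[x0 x1] := x01.
  have := @sum_shift e (flip q D) (lift g) _ x
    (fun n => lift_sum q1 n e1 ng.1 g0 (ltW x0)) (fun k => h2 x0 k.+1 (big1 x k x0)).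
  move=> c; have := ccvg_unique c (h1 x01) => E.
  by rewrite /K mulN1r; apply/eqP; rewrite -addr_eq0; apply/eqP.
have DK : {ae mu, forall t, 0 < t -> 1 < t -> D t = lift K t}.
  have fK' : {ae mu, forall x, 0 < x -> x != 1 ->
     (0 < x < 1 -> flip q D x = K x) /\ (1 < x < q -> flip q D x = lift g x)}.
    by apply: ae_imp2 fK fD => x h1 h2 x0 _; split=> [|/andP[? _]]; [exact: h1|exact: h2].
  have := negligible_recip q0 fK'; apply: ae_imp2 (ae_neq q) => t tq h t0 t1.
  have n1 : q / t != 1 by apply: contra_neq tq => h'; rewrite -[t]mul1r -h' divfK ?gt_eqF.
  have [a b] := h t0 n1; rewrite -[LHS](@flipK _ q) ?gt_eqF// {1}/flip.
  have [[c qt]|c] := qdiv t t0 t1 tq; first by rewrite a// lift_large.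
  have tq' : t <= q by rewrite leNgt; apply/negP => qt; move: c => /andP[c _];
    move: c; rewrite ltr_pdivlMr// mul1r ltNge (ltW qt).
  have qtq : q / t <= q by case/andP: c => _ /ltW.
  by rewrite b// (lift_small q1 _ qtq) mulr0 (lift_small q1 _ tq').
have Dgz : {ae mu, forall x, 0 < x < 1 -> g x = - transfer z K x}.
  apply: ae_imp3 D1 (negligible_shift DK) Dg => x h1 h2 h3 x01; have /andP[x0 x1] := x01.
  have := @sum_shift z D (lift K) _ x
    (fun n => lift_sum q1 n z1 nK.1 K0 (ltW x0)) (fun k => h2 x0 k.+1 (big1 x k x0)).
  move=> c; have := ccvg_unique c (h1 x01) => E.
  by rewrite -h3 ?RplusE//; apply/eqP; rewrite -addr_eq0; apply/eqP.
exists K; do 2 eexists; split; [exact: ng|exact: nK| |].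
  by split=> //; apply: aeW => x _; rewrite /K mulN1r.
move=> gz Kz.
have Kz' : {ae mu, forall x, 0 < x -> 0 < x < 1 -> K x = 0} by apply: ae_imp Kz => x h _.
have L0 : {ae mu, forall t, 0 < t -> lift K t = 0}.
  apply: ae_imp (negligible_recip q0 Kz') => t h t0; have [tq|qt] := leP t q.
    exact: lift_small.
  by rewrite lift_large// h ?mulr0// divr_gt0//= ltr_pdivrMr// mul1r.
have gz' : {ae mu, forall x, 0 < x < 1 -> D x = 0}.
  by apply: ae_imp2 Dg gz => x h1 h2 x01; rewrite h1 ?h2// RplusE; case/andP: x01.
have big : {ae mu, forall x, 1 < x -> D x = 0}.
  apply: ae_imp2 DK L0 => x h1 h2 x1; have x0 : 0 < x by exact: lt_trans x1.
  by rewrite h1// h2.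
apply: ae_imp3 gz' big (ae_neq 1) => x h1 h2 x1; rewrite RplusE => x0.
have [lt|ge] := ltP x 1; first by apply: h1; rewrite x0.
by apply: h2; rewrite lt_neqAle eq_sym x1.
Qed.

Lemma bvnorm_mass0 f M : bvnorm_le f M -> mass f = 0 -> {ae mu, forall x, 0 < x < 1 -> f x = 0}.
Proof.
move=> nf m0; have iff := bvnorm_integrable nf.
have fin : (\int[mu]_(x in U) (nrm (f x))%:E)%E \is a fin_num by exact: integrable_fin_num iff.
have I0 : (\int[mu]_(x in U) `|(nrm (f x))%:E| = 0)%E.
  transitivity (\int[mu]_(x in U) (nrm (f x))%:E)%E.
    by apply: eq_integral => x _ /=; rewrite ger0_norm ?nrm_ge0.
  by rewrite -(fineK fin); congr EFin; exact: m0.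
have := (ae_eq_integral_abs mu mU (measurable_int _ iff)).1 I0.
by apply: ae_imp => x h x01; apply: nrm_eq0; have := h; rewrite UE => /(_ x01) /= [].
Qed.

Lemma homogeneous_unique z e D g T : nrm z = 1 -> nrm e = 1 -> period_solution z e D ->
  eq_ae Rplus D g ->
  bv Rplus g T -> eq_ae I1q D (fun=> 0) ->
  eq_ae Rplus D (fun=> 0) \/ [/\ z = 1, e = 1 & cintegral U D <> 0].
Proof.
move=> z1 e1 sD Dg gT D0.
have [K [M [N [ng nK [h1 h2] h3]]]] := homogeneous_equations z1 e1 sD Dg gT D0.
have [[m1 m2]|[zE eE I0]] := kernel_dichotomy q1 z1 e1 ng nK h1 h2.
  by left; apply: h3; [exact: bvnorm_mass0 ng m1|exact: bvnorm_mass0 nK m2].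
right; split=> //.
have UD : U `<=` Rplus by move=> x; rewrite UE RplusE => /andP[].
have [[a b] _ _] := sD.
have LU : L1 U D by split; [exact: integrableS a|exact: integrableS b].
rewrite (cint_ae mU LU (bvnorm_L1 ng))//.
by apply: ae_imp Dg => x h /UD; exact: h.
Qed.

(** The equation f = 1 + double_transfer 1 1 f has no solution, as integrating
    it gives 0 = 1. So the alternative provides a fixed point, which is glued
    to 0 on (1,q). *)
Lemma vanishing_solution : exists F S, [/\ period_solution 1 1 F, bv Rplus F S, forall t,
  1 < t < q -> F t = 0 &
  cintegral U F <> 0].
Proof.
have n1 : bvnorm_le (fun=> 1 : R[i]) 1.
  split; first by move=> x _; rewrite nrm1.
  by apply: (@bv_le _ _ _ 0) => //; exists (fun=> 0) => [x _|x y _ _ _];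
    rewrite ?lexx// !subrr nrm0.
have i1 : cintegral U (fun=> 1 : R[i]) = 1.
  by apply: complex_eq; rewrite /= ?RintC ?subr0 ?mul1r ?mul0r.
have [[f [M [nf fE]]]|[g [M [ng mg gE _]]]] := fredholm_alternative q1 (nrm1 R) (nrm1 R) n1.
  exfalso; have [N nN] := double_transfer_bvnorm q1 (nrm1 R) (nrm1 R) nf.
  have : cintegral U f = 1 + cintegral U f.
    transitivity (cintegral U (fun x => 1 + double_transfer 1 1 f x)).
      by apply: cint_eq => x; rewrite UE; exact: fE.
    have := @cintD _ _ (fun=> 1) (double_transfer 1 1 f) mU (bvnorm_L1 n1) (bvnorm_L1 nN).
    by rewrite i1 (cint_double_transfer q1 nf).
  by move/eqP; rewrite -subr_eq0 opprD addrCA subrr addr0 oppr_eq0 oner_eq0.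
have [N nN] := transfer_bvnorm q1 (nrm1 R) ng.
pose K x := -1 * transfer 1 g x; have nK := bvnormZ (-1) nN.
have s0 : slab (fun=> 0) 0 0.
  by split=> // [t|]; [rewrite nrm0|exact: bv0].
have t0 z h x : (forall x, h x = 0) -> tail z h x = 0.
  move=> h0; apply: csumE; apply: (@ccvg_ext _ (fun=> 0)); last by split; exact: cvg_cst.
  by move=> n; rewrite /psum big1// => k _; rewrite h0 mulr0.
have gK x : 0 < x < 1 -> g x = - transfer 1 K x.
  move=> x01; rewrite gE// /K (transferZ q1 (-1) (nrm1 R) (bvnorm_ge0 nN) nN.1).
    by rewrite mulN1r opprK.
  by case/andP: x01 => /ltW.
have [S bS] := glue_bv ng s0 nK.
exists (glue g (fun=> 0) K), S; split=> //.
- apply: (glue_period_solution (nrm1 R) (nrm1 R) ng s0 nK) => x x01.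
    by rewrite t0// oppr0 add0r; exact: gK.
  by rewrite t0 ?oppr0 ?add0r /K ?mulN1r// => y; rewrite /flip mulr0.
- exact: glue_mid.
have -> : cintegral U (glue g (fun=> 0) K) = cintegral U g.
  apply: cint_eq => x; rewrite UE => x01; have /andP[x0 x1] := x01.
  by rewrite /glue /cut x01 (lift_small q1) ?addr0//; exact: ltW (lt_trans x1 q1).
have gK' : {ae mu, forall x, 0 < x < 1 -> g x = - transfer 1 K x} by exact: aeW.
have Kg : {ae mu, forall x, 0 < x < 1 -> K x = - transfer 1 g x}.
  by apply: aeW => x _; rewrite /K mulN1r.
have [[m0 _]|[]//] := kernel_dichotomy q1 (nrm1 R) (nrm1 R) ng nK gK' Kg.
by move: mg; rewrite m0 => /eqP; rewrite eq_sym oner_eq0.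
Qed.

End assembly.

(** * Integrals against the image of a density *)

Section charge_integrals.
Context d d' (X : measurableType d) (T : measurableType d') (R : realType).

Definition bounded_measurable (u : T -> R) := measurable_fun [set: T] u /\ exists C : R,
  forall x, `|u x| <= C.

Lemma bounded_measurable_indic (B : set T) : measurable B -> bounded_measurable (\1_B : T -> R).
Proof.
move=> mB; split; first exact: measurable_indic.
by exists 1 => x; rewrite indicE; case: (_ \in _); rewrite ?normr1 ?normr0.
Qed.

Lemma bounded_measurable_lin (a : R) u v : bounded_measurable u -> bounded_measurable v ->
  bounded_measurable (fun x => a * u x + v x).
Proof.
move=> [mu [C uC]] [mv [D vD]]; split.
  by apply: measurable_funD => //; exact: measurable_funM.
exists (`|a| * C + D) => x; rewrite (le_trans (ler_normD _ _))// lerD// normrM.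
by rewrite ler_wpM2l.
Qed.

(** The sum is the integer part of y, as long as this is at most N. *)
Lemma level_count (y : R) N : 0 <= y ->
  (N%:R <= y -> \sum_(j < N) ((nat_of_bool (j.+1%:R <= y)%R)%:R : R) = N%:R) /\
  (y <= N%:R -> y - 1 <= \sum_(j < N) ((nat_of_bool (j.+1%:R <= y)%R)%:R : R) <= y).
Proof.
move=> y0; elim: N => [|N [IH1 IH2]].
  by rewrite big_ord0; split=> // yl; apply/andP; split; lra.
rewrite big_ord_recr/= -natr1; split=> [Ny|yN].
  by rewrite IH1 ?Ny//; lra.
have [le|lt] := leP (N%:R + 1) y.
  by rewrite /= IH1; [apply/andP; split; lra|lra].
rewrite addr0; have [Ny|/ltW yN'] := leP N%:R y; last exact: IH2.
by rewrite IH1//; apply/andP; split; lra.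
Qed.

(** A function with values in [0,1] is within 1 / N of the average of the
    indicators of N of its level sets; an affine change reduces the general
    case to this one. *)
Lemma linear_indicator_zero (H : (T -> R) -> R) (C : R) :
  (forall a u v, bounded_measurable u -> bounded_measurable v ->
    H (fun x => a * u x + v x) = a * H u + H v) ->
  (forall u e, bounded_measurable u -> (forall x, `|u x| <= e) -> `|H u| <= C * e) ->
  (forall B, measurable B -> H (\1_B : T -> R) = 0) ->
  forall u, bounded_measurable u -> H u = 0.
Proof.
move=> lin bdd ind.
have b0 : bounded_measurable (fun=> 0 : R) by split; [exact: measurable_cst|exists 0 => x;
  rewrite normr0].
have H0 : H (fun=> 0) = 0.
  have := lin 1 (fun=> 0) (fun=> 0) b0 b0.
  have -> : (fun x : T => 1 * 0 + 0 : R) = fun=> 0 by apply/funext => x; rewrite mulr0 addr0.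
  by rewrite mul1r => /eqP; rewrite -subr_eq0 opprD addrA subrr add0r oppr_eq0 => /eqP.
have unit v : bounded_measurable v -> (forall x, 0 <= v x <= 1) -> H v = 0.
  move=> bv v01; apply/eqP; rewrite -normr_eq0 eq_le normr_ge0 andbT.
  apply/ler_addgt0Pr => e e0; rewrite add0r.
  have [N [N1 CN]] := ex_small_quotient (normr_ge0 C) e0.
  have N0 : 0 < N%:R :> R by rewrite ltr0n ltnW.
  pose B j := [set x | j.+1%:R <= N%:R * v x].
  have mB j : measurable (B j).
    rewrite -[B j]setTI; apply: measurable_fun_le => //.
    by apply: measurable_funM => //; exact: bv.1.
  have gP m : bounded_measurable (fun x => \sum_(j < m) (\1_(B j) x : R)) /\
      H (fun x => \sum_(j < m) (\1_(B j) x : R)) = 0.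
    elim: m => [|m [IH1 IH2]].
      by rewrite (_ : (fun x => _) = fun=> 0)//; apply/funext => x; rewrite big_ord0.
    rewrite (_ : (fun x => _) = fun x => 1 * (\1_(B m) x : R) + \sum_(j < m) (\1_(B j) x : R)).
      split; first by apply: bounded_measurable_lin => //; exact: bounded_measurable_indic.
      by rewrite lin ?ind ?IH2 ?mulr0 ?addr0//; exact: bounded_measurable_indic.
    by apply/funext => x; rewrite big_ord_recr/= mul1r addrC.
  have [bg Hg] := gP N.
  have E : H v = H (fun x => (- N%:R^-1) * \sum_(j < N) (\1_(B j) x : R) + v x).
    by rewrite lin// Hg mulr0 add0r.
  rewrite E; apply: le_trans CN; apply: (@le_trans _ _ (C * N%:R^-1)).
    apply: bdd; first exact: bounded_measurable_lin.
    move=> x; have /andP[v0 v1] := v01 x; have y0 : 0 <= N%:R * v x by rewrite mulr_ge0.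
    have yN : N%:R * v x <= N%:R by rewrite ler_piMr.
    have [_ /(_ yN)] := level_count N y0.
    have -> : \sum_(j < N) ((nat_of_bool (j.+1%:R <= N%:R * v x)%R)%:R :
      R) = \sum_(j < N) (\1_(B j) x : R).
      apply: eq_bigr => j _; rewrite indicE; congr (nat_of_bool _)%:R.
      by apply/idP/idP => h; [rewrite mem_set|move/set_mem: h].
    move: (\sum_(j < N) _) => s /andP[s1 s2].
    have -> : - N%:R^-1 * s + v x = (N%:R * v x - s) / N%:R by field; rewrite gt_eqF.
    rewrite normrM [X in _ * X]ger0_norm ?invr_ge0 ?ler0n// -[leRHS]mul1r.
    by rewrite ler_wpM2r ?invr_ge0 ?ler0n// ger0_norm; lra.
  by rewrite ler_wpM2r ?invr_ge0 ?ler0n// ler_norm.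
move=> u bu; have [mu [M uM]] := bu.
pose M' := `|M| + 1; have M0 : 0 < M' by rewrite ltr_wpDl.
have uM' x : `|u x| <= M' by rewrite (le_trans (uM x))// (le_trans (ler_norm _))// lerDl.
have bT : bounded_measurable (\1_[set: T] : T -> R) by exact: bounded_measurable_indic.
pose v x := (2 * M')^-1 * u x + 2^-1 * (\1_[set: T] x : R).
have E1 x : (\1_[set: T] x : R) = 1 by rewrite indicT.
have bh : bounded_measurable (fun x => 2^-1 * (\1_[set: T] x :
  R) + 0) by exact: bounded_measurable_lin.
have bh' : bounded_measurable (fun x => 2^-1 * (\1_[set: T] x : R)).
  by rewrite (_ : (fun x => _) = fun x => 2^-1 * (\1_[set: T] x : R) + 0)//; apply/funext => x;
    rewrite addr0.
have bv : bounded_measurable v by exact: bounded_measurable_lin.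
have v0 : H v = 0.
  apply: unit => // x; rewrite /v E1 mulr1.
  have := uM' x; rewrite ler_norml => /andP[l1 l2].
  have i0 : 0 < (2 * M')^-1 by rewrite invr_gt0 mulr_gt0.
  have hM : (2 * M')^-1 * M' = 2^-1 by field; rewrite gt_eqF.
  have a1 : (2 * M')^-1 * u x <= (2 * M')^-1 * M' by rewrite ler_pM2l.
  have a2 : (2 * M')^-1 * (- M') <= (2 * M')^-1 * u x by rewrite ler_pM2l.
  by move: a1 a2; rewrite mulrN hM => a1 a2; apply/andP; split; lra.
have Hh : H (fun x => 2^-1 * (\1_[set: T] x : R)) = 0.
  have := lin 2^-1 (\1_[set: T]) (fun=> 0) bT b0; rewrite ind// H0 mulr0 addr0.
  by rewrite (_ : (fun x => _ + 0) = fun x => 2^-1 * (\1_[set: T] x : R))//; apply/funext => x;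
    rewrite addr0.
have := lin (2 * M')^-1 u _ bu bh'; rewrite -/v v0 Hh addr0 => /esym/eqP.
by rewrite mulf_eq0 invr_eq0 mulf_eq0 pnatr_eq0/= (gt_eqF M0)/= => /eqP.
Qed.

Lemma bounded_measurable_integrable (m : {finite_measure set T -> \bar R}) u :
  bounded_measurable u ->
  m.-integrable [set: T] (EFin \o u).
Proof.
move=> [mu [C uC]]; apply: measurable_bounded_integrable => //.
  by apply: fin_num_fun_lty; exact: fin_num_measure.
by exists C; split; [exact: num_real|move=> x Cx y _; rewrite /= (le_trans (uC y))// ltW].
Qed.

(** Both sides are linear in u and continuous for the supremum norm, and for an
    indicator u the equality is the Jordan decomposition of nu. This settles
    the value of [charge_integral] whichever Hahn decomposition its definition
    picks. *)
Lemma charge_integral_density (mu : {measure set X -> \bar R}) (phi : X -> T) (h : X -> R)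
    (nu : {charge set T -> \bar R}) u :
  measurable_fun [set: X] phi -> mu.-integrable [set: X] (EFin \o h) ->
  (forall A, measurable A -> nu A = (\int[mu]_(x in phi @^-1` A) (h x)%:E)%E) ->
  bounded_measurable u -> charge_integral nu u = Rintegral mu setT (fun x => u (phi x) * h x).
Proof.
move=> mphi ih nuE bu; apply/eqP; rewrite -subr_eq0; apply/eqP; move: u bu.
have mh : measurable_fun [set: X] h by exact/measurable_EFinP/(measurable_int _ ih).
have iph u : bounded_measurable u -> mu.-integrable [set: X] (EFin \o (fun x => u (phi x) * h x)).
  move=> [mu_ [C uC]]; have iC := integrableZl measurableT C ih.
  apply: le_integrable iC => //.
    by apply/measurable_EFinP; apply: measurable_funM => //; exact: measurableT_comp.
  move=> x _ /=; rewrite lee_fin !normrM ler_wpM2r// (le_trans (uC _))// ler_norm//.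
rewrite /charge_integral.
set nuPN := projT2 (cid (projT2 (cid (Hahn_decomposition nu)))).
pose p : {finite_measure set T -> \bar R} := jordan_pos nuPN.
pose n : {finite_measure set T -> \bar R} := jordan_neg nuPN.
pose I := Rintegral mu setT (fun x => `|h x|).
have I0 : 0 <= I by apply: Rintegral_ge0.
have boundT (m : {finite_measure set T -> \bar R}) u e : bounded_measurable u -> (forall x,
  `|u x| <= e) ->
    `|Rintegral m setT u| <= fine (m setT) * e.
  move=> bu ue; have iu := bounded_measurable_integrable m bu.
  apply: le_trans (le_normr_Rintegral measurableT iu) _.
  have be : bounded_measurable (fun=> e) by split; [exact: measurable_cst|exists `|e|].
  have ie := bounded_measurable_integrable m be.
  rewrite mulrC -Rintegral_cst//; apply: le_Rintegral => //; exact: integrable_norm iu.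
apply: (@linear_indicator_zero _ (fine (p setT) + fine (n setT) + I)).
- move=> a u v bu bv.
  have L (m : {finite_measure set T -> \bar R}) :
     Rintegral m setT (fun x => a * u x + v x) = a * Rintegral m setT u + Rintegral m setT v.
    have iu := bounded_measurable_integrable m bu; have iv := bounded_measurable_integrable m bv.
    have iau : m.-integrable [set: T] (EFin \o (fun x => a * u x)).
      exact: (@integrableZl _ _ _ m setT measurableT a (EFin \o u) iu).
    by rewrite (RintegralD measurableT iau iv) RintegralZl.
  have iau : mu.-integrable [set: X] (EFin \o (fun x => a * (u (phi x) * h x))).
    exact: (@integrableZl _ _ _ mu setT measurableT a _ (iph u bu)).
  have -> : Rintegral mu setT (fun x => (a * u (phi x) + v (phi x)) * h x) =
     a * Rintegral mu setT (fun x => u (phi x) * h x) + Rintegral mu setT (fun x => v (phi x) * h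
       x).
    rewrite -(RintegralZl a measurableT (iph u bu)) -(RintegralD measurableT iau (iph v bv)).
    by apply: eq_Rintegral => x _; rewrite mulrDl mulrA.
  by rewrite (L p) (L n); ring.
- move=> u e bu ue.
  have b1 := boundT p u e bu ue; have b2 := boundT n u e bu ue.
  have b3 : `|Rintegral mu setT (fun x => u (phi x) * h x)| <= I * e.
    apply: le_trans (le_normr_Rintegral measurableT (iph u bu)) _.
    have ia : mu.-integrable [set: X] (EFin \o (fun x => `|h x|)) by exact: integrable_norm ih.
    rewrite mulrC -(RintegralZl e measurableT ia); apply: le_Rintegral => //.
    + exact: integrable_norm (iph u bu).
    + exact: (@integrableZl _ _ _ mu setT measurableT e _ ia).
    + by move=> x _; rewrite normrM ler_wpM2r.
  apply: (le_trans (ler_normB _ _)); rewrite !mulrDl lerD//.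
  by apply: (le_trans (ler_normB _ _)); rewrite lerD.
- move=> B mB.
  have e1 (m : {finite_measure set T -> \bar R}) : Rintegral m setT (\1_B : T -> R) = fine (m B).
    by rewrite /Rintegral integral_indic// setIT.
  have mphB : measurable (phi @^-1` B) by rewrite -[_ @^-1` _]setTI; exact: mphi.
  have e2 : Rintegral mu setT (fun x => (\1_B (phi x) : R) * h x) = fine (nu B).
    rewrite nuE// /Rintegral [in RHS]integral_mkcond; congr fine; apply: eq_integral => x _.
    rewrite patchE indicE; case: ifPn => [/set_mem h1|/negP h1].
      by rewrite mem_set// mul1r.
    by rewrite memNset ?mul0r// => h2; apply: h1; rewrite mem_set.
  have nuB : nu B = (p B - n B)%E by rewrite (jordan_decomp nuPN mB) /cadd/= cscaleN1.
  rewrite (e1 p) (e1 n) e2 nuB fineB ?subrr//.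
  + exact: (fin_num_measure p).
  + exact: (fin_num_measure n).
Qed.

End charge_integrals.

(** * Measures on the hyperbola *)

Section hyperbola.
Context (R : realType).
Local Notation mu := (@lebesgue_measure R).

Definition hyperbola (t : measurableTypeR R) : plane R := (t, t^-1).

Lemma measurable_hyperbola : measurable_fun setT hyperbola.
Proof.
apply: measurable_fun_pair; first exact: measurable_id.
exact: measurable_inv.
Qed.

Definition hyperbola_charge (h : R -> R)
  (ih : mu.-integrable [set: measurableTypeR R] (EFin \o h)) :
  {charge set (plane R) -> \bar R}.
Proof.
unshelve refine (pushforward (induced_charge ih) hyperbola : {charge set _ -> \bar _}).
exact: measurable_hyperbola.
Defined.

Lemma hyperbola_chargeE h (ih : mu.-integrable [set: measurableTypeR R] (EFin \o h)) A :
  hyperbola_charge ih A = (\int[mu]_(x in hyperbola @^-1` A) (h x)%:E)%E.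
Proof. by []. Qed.

(** The parametrization t -> (t, 1 / t) has speed at least 1. *)
Lemma arc_length_null (A : set (plane R)) : measurable A -> arc_length Gamma_plus A = 0%E ->
  mu (hyperbola @^-1` A `&` Rplus) = 0%E.
Proof.
move=> mA; set E := hyperbola @^-1` A `&` Rplus.
have mD : measurable (Rplus : set (measurableTypeR R)) by exact: measurable_itv.
have mE : measurable (E : set (measurableTypeR R)).
  by apply: measurableI => //; rewrite -[_ @^-1` _]setTI; exact: measurable_hyperbola.
have inv' (x : R) : x != 0 -> derive1 (fun t : R => t^-1) x = - x ^- 2.
  move=> x0; rewrite derive1E (@deriveV R R id x 1 x0 (@derivable_id R R x 1)).
  by rewrite derive_id /GRing.scale/= mulr1.
have id' (x : R) : derive1 (fun t : R => t) x = 1 by rewrite derive1E derive_id.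
have -> : arc_length Gamma_plus A =
    (\int[mu]_(t in E) (Num.sqrt (1 + (- t ^- 2) ^+ 2))%:E)%E.
  rewrite /arc_length /=.
  have -> : [set t : R | t \in `]0, +oo[ /\ A (t, t^-1)] = E.
    by apply/seteqP; split=> t /= [a b]; split.
  apply: eq_integral => t /set_mem [_]; rewrite RplusE => t0.
  by rewrite id' inv' ?gt_eqF// expr1n.
have ms : measurable_fun E (fun t => (Num.sqrt (1 + (- t ^- 2) ^+ 2))%:E).
  apply/measurable_EFinP; apply: measurable_funTS.
  apply: (measurableT_comp (continuous_measurable_fun (@sqrt_continuous R))).
  apply: measurable_funD => //; apply: measurable_funX; apply: measurableT_comp => //.
  have -> : (fun t : R => t ^- 2) = (fun t : R => (t^-1) ^+ 2) by apply/funext => t;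
    rewrite exprVn.
  by apply: measurable_funX; exact: measurable_inv.
move=> I0; apply/eqP; rewrite eq_le measure_ge0 andbT -I0.
rewrite -[leLHS]mul1e -integral_cst//; apply: ge0_le_integral => //.
move=> t _; rewrite lee_fin -[leLHS]sqrtr1 ler_wsqrtr// lerDl sqr_ge0//.
Qed.

Lemma restr_int (h : R -> R) : mu.-integrable Rplus (EFin \o h) ->
  mu.-integrable [set: measurableTypeR R] (EFin \o (h \_ Rplus)).
Proof.
move=> ih; have mD : measurable (Rplus : set R) by exact: measurable_itv.
have := (@integrable_mkcond _ _ _ mu Rplus (EFin \o h) mD).1 ih.
by apply: eq_integrable => // x _; rewrite /= !patchE; case: ifP.
Qed.

Lemma hyperbola_supported (h : R -> R) (ih : mu.-integrable Rplus (EFin \o h)) A :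
  measurable A -> A `&` curve_image Gamma_plus = set0 -> hyperbola_charge (restr_int ih) A = 0%E.
Proof.
move=> mA A0; rewrite hyperbola_chargeE; apply: integral0_eq => t At.
rewrite patchE memNset// => /= tp; have : (A `&` curve_image Gamma_plus) (hyperbola t).
  by split=> //; exists t.
by rewrite A0.
Qed.

Lemma hyperbola_abs_continuous (h : R -> R) (ih : mu.-integrable Rplus (EFin \o h)) A :
  measurable A -> arc_length Gamma_plus A = 0%E -> hyperbola_charge (restr_int ih) A = 0%E.
Proof.
move=> mA A0; have N0 := arc_length_null mA A0.
have mD : measurable (Rplus : set (measurableTypeR R)) by exact: measurable_itv.
have mpA : measurable (hyperbola @^-1` A).
  by rewrite -[_ @^-1` _]setTI; exact: measurable_hyperbola.
rewrite hyperbola_chargeE.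
transitivity (\int[mu]_(x in hyperbola @^-1` A) ((EFin \o h) \_ Rplus) x)%E.
  by apply: eq_integral => x _; rewrite /= !patchE; case: ifP.
rewrite -integral_mkcondr; apply: null_set_integral => //.
  exact: measurableI.
apply: measurable_funS (measurable_int _ ih) => //.
Qed.

Lemma bounded_measurable_trig (z : R * R) :
  bounded_measurable (fun p : plane R => complex.Re (expipi (p.1 * z.1 + p.2 * z.2))) /\
  bounded_measurable (fun p : plane R => complex.Im (expipi (p.1 * z.1 + p.2 * z.2))).
Proof.
have ml : measurable_fun [set: plane R] (fun p : plane R => pi * (p.1 * z.1 + p.2 * z.2)).
  have m1 := @measurable_fst _ _ (measurableTypeR R) (measurableTypeR R).
  have m2 := @measurable_snd _ _ (measurableTypeR R) (measurableTypeR R).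
  by apply: measurable_funM => //; apply: measurable_funD; apply: measurable_funM.
split; split.
- exact: (measurableT_comp (continuous_measurable_fun (@continuous_cos R)) ml).
- by exists 1 => p /=; rewrite ler_norml cos_geN1 cos_le1.
- exact: (measurableT_comp (continuous_measurable_fun (@continuous_sin R)) ml).
- by exists 1 => p /=; rewrite ler_norml sin_geN1 sin_le1.
Qed.

Definition hyperbola_measure f (Lf : L1 Rplus f) : complex_measure (plane R) R :=
  ComplexMeasure (hyperbola_charge (restr_int Lf.1)) (hyperbola_charge (restr_int Lf.2)).

Lemma fourier_hyperbola f (Lf : L1 Rplus f) (z : R * R) :
  fourier (hyperbola_measure Lf) z =
  cintegral Rplus (fun t => f t * expipi (t * z.1 + t^-1 * z.2)).
Proof.
have [b1 b2] := bounded_measurable_trig z; have mD : measurable (Rplus :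
  set R) by exact: measurable_itv.
have CI h (ih : mu.-integrable Rplus (EFin \o h)) u : bounded_measurable u ->
    charge_integral (hyperbola_charge (restr_int ih)) u =
    Rintegral mu Rplus (fun t => u (hyperbola t) * h t).
  move=> bu.
  rewrite (charge_integral_density measurable_hyperbola (restr_int ih) _ bu); last first.
    by move=> A mA; rewrite hyperbola_chargeE.
  rewrite /Rintegral [in RHS]integral_mkcond; congr fine; apply: eq_integral => t _.
  by rewrite /= !patchE; case: ifP => // _; rewrite mulr0.
have mtrig (w : plane R -> R) : bounded_measurable w -> measurable_fun Rplus (fun t :
  R => w (hyperbola t)).
  move=> bw; apply: measurable_funTS; exact: (measurableT_comp bw.1 measurable_hyperbola).
have iM h (ih : mu.-integrable Rplus (EFin \o h)) u : bounded_measurable u ->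
    mu.-integrable Rplus (EFin \o (fun t => u (hyperbola t) * h t)).
  move=> bu; have [mu_ [C uC]] := bu.
  have := @integrable_mul_bounded _ Rplus h (fun t => u (hyperbola t)) C mD ih (mtrig u bu).
  move=> /(_ (fun t _ => uC _)); apply: eq_integrable => // t _.
  by rewrite /= mulrC.
rewrite /fourier /cmeasure_integral /= !CI//.
have E1 := RintB mD (iM _ Lf.1 _ b1) (iM _ Lf.2 _ b2).
have E2 := RintD mD (iM _ Lf.2 _ b1) (iM _ Lf.1 _ b2).
apply: complex_eq; rewrite /=.
  transitivity (Rintegral mu Rplus (fun t =>
    complex.Re (expipi (t * z.1 + t^-1 * z.2)) * complex.Re (f t) -
    complex.Im (expipi (t * z.1 + t^-1 * z.2)) * complex.Im (f t))); first exact: esym E1.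
  by apply: Rint_eq => t _; rewrite cReM; ring.
transitivity (Rintegral mu Rplus (fun t =>
  complex.Re (expipi (t * z.1 + t^-1 * z.2)) * complex.Im (f t) +
  complex.Im (expipi (t * z.1 + t^-1 * z.2)) * complex.Re (f t))); first exact: esym E2.
by apply: Rint_eq => t _; rewrite cImM; ring.
Qed.

End hyperbola.

(** * The theorem *)

Section conclusion.
Context (R : realType) (alpha gamma theta1 theta2 : R).
Context (alpha_gt0 : 0 < alpha) (gamma_gt0 : 0 < gamma).
Local Notation mu := (@lebesgue_measure R).
Local Notation U := (`]0%R, 1%R[%classic : set R).
Local Notation q := (alpha * gamma).
Local Notation I1q := (`]1%R, q[%classic : set R).
Local Notation zeta := (expipi (theta1 / alpha)).
Local Notation eta := (expipi (theta2 / gamma)).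
Local Notation A := (pre_annihilator alpha gamma theta1 theta2).
Local Notation ABV := (BV_core alpha gamma theta1 theta2).
Context (q1 : 1 < q).
Implicit Types (v F G : R -> R[i]).

Let q0 : 0 < q. Proof. exact: lt_trans q1. Qed.
Let mU : measurable U. Proof. exact: measurable_itv. Qed.
Let mD : measurable (Rplus : set R). Proof. exact: measurable_itv. Qed.
Let z1 : nrm zeta = 1. Proof. exact: nrm_expipi. Qed.
Let e1 : nrm eta = 1. Proof. exact: nrm_expipi. Qed.
Let UD : U `<=` Rplus. Proof. by move=> x; rewrite UE RplusE => /andP[]. Qed.
Let IE (t : R) : I1q t = (1 < t < q) :> Prop. Proof. by rewrite /= in_itv. Qed.

Lemma ABVP F : ABV F <-> period_solution q zeta eta F /\ exists g T, eq_ae Rplus F g /\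
  bv Rplus g T.
Proof.
split=> [[/(normalized_period _ _ _ alpha_gt0 gamma_gt0) sF /BVP[_ b]]|[sF b]]; first by split.
split; first exact/(normalized_period _ _ _ alpha_gt0 gamma_gt0).
by apply/BVP; split=> //; case: sF.
Qed.

Lemma ABV_lin F G (c : R[i]) : ABV F -> ABV G -> ABV (fun x => F x + c * G x).
Proof.
move=> /ABVP[sF [f [T [Ff fT]]]] /ABVP[sG [g [S [Gg gS]]]]; apply/ABVP; split.
  exact: period_solution_lin.
exists (fun x => f x + c * g x), (T + nrm c * S); split; last by apply: bvD => //; exact: bvZ.
by apply: ae_imp2 Ff Gg => x h1 h2 Dx; rewrite h1// h2.
Qed.

Lemma ABV_ae F G : L1 Rplus F -> eq_ae Rplus F G -> ABV G -> ABV F.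
Proof.
move=> LF FG [[LG [f Af Gf]] /BVP[_ [g [T [Gg gT]]]]].
have tr h : eq_ae Rplus G h -> eq_ae Rplus F h.
  by move=> Gh; apply: ae_imp2 FG Gh => x h1 h2 Dx; rewrite h1// h2.
split; first by split=> //; exists f => //; exact: tr.
by apply/BVP; split=> //; exists g, T; split=> //; exact: tr.
Qed.

Lemma ABV_extension v : BV I1q v -> exists2 F, ABV F & eq_ae I1q F v.
Proof.
move=> /BV_slab[//|g [B [T [sg vg]]]].
have [F [S [sF FS Fg]]] := slab_extension q1 z1 e1 sg.
exists F; first by apply/ABVP; split=> //; exists F, S; split=> //; exact: aeW.
by apply: ae_imp vg => x h; rewrite IE => x1q; rewrite Fg// h// IE.
Qed.

Lemma ABV_vanishing D : ABV D -> eq_ae I1q D (fun=> 0) ->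
  eq_ae Rplus D (fun=> 0) \/ [/\ zeta = 1, eta = 1 & cintegral U D <> 0].
Proof.
by move=> /ABVP[sD [g [T [Dg gT]]]] D0; have := homogeneous_unique q1 z1 e1 sD Dg gT D0.
Qed.

Lemma eq_ae_sub F G : eq_ae Rplus (fun x => F x + -1 * G x) (fun=> 0) -> eq_ae Rplus F G.
Proof.
by apply: ae_imp => x h Dx; have := h Dx; rewrite mulN1r => /eqP; rewrite subr_eq0 => /eqP.
Qed.

Lemma ABV_unique v F G : (zeta, eta) <> (1, 1) -> ABV F -> ABV G ->
  eq_ae I1q F v -> eq_ae I1q G v -> eq_ae Rplus F G.
Proof.
move=> ne AF AG Fv Gv; apply: eq_ae_sub.
have [|//|[zE eE _]] := ABV_vanishing (ABV_lin (-1) AF AG); last by case: ne; rewrite zE eE.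
by apply: ae_imp2 Fv Gv => x h1 h2 Ix; rewrite h1// h2// mulN1r subrr.
Qed.

Lemma L1_unit F : L1 Rplus F -> L1 U F.
Proof. by move=> [a b]; split; [exact: integrableS a|exact: integrableS b]. Qed.

(** By [ABV_vanishing], an element of the core that vanishes on (1,q) and has
    integral 0 over (0,1) is zero. So the difference of two extensions is the
    multiple of Psi with the same integral over (0,1). *)
Lemma ABV_line : (zeta, eta) = (1, 1) -> exists Psi, [/\ ABV Psi, ~ eq_ae Rplus Psi (fun=> 0),
  eq_ae I1q Psi (fun=> 0) & forall v, BV I1q v -> exists2 Fv, ABV Fv &
    forall F, L1 Rplus F -> (ABV F /\ eq_ae I1q F v <->
      exists c : R[i], eq_ae Rplus F (fun x => Fv x + c * Psi x))].
Proof.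
move=> zeE; have zE : zeta = 1 := congr1 fst zeE; have eE : eta = 1 := congr1 snd zeE.
have [Psi [S [sP PS P0 PI]]] := vanishing_solution q1.
have AP : ABV Psi.
  by apply/ABVP; rewrite zE eE; split=> //; exists Psi, S; split=> //; exact: aeW.
have P0' : eq_ae I1q Psi (fun=> 0) by apply: aeW => x; rewrite IE; exact: P0.
have LP : L1 Rplus Psi by case: sP.
exists Psi; split=> //.
  move=> Pae; apply: PI; rewrite (cint_ae mU (L1_unit LP) (bvnorm_L1 (bvnorm0 R))).
    by apply: complex_eq => /=; exact: Rint0.
  by apply: ae_imp Pae => x h /UD; exact: h.
move=> v /ABV_extension[Fv AFv Fvv]; exists Fv => // F LF; split.
  move=> [AF FE]; have AD := ABV_lin (-1) AF AFv.
  pose c := cintegral U (fun x => F x + -1 * Fv x) / cintegral U Psi; exists c.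
  have AD' := ABV_lin (- c) AD AP.
  have LD : L1 Rplus (fun x => F x + -1 * Fv x) by case: AD => [[]].
  have [|D0|[_ _]] := ABV_vanishing AD'.
  - apply: ae_imp3 FE Fvv P0' => x h1 h2 h3 Ix.
    by rewrite h1// h2// h3// mulr0 addr0 mulN1r subrr.
  - apply: ae_imp D0 => x h Dx; have := h Dx.
    rewrite mulN1r mulNr => /eqP; rewrite subr_eq0 subr_eq addrC => /eqP ->.
    by rewrite addrC.
  - rewrite cintD//; [|exact: L1_unit|exact: L1Z (L1_unit LP)].
    rewrite cintZ//; last exact: L1_unit.
    rewrite mulNr /c divfK ?subrr//; by apply/eqP.
move=> [c Fc]; split; first exact: ABV_ae Fc (ABV_lin c AFv AP).
have ID : I1q `<=` Rplus by move=> t; rewrite IE RplusE => /andP[t1 _]; exact: lt_trans t1.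
apply: ae_imp3 Fc Fvv P0' => x h1 h2 h3 Ix; rewrite h1; last exact: ID.
by rewrite h2// h3// mulr0 addr0.
Qed.

Lemma ae_scale (a : R) (P : R -> Prop) : 0 < a -> {ae mu, forall x, 0 < x -> P x} ->
  {ae mu, forall x, 0 < x -> P (x / a)}.
Proof.
move=> a0 /(negligible_recip ltr01)/(negligible_recip a0).
by apply: ae_imp => x h x0; have := h x0; rewrite div1r invf_div.
Qed.

Lemma slab_indicator (a b : R) : 1 <= a -> b <= q ->
  slab q (fun x => if a < x < b then 1 else 0) 1 2.
Proof.
move=> a1 bq; split=> //.
- move=> t nt; case: ifP => // /andP[at_ tb]; case: nt.
  by rewrite (le_lt_trans a1 at_) (lt_le_trans tb bq).
- by move=> t; case: ifP => _; rewrite ?nrm1 ?nrm0.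
have b0 : bv `]a, b[ (fun=> 1 : R[i]) 0.
  by exists (fun=> 0) => [x _|x y _ _ _]; rewrite ?lexx// !subrr nrm0.
have := @bv_extend_itv R (fun=> 1) a b 1 0 ler01 (lexx 0) (fun x _ => eq_ind_r (fun c => c <= 1)
  (lexx 1) (nrm1 R)) b0.
by rewrite mulr1 addr0.
Qed.

Lemma A_extension g B T : slab q g B T -> exists2 f, A f &
  {ae mu, forall x, 1 < x < q -> g x = (alpha^-1)%:C * f (x / alpha)}.
Proof.
move=> sg; have [F [S [sF _ Fg]]] := slab_extension q1 z1 e1 sg.
have /(normalized_period _ _ _ alpha_gt0 gamma_gt0)[_ [f Af Ff]] := sF.
exists f => //; apply: ae_imp Ff => x h x1q; rewrite -Fg// h// RplusE.
by case/andP: x1q => x1 _; exact: lt_trans x1.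
Qed.

(** Extend the indicators of n + 1 disjoint intervals of (1,q). If n functions
    spanned A, a nontrivial combination of these extensions would vanish, which
    is impossible on an interval whose coefficient is nonzero. *)
Lemma A_infinite_dimensional : ~ finite_dimensional Rplus A.
Proof.
move=> [n [b [bA bspan]]].
pose a (k : nat) : R := 1 + (q - 1) * (k%:R / n.+1%:R).
have n0 : 0 < n.+1%:R :> R by [].
have qm : 0 < q - 1 by rewrite subr_gt0.
have a1 k : 1 <= a k by rewrite /a lerDl mulr_ge0 ?(ltW qm)// divr_ge0.
have aq k : (k <= n.+1)%N -> a k <= q.
  move=> kn; rewrite /a -lerBrDl -[leRHS]mulr1 ler_pM2l//.
  by rewrite ler_pdivrMr// mul1r ler_nat.
have am k l : (k <= l)%N -> a k <= a l.
  by move=> kl; rewrite /a lerD2l ler_pM2l// ler_pM2r ?invr_gt0// ler_nat.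
have alt k : a k < a k.+1.
  by rewrite /a ltrD2l ltr_pM2l// ltr_pM2r ?invr_gt0// ltr_nat.
pose g (k : nat) : R -> R[i] := fun x => if a k < x < a k.+1 then 1 else 0.
have /choice[f fP] : forall k : 'I_n.+1, exists f, A f /\
    {ae mu, forall x, 1 < x < q -> g k x = (alpha^-1)%:C * f (x / alpha)}.
  move=> k; have [f Af fE] := A_extension (slab_indicator (a1 k) (aq k.+1 (ltn_ord k))).
  by exists f.
have /choice[c cP] : forall k : 'I_n.+1, exists c : 'I_n -> R[i],
    eq_ae Rplus (f k) (fun x => \sum_(i < n) c i * b i x).
  by move=> k; exact: bspan (fP k).1.
pose M := \matrix_(k < n.+1, i < n) c k i.
(* The matrix of coefficients has more rows than columns, so its rows are
   dependent. *)
have /rowV0Pn[v /sub_kermxP vM v0] : kermx M != 0.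
  rewrite -mxrank_eq0 mxrank_ker subn_eq0 -ltnNge ltnS; exact: rank_leq_col.
have cM i : \sum_k v 0 k * c k i = 0.
  have E := congr1 (fun m : 'rV_n => m 0 i) vM; rewrite !mxE in E; rewrite -[RHS]E.
  by apply: eq_bigr => k _; rewrite mxE.
have [j vj] : exists j, v 0 j != 0.
  by apply/existsP; apply: contraT => /existsPn h; case/negP: v0; apply/eqP/rowP => k;
    rewrite mxE; apply/eqP; move: (h k); rewrite negbK.
have ae1 : {ae mu, forall x, forall k : 'I_n.+1, 0 < x -> f k x = \sum_(i < n) c k i * b i x}.
  apply: (@filter_forall _ _ _ _ (ae_filter_ringOfSetsType mu)) => k.
  by apply: ae_imp (cP k) => x h; rewrite -RplusE.
have ae2 : {ae mu, forall x, forall k : 'I_n.+1, 1 < x < q ->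
  g k x = (alpha^-1)%:C * f k (x / alpha)}.
  by apply: (@filter_forall _ _ _ _ (ae_filter_ringOfSetsType mu)) => k; exact: (fP k).2.
have ae3 : {ae mu, forall x, 0 < x -> forall k : 'I_n.+1, f k x = \sum_(i < n) c k i * b i x}.
  by apply: ae_imp ae1 => x h x0 k; exact: h.
have [x [/andP[xa xb] [h1 h2]]] := ae_point (alt j)
  (ae_imp2 (fun x p r => conj p r) ae2 (ae_scale alpha_gt0 ae3)).
have x1 : 1 < x by exact: le_lt_trans xa.
have xq : x < q by exact: lt_le_trans xb (aq _ (ltn_ord j)).
have x0 : 0 < x by exact: lt_trans x1.
have S0 : \sum_k v 0 k * g k x = 0.
  transitivity ((alpha^-1)%:C * \sum_k v 0 k * f k (x / alpha)).
    by rewrite mulr_sumr; apply: eq_bigr => k _; rewrite h1 ?x1// mulrCA.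
  transitivity ((alpha^-1)%:C * \sum_(i < n) (\sum_k v 0 k * c k i) * b i (x / alpha)).
    congr (_ * _); under [RHS]eq_bigr do rewrite mulr_suml.
    rewrite exchange_big; apply: eq_bigr => k _; rewrite h2// mulr_sumr.
    by apply: eq_bigr => i _; rewrite mulrA.
  by rewrite big1 ?mulr0// => i _; rewrite cM mul0r.
case/negP: vj; rewrite -S0 (bigD1 j)//= {1}/g xa xb/= mulr1 big1 ?addr0// => k kj.
rewrite /g; case: ifP => [/andP[ka kb]|_]; last by rewrite mulr0.
exfalso; have [jk|kj'|jk] := ltngtP (nat_of_ord j) k.
- by have := lt_le_trans ka (le_trans (ltW xb) (am _ _ jk)); rewrite ltxx.
- by have := lt_le_trans xa (le_trans (ltW kb) (am _ _ kj')); rewrite ltxx.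
- by case/eqP: kj; apply/val_inj; rewrite /= jk.
Qed.

(** The measure f dt on the hyperbola has the moments of f as values of its
    Fourier transform on the two axes. It is nonzero because its values on the
    strips B x R determine f. *)
Lemma not_Heisenberg :
  ~ Heisenberg_uniqueness_pair Gamma_plus (lattice_cross alpha gamma theta1 theta2).
Proof.
move=> HUP; have [f Af fE] := A_extension (slab_indicator (lexx 1) (lexx q)).
have [Lf f1 f2] := Af.
have c0 (x y : R) : x +i* y = 0 -> x = 0 /\ y = 0 by move=> [-> ->].
have H : forall B, measurable B -> cmeasure (hyperbola_measure Lf) B = 0.
  apply: HUP.
  - move=> B mB B0; rewrite /cmeasure /hyperbola_measure.
    by rewrite (hyperbola_supported Lf.1 mB B0) (hyperbola_supported Lf.2 mB B0).
  - move=> B mB B0; rewrite /cmeasure /hyperbola_measure.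
    by rewrite (hyperbola_abs_continuous Lf.1 mB B0) (hyperbola_abs_continuous Lf.2 mB B0).
  - move=> z Lz; rewrite fourier_hyperbola.
    case: Lz => [[m _ <-]|[m _ <-]] /=.
      rewrite -[RHS](f1 m); apply: cint_eq => t _; rewrite mulr0 addr0; congr (_ * expipi _);
        ring.
    rewrite -[RHS](f2 m); apply: cint_eq => t _; rewrite mulr0 add0r; congr (_ * expipi _); ring.
have zero h (ih : mu.-integrable Rplus (EFin \o h)) :
    (forall B, measurable B -> fine (hyperbola_charge (restr_int ih) B) = 0) ->
    {ae mu, forall x, 0 < x -> h x = 0}.
  move=> h0; have ih' := restr_int ih.
  have := @integral_ae_eq _ _ _ mu setT measurableT (cst 0%E) _ ih'.
  have mc : measurable_fun [set: measurableTypeR R] (cst 0%E : _ ->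
    \bar R) by exact: measurable_cst.
  move=> /(_ mc) E; have {}E := E _.
  have : ae_eq mu setT (EFin \o (h \_ Rplus)) (cst 0%E).
    apply: E => B _ mB; rewrite [RHS]integral0_eq//.
    have mB' : measurable (fst @^-1` B : set (plane R)).
      by rewrite -[_ @^-1` _]setTI; exact: measurable_fst.
    have := h0 _ mB'; rewrite hyperbola_chargeE => h1.
    rewrite -[LHS]fineK; first by rewrite h1.
    by apply: integrable_fin_num => //; exact: integrableS ih'.
  apply: ae_imp => x hx x0; have := hx I; rewrite /= patchE mem_set ?RplusE//.
  by case.
have r0 := zero _ Lf.1 (fun B mB => (c0 _ _ (H B mB)).1).
have i0 := zero _ Lf.2 (fun B mB => (c0 _ _ (H B mB)).2).
have F0 := ae_scale alpha_gt0 (ae_imp2 (fun x p r x0 => conj (p x0) (r x0)) r0 i0).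
have [x [x1q [h1 h2]]] := ae_point q1 (ae_imp2 (fun x p r => conj p r) fE F0).
have [a b] := h2 (lt_trans ltr01 (andP x1q).1).
have := h1 x1q; rewrite x1q (_ : f (x / alpha) = 0); last exact: complex_eq.
by rewrite mulr0 => /eqP; rewrite oner_eq0.
Qed.

End conclusion.

Theorem theorem1p1 (R : realType) (alpha gamma theta1 theta2 : R)
    (alpha_gt0 : 0 < alpha) (gamma_gt0 : 0 < gamma) :
  let q := alpha * gamma in
  let zeta := expipi (theta1 / alpha) in
  let eta := expipi (theta2 / gamma) in
  let A := pre_annihilator alpha gamma theta1 theta2 in
  let ABV := BV_core alpha gamma theta1 theta2 in
  let I1q : set R := `]1, q[%classic in
  1 < q ->
  [/\ (* (i) *)
      forall v, BV I1q v -> exists2 F, ABV F & eq_ae I1q F v,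
      (* (ii) *)
      ((zeta, eta) <> (1, 1) ->
        forall v, BV I1q v -> forall F G, ABV F -> ABV G ->
          eq_ae I1q F v -> eq_ae I1q G v -> eq_ae Rplus F G) /\
      ((zeta, eta) = (1, 1) ->
        exists Psi, [/\ ABV Psi, ~ eq_ae Rplus Psi (fun=> 0),
          eq_ae I1q Psi (fun=> 0) &
          forall v, BV I1q v -> exists2 Fv, ABV Fv &
            forall F, L1 Rplus F ->
              (ABV F /\ eq_ae I1q F v <->
               exists c : R[i], eq_ae Rplus F (fun x => Fv x + c * Psi x))]) &
      (* (iii) *)
      ~ finite_dimensional Rplus A /\
      ~ Heisenberg_uniqueness_pair Gamma_plus
          (lattice_cross alpha gamma theta1 theta2)].
Proof.
move=> q zeta eta A ABV I1q q1; split.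
- by move=> v; exact: ABV_extension.
- split; last exact: ABV_line.
  by move=> ne v _ F G; exact: ABV_unique.
- by split; [exact: A_infinite_dimensional|exact: not_Heisenberg].
Qed.
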